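(* There exist absolute constants $C,C_1,C_2,c_3,C_4>0$ such that the following holds. Let $d,n,k,m$ be positive integers with $k\le n$, $\gamma\in(0,1)$, $\delta\in(0,1)$, $\alpha\in(0,1]$, $v\in\mathbb{S}^{d-1}$. Let $f(W,x)=\sum_{j=1}^{2m}(-1)^j\sigma(\langle w_j,x\rangle)$ with $\sigma(z)=\max(z,\alpha z)$, where $w_j$ is the $j$-th row of $W\in\mathbb{R}^{2m\times d}$. Let $(X,\hat y,\mathbf y,x,y)\sim\mathcal{D}(d,n,k,\gamma,v)$, let $\eta,\lambda>0$ satisfy $\eta\le\frac{1}{mn\max_i\|x_i\|^2}$ and $\lambda\le\frac{\sqrt\alpha}{m\min_i\|x_i\|}$, and let $W=\mathcal{A}_{GD}(X,\hat y,\eta,\lambda)$ be the output of gradient descent on the hinge loss. If $$n\ge C_1\log\tfrac1\delta,\qquad d\ge C_2n,\qquad k\le c_3\alpha^2n,\qquad\gamma\ge\frac{C_4}{k},$$ then: 1. almost surely, $\mathcal{A}_{GD}$ terminates after a finite number of updates and $L(W,X,\hat y)=0$; 2. with probability at least $1-\delta$ over the training data $(X,\hat y)$, $$\mathbb{P}\big(yf(W,x)\le0\,\big|\,X,\hat y\big)\le\exp\left(-C\cdot\frac{\alpha^2d}{k}\right).$$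
   Context: Data model $\mathcal D(d,n,k,\gamma,v)$: the true labels $\mathbf y=(y_1,\dots,y_n)$ are i.i.d. uniform on $\{\pm1\}$; the noise vectors $\mathbf n_1,\dots,\mathbf n_n$ are i.i.d. $\mathcal N(0,\frac1d(I_d-vv^T))$, independent of $\mathbf y$; $X\in\mathbb R^{n\times d}$ has rows $x_i=\sqrt\gamma\,y_iv+\sqrt{1-\gamma}\,\mathbf n_i$. $\mathcal B\subset[n]$ is any subset with $|\mathcal B|=k$ chosen independently of $\mathbf y$; the observed labels are $\hat y_i=-y_i$ for $i\in\mathcal B$ and $\hat y_i=y_i$ for $i\notin\mathcal B$. The test label $y$ is uniform on $\{\pm1\}$ and the test input is $x=\sqrt\gamma\,yv+\sqrt{1-\gamma}\,\mathbf n$ with $\mathbf n\sim\mathcal N(0,\frac1d(I_d-vv^T))$; $y$ and $\mathbf n$ are independent of each other and of the training data. $(X,\hat y)$ is the training data. Gradient descent: $\dot\sigma(z)=1$ if $z\ge0$, $\dot\sigma(z)=\alpha$ if $z<0$; $L(W,X,\hat y)=\sum_{i=1}^n\max\{0,1-\hat y_if(W,x_i)\}$. From an initialization $W^{(0)}$, for $t\ge1$, $j\in[2m]$, $$w_j^{(t)}=w_j^{(t-1)}+\eta(-1)^j\sum_{i\in\mathcal F^{(t-1)}}\hat y_i\,\dot\sigma(\langle w_j^{(t-1)},x_i\rangle)\,x_i,\qquad \mathcal F^{(t)}=\{i\in[n]:\hat y_if(W^{(t)},x_i)<1\}.$$ $\mathcal A_{GD}(X,\hat y,\eta,\lambda)$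 denotes the limit $\lim_tW^{(t)}$; statements about it are meant for every initialization $W^{(0)}$ with $\|w_j^{(0)}\|\le\lambda$ for all $j\in[2m]$ (the choice not depending on the test point). It terminates after finitely many updates if $W^{(t)}=W^{(T)}$ for some $T$ and all $t\ge T$. *)

(* Defs.v *)
From HB Require Import structures.
From mathcomp Require Import all_boot all_order all_algebra.
From mathcomp Require Import all_classical all_reals all_analysis.
Set Implicit Arguments.
Unset Strict Implicit.
Unset Printing Implicit Defensive.
Import Order.TTheory GRing.Theory Num.Theory.
Import numFieldNormedType.Exports.
Local Open Scope classical_set_scope.
Local Open Scope ring_scope.

(* Matrices carry the product sigma-algebra, i.e. the one generated by the    *)
(* entries (the Borel sets of R^(p*q) when T is the reals).                   *)
Definition measure_matrix_display : measure_display -> measure_display.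
Proof. exact. Qed.

Section measurable_matrix.
Context {disp : measure_display} (T : measurableType disp) (p q : nat).

Definition matrix_cylinders : set_system 'M[T]_(p, q) :=
  [set A | exists i j, exists2 U : set T,
     measurable U & A = [set M : 'M[T]_(p, q) | U (M i j)]].

Let matrix_set0 : <<s matrix_cylinders >> set0.
Proof. exact: sigma_algebra0. Qed.

Let matrix_setC A :
  <<s matrix_cylinders >> A -> <<s matrix_cylinders >> (~` A).
Proof. exact: sigma_algebraC. Qed.

Let matrix_bigcup (F : (set 'M[T]_(p, q))^nat) :
  (forall i, <<s matrix_cylinders >> (F i)) ->
  <<s matrix_cylinders >> (\bigcup_i F i).
Proof. exact: sigma_algebra_bigcup. Qed.

HB.instance Definition _ :=
  @isMeasurable.Build (measure_matrix_display disp) 'M[T]_(p, q)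
    <<s matrix_cylinders >> matrix_set0 matrix_setC matrix_bigcup.

End measurable_matrix.

Section probability_notions.
Context {disp : measure_display} {Om : measurableType disp} {R : realType}.
Implicit Type P : probability Om R.

Definition sigma_of {disp' : measure_display} {T : measurableType disp'}
    (f : Om -> T) : set_system Om :=
  preimage_set_system [set: Om] f measurable.

Definition mutually_independent P (I : finType) (F : I -> set_system Om) :=
  forall (J : {set I}) (A : I -> set Om), (forall i, i \in J -> F i (A i)) ->
    P (\bigcap_(i in [set` J]) A i) = (\prod_(i in J) P (A i))%E.

Definition independent P (F G : set_system Om) :=
  forall A B, F A -> G B -> P (A `&` B) = (P A * P B)%E.

(* g is a version of the conditional probability P(A | G).                    *)
Definition is_cond_prob P (G : set_system Om) (A : set Om) (g : Om -> R) :=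
  [/\ forall U : set R, measurable U -> G (g @^-1` U),
      P.-integrable [set: Om] (EFin \o g) &
      forall B, G B -> (\int[P]_(w in B) (g w)%:E)%E = P (A `&` B)].

Definition uniform_sign P (y : Om -> R) :=
  [/\ measurable_fun [set: Om] y,
      P [set w | y w = 1] = (2^-1)%:E &
      P [set w | y w = -1] = (2^-1)%:E].

Definition standard_normal P d (g : Om -> 'rV[R]_d) :=
  [/\ measurable_fun [set: Om] g,
      mutually_independent P (fun l : 'I_d => sigma_of (fun w => g w ord0 l)) &
      forall (l : 'I_d) (U : set R), measurable U ->
        P [set w | U (g w ord0 l)] = normal_prob 0 1 U].

End probability_notions.

(* Z ~ N(0, Sigma): Z has the law of Sigma^(1/2) g, where Sigma^(1/2) is the  *)
(* symmetric positive semidefinite square root of Sigma (which may be         *)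
(* singular) and g is a standard normal vector on some probability space.     *)
(* Vectors are rows, so S g is written g *m S.                                *)
Definition centered_gaussian {R : realType} {disp : measure_display}
    {Om : measurableType disp} (P : probability Om R) d
    (Z : Om -> 'rV[R]_d) (Sigma : 'M[R]_d) :=
  measurable_fun [set: Om] Z /\
  exists S : 'M[R]_d,
    [/\ S^T = S, forall u : 'rV[R]_d, 0 <= (u *m S *m u^T) ord0 ord0,
        S *m S = Sigma &
        exists (disp' : measure_display) (Om' : measurableType disp')
               (P' : probability Om' R) (g : Om' -> 'rV[R]_d),
          standard_normal P' g /\
          forall U : set 'rV[R]_d, measurable U ->
            P (Z @^-1` U) = P' [set w | U (g w *m S)]].

Section euclidean.
Context {R : realType} {d : nat}.

Definition dotp (u w : 'rV[R]_d) : R := (u *m w^T) ord0 ord0.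

(* The norm `|u| of the library on matrices is the sup norm. *)
Definition enorm (u : 'rV[R]_d) : R := Num.sqrt (dotp u u).

End euclidean.

Section data_model.
Context {R : realType}.

Definition data_point d (gamma : R) (v : 'rV[R]_d) (y : R) (z : 'rV[R]_d) :
    'rV[R]_d :=
  (Num.sqrt gamma * y) *: v + Num.sqrt (1 - gamma) *: z.

Definition data_matrix d n (gamma : R) (v : 'rV[R]_d) (y : 'rV[R]_n)
    (N : 'M[R]_(n, d)) : 'M[R]_(n, d) :=
  \matrix_(i < n) data_point gamma v (y ord0 i) (row i N).

Definition flip_labels n (B : {set 'I_n}) (y : 'rV[R]_n) : 'rV[R]_n :=
  \row_(i < n) (if i \in B then - y ord0 i else y ord0 i).

Definition noise_cov d (v : 'rV[R]_d) : 'M[R]_d :=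
  d%:R^-1 *: (1%:M - v^T *m v).

Context {disp : measure_display} {Om : measurableType disp}.

Definition training_data d n (gamma : R) (v : 'rV[R]_d) (y : Om -> 'rV[R]_n)
    (N : Om -> 'M[R]_(n, d)) (B : Om -> {set 'I_n}) (w : Om) :
    'M[R]_(n, d) * 'rV[R]_n :=
  (data_matrix gamma v (y w) (N w), flip_labels (B w) (y w)).

(* y, N, B: true labels, noise vectors (the rows of N) and set of flipped     *)
(* indices; yt, nt: label and noise vector of the test point. The set B may   *)
(* be random; the finite type of its values has the discrete sigma-algebra.   *)
Record data_model (P : probability Om R) d n (k : nat) (gamma : R)
    (v : 'rV[R]_d) (y : Om -> 'rV[R]_n) (N : Om -> 'M[R]_(n, d))
    (B : Om -> {set 'I_n}) (yt : Om -> R) (nt : Om -> 'rV[R]_d) : Prop :=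
  DataModel {
    dm_y_unif : forall i, uniform_sign P (fun w => y w ord0 i);
    dm_y_indep :
      mutually_independent P (fun i : 'I_n => sigma_of (fun w => y w ord0 i));
    dm_N_gauss :
      forall i, centered_gaussian P (fun w => row i (N w)) (noise_cov v);
    dm_N_indep :
      mutually_independent P (fun i : 'I_n => sigma_of (fun w => row i (N w)));
    dm_yN_indep : independent P (sigma_of y) (sigma_of N);
    dm_B_meas : forall S, measurable (B @^-1` [set S]);
    dm_B_card : forall w, #|B w| = k;
    dm_B_indep :
      independent P (preimage_set_system [set: Om] B setT) (sigma_of y);
    dm_yt_unif : uniform_sign P yt;
    dm_nt_gauss : centered_gaussian P nt (noise_cov v);
    dm_test_indep : independent P (sigma_of yt) (sigma_of nt);
    dm_test_train_indep :
      independent P (sigma_of (fun w => (yt w, nt w)))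
        (sigma_of (training_data gamma v y N B))
  }.

End data_model.

Section network.
Context {R : realType} {d n m : nat}.
Variable alpha : R.
Implicit Types (W : 'M[R]_(m.*2, d)) (x : 'rV[R]_d).
Implicit Types (X : 'M[R]_(n, d)) (yh : 'rV[R]_n).

Definition leaky_relu (z : R) : R := Num.max z (alpha * z).

Definition leaky_relu' (z : R) : R := if 0 <= z then 1 else alpha.

(* The neuron numbered j + 1 in 1, ..., 2m has the index j : 'I_(2m). *)
Definition out_sign (j : 'I_(m.*2)) : R := (-1) ^+ j.+1.

Definition network W x : R :=
  \sum_(j < m.*2) out_sign j * leaky_relu (dotp (row j W) x).

Definition hinge_loss W X yh : R :=
  \sum_(i < n) Num.max 0 (1 - yh ord0 i * network W (row i X)).

Definition active_set W X yh : {set 'I_n} :=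
  [set i | yh ord0 i * network W (row i X) < 1]%SET.

Definition gd_step (eta : R) X yh W : 'M[R]_(m.*2, d) :=
  \matrix_(j < m.*2)
    (row j W + (eta * out_sign j) *:
       \sum_(i in active_set W X yh)
         (yh ord0 i * leaky_relu' (dotp (row j W) (row i X))) *: row i X).

Definition gd (eta : R) X yh (W0 : 'M[R]_(m.*2, d)) (t : nat) :
    'M[R]_(m.*2, d) := iter t (gd_step eta X yh) W0.

Definition gd_output (eta : R) X yh (W0 : 'M[R]_(m.*2, d)) : 'M[R]_(m.*2, d) :=
  lim (gd eta X yh W0 t @[t --> \oo]).

Definition gd_terminates (eta : R) X yh (W0 : 'M[R]_(m.*2, d)) : Prop :=
  exists T, forall t, (T <= t)%N -> gd eta X yh W0 t = gd eta X yh W0 T.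

Definition max_sqnorm X : R := \big[Num.max/0]_(i < n) enorm (row i X) ^+ 2.

Definition max_norm X : R := \big[Num.max/0]_(i < n) enorm (row i X).

(* The starting value max_norm X is neutral as soon as 0 < n. *)
Definition min_norm X : R :=
  \big[Num.min/max_norm X]_(i < n) enorm (row i X).

Definition gd_admissible X (eta lam : R) (W0 : 'M[R]_(m.*2, d)) : Prop :=
  [/\ 0 < eta, 0 < lam,
      eta <= 1 / (m%:R * n%:R * max_sqnorm X),
      lam <= Num.sqrt alpha / (m%:R * min_norm X) &
      forall j, enorm (row j W0) <= lam].

End network.

(* Main.v *)
(* Let N be the noise matrix. A union bound over the integer vectors of an
   l1-ball of radius Mn, at most (8M)^n many, shows that for M = 2^(32 r), with
   probability at least 1 - 2^(-5rd), |p|^2 <= M |pN|^2 for all p and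
   sum_i |<w, N_i>| <= sqrt(Mn) |w| for all w. The first bound yields a vector
   ws separating the observed labels with margin 1 and
   (1 - gamma) |ws|^2 <= 1/gamma + 4kM: a multiple of v plus a combination of
   the noise vectors which corrects the flipped labels. The perceptron argument
   makes gradient descent stop at zero loss with sum_j |w_j| <= 6 |ws| / alpha;
   letting r grow, this holds almost surely.

   With r = 1, the second bound shows that the noise cannot account for the
   margin at the many unflipped points of either label, so that the output has
   margin 1/2 at sqrt(gamma) s v for s = 1, -1. A test error then requires
   sqrt(1 - gamma) sum_j |<w_j, n>| >= 1/2, an event whose probability is
   bounded through exponential moments since the w_j do not depend on n. *)

Require Import Defs.
From HB Require Import structures.
From mathcomp Require Import all_boot all_order all_algebra.
From mathcomp Require Import all_classical all_reals all_analysis.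
From mathcomp Require Import measurable_realfun.
From mathcomp Require Import ring lra zify.
Import Order.TTheory GRing.Theory Num.Theory.
Import numFieldNormedType.Exports.
Local Open Scope classical_set_scope.
Local Open Scope ring_scope.

Set Implicit Arguments.
Unset Strict Implicit.
Unset Printing Implicit Defensive.

(** * Integration against laws of random variables *)

(** The union bound succeeds for every [M] because the probability that [zN] is short is
    polynomially small in [M]: it is of order [M^(-(d-1)/2)] up to factors [C^d], against about
    [M^n] net points, so [d >= 8n] leaves room. Enlarging [M] thus drives the failure probability to
    0 at fixed [n] and [d], which ordinary concentration around the mean would not do; this is why
    one estimate serves both conclusions. The obstacle is the law of [|zN|^2]: the covariance is
    singular and each row is only known to have the law of some [gS]. Squares are therefore
    linearised by an auxiliary standard normal [g], through [exp(-|x|^2/2) = E cos <g,x>] and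
    [exp(|x|^2/2) = E exp <g,x>]; exchanging the two expectations leaves a quadratic form in [g]
    alone. Hence the detour through cosine transforms, kept real by carrying a phase [c]. Norms of
    weights always occur multiplied by [sqrt(1 - gamma)], so that no estimate degenerates as [gamma]
    tends to 1. Goodness is a property of the observed data, since the event [E] must belong to
    their sigma-algebra. *)

Section simple_function_reduction.
Import HBNNSimple.
Context d d' (T : measurableType d) (T' : measurableType d') (R : realType).
Variables (mu : {measure set T -> \bar R}) (f : T -> T') (psi : T -> R).
Hypotheses (mf : measurable_fun setT f) (mpsi : measurable_fun setT psi).
Hypothesis psi0 : forall x, 0 <= psi x.

Lemma ge0_integral_comp_nnsfun (g : {nnsfun T' >-> R}) :
  (\int[mu]_x (psi x * g (f x))%:E =
   \sum_(r \in range g)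
     r%:E * \int[mu]_x (psi x * \1_(g @^-1` [set r]) (f x))%:E)%E.
Proof.
have mI r : measurable (g @^-1` [set r]) by [].
have mIf r : measurable_fun setT (fun x => \1_(g @^-1` [set r]) (f x) : R).
  by apply: (measurableT_comp (measurable_indic (mI r)) mf).
transitivity (\int[mu]_x
   (\sum_(r \in range g) (psi x * (r * \1_(g @^-1` [set r]) (f x)))%:E))%E.
  apply: eq_integral => x _; rewrite fsumEFin//; congr EFin.
  rewrite [in LHS]fimfunE !fsbig_finite//= mulr_sumr.
  exact: eq_bigr.
rewrite ge0_integral_fsum//; last 2 first.
- move=> r; apply/measurable_EFinP; apply: measurable_funM => //.
  exact: measurable_funM.
- move=> r y _; rewrite lee_fin mulr_ge0//.
  by have := nnfun_muleindic_ge0 g r (f y); rewrite lee_fin.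
apply: eq_fsbigr => r; rewrite inE => -[z _ hz].
have r0 : 0 <= r by rewrite -hz.
under eq_integral do rewrite mulrCA EFinM.
rewrite ge0_integralZl//.
- by apply/measurable_EFinP; apply: measurable_funM.
- by move=> x _; rewrite lee_fin mulr_ge0// indicE ler0n.
Qed.

Lemma cvg_integral_comp_nnsfun_approx (phi : T' -> R)
  (mphi : measurable_fun setT (EFin \o phi)) : (forall x, 0 <= phi x) ->
  (\int[mu]_x (psi x * phi (f x))%:E =
   lim (\int[mu]_x (psi x * nnsfun_approx measurableT mphi n (f x))%:E
     @[n --> \oo]))%E.
Proof.
move=> phi0; set g := nnsfun_approx measurableT mphi.
have mg n : measurable_fun setT (g n : T' -> R) by exact/measurable_funP.
rewrite -monotone_convergence//.
- apply: eq_integral => x _; apply/esym/cvg_lim => //.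
  under eq_fun do rewrite EFinM.
  rewrite EFinM; apply: cvgeZl => //.
  by apply: (@cvg_nnsfun_approx _ _ _ _ measurableT _ mphi) => //= z _;
    rewrite lee_fin.
- move=> n; apply/measurable_EFinP; apply: measurable_funM => //.
  exact: (measurableT_comp (mg n) mf).
- by move=> n x _; rewrite lee_fin mulr_ge0.
- move=> x _ m n mn; rewrite lee_fin ler_wpM2l//.
  by have /lefP/(_ (f x)) := nd_nnsfun_approx measurableT mphi mn.
Qed.

End simple_function_reduction.

Section eq_integral_comp.
Import HBNNSimple.

(** Equality on indicators passes to simple functions by linearity and to nonnegative functions by
    monotone convergence. The weights [psi1], [psi2] make one statement cover densities (a normal
    density under Lebesgue measure) and independence (the product of the other factors). *)
Lemma ge0_eq_integral_comp d1 d2 d' (T1 : measurableType d1)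
    (T2 : measurableType d2) (T' : measurableType d') (R : realType)
    (mu1 : {measure set T1 -> \bar R}) (mu2 : {measure set T2 -> \bar R})
    (f1 : T1 -> T') (f2 : T2 -> T') (psi1 : T1 -> R) (psi2 : T2 -> R)
    (phi : T' -> R) :
  measurable_fun setT f1 -> measurable_fun setT f2 ->
  measurable_fun setT psi1 -> measurable_fun setT psi2 ->
  (forall x, 0 <= psi1 x) -> (forall x, 0 <= psi2 x) ->
  (forall A, measurable A -> \int[mu1]_x (psi1 x * \1_A (f1 x))%:E =
                             \int[mu2]_x (psi2 x * \1_A (f2 x))%:E)%E ->
  measurable_fun setT phi -> (forall x, 0 <= phi x) ->
  (\int[mu1]_x (psi1 x * phi (f1 x))%:E =
   \int[mu2]_x (psi2 x * phi (f2 x))%:E)%E.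
Proof.
move=> mf1 mf2 mpsi1 mpsi2 psi10 psi20 E mphi phi0.
have mphi' : measurable_fun setT (EFin \o phi) by exact/measurable_EFinP.
rewrite !(cvg_integral_comp_nnsfun_approx _ _ _ _ mphi')//.
set g := nnsfun_approx measurableT mphi'.
congr (lim (_ @ \oo)); apply/funext => n; rewrite !ge0_integral_comp_nnsfun//.
by apply: eq_fsbigr => r _; rewrite E.
Qed.

End eq_integral_comp.

Lemma eq_law_ge0_integral d1 d2 d' (T1 : measurableType d1)
    (T2 : measurableType d2) (T' : measurableType d') (R : realType)
    (mu1 : {measure set T1 -> \bar R}) (mu2 : {measure set T2 -> \bar R})
    (f1 : T1 -> T') (f2 : T2 -> T') (phi : T' -> R) :
  measurable_fun setT f1 -> measurable_fun setT f2 ->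
  (forall A, measurable A -> mu1 (f1 @^-1` A) = mu2 (f2 @^-1` A)) ->
  measurable_fun setT phi -> (forall x, 0 <= phi x) ->
  (\int[mu1]_x (phi (f1 x))%:E = \int[mu2]_x (phi (f2 x))%:E)%E.
Proof.
move=> mf1 mf2 E mphi phi0.
have mpre d (T : measurableType d) (f : T -> T') A : measurable_fun setT f ->
    measurable A -> measurable (f @^-1` A).
  by move=> mf mA; rewrite -[X in measurable X]setTI; exact: mf.
transitivity (\int[mu1]_x (cst 1 x * phi (f1 x))%:E)%E.
  by apply: eq_integral => x _; rewrite mul1r.
transitivity (\int[mu2]_x (cst 1 x * phi (f2 x))%:E)%E; last first.
  by apply: eq_integral => x _; rewrite mul1r.
apply: ge0_eq_integral_comp => // A mA.
transitivity (\int[mu1]_x (\1_(f1 @^-1` A) x)%:E)%E.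
  by apply: eq_integral => x _; rewrite mul1r.
transitivity (\int[mu2]_x (\1_(f2 @^-1` A) x)%:E)%E; last first.
  by apply: eq_integral => x _; rewrite mul1r.
rewrite (integral_indic mu1 measurableT (mpre _ _ _ _ mf1 mA)).
by rewrite (integral_indic mu2 measurableT (mpre _ _ _ _ mf2 mA)) !setIT E.
Qed.

Lemma measurable_prod_cond d (T : measurableType d) (R : realType)
    (I : finType) (p : pred I) (h : I -> T -> R) :
  (forall i, p i -> measurable_fun setT (h i)) ->
  measurable_fun setT (fun x => \prod_(i | p i) h i x).
Proof.
move=> mh; under eq_fun do rewrite -big_filter.
by apply: measurable_prod => i; rewrite mem_filter => /andP[/mh].
Qed.

Lemma bounded_integrable d (T : measurableType d) (R : realType)
    (P : probability T R) (f : T -> R) (M : R) :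
  measurable_fun setT f -> (forall x, `|f x| <= M) ->
  P.-integrable setT (fun x => (f x)%:E).
Proof.
move=> mf fM; apply: (@le_integrable _ _ _ P setT measurableT _ (cst M%:E)).
- exact/measurable_EFinP.
- move=> x _ /=; rewrite lee_fin (le_trans (fM x))// ler_norm //.
- apply/integrableP; split; first exact: measurable_cst.
  by under eq_integral do rewrite /=; rewrite integral_cst//= probability_setT mule1 ltry.
Qed.

Section independent_products.
Context d (Om : measurableType d) (R : realType) (P : probability Om R).
Context (I : finType) d' (T : measurableType d') (f : I -> Om -> T).
Hypothesis mf : forall i, measurable_fun setT (f i).
Hypothesis indep : mutually_independent P (fun i => sigma_of (f i)).

Let independent_prod_indic (A : I -> set T) : (forall i, measurable (A i)) ->
  (\int[P]_w (\prod_i \1_(A i) (f i w))%:E =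
   \prod_i \int[P]_w (\1_(A i) (f i w))%:E)%E.
Proof.
move=> mA.
have mfA i : measurable (f i @^-1` A i).
  by rewrite -[X in measurable X]setTI; exact: mf.
have := @indep [set: I]%SET (fun i => f i @^-1` A i).
have /[swap]/[apply] : forall i, i \in [set: I]%SET ->
    sigma_of (f i) (f i @^-1` A i).
  by move=> i _; exists (A i) => //; rewrite setTI.
have -> : (\prod_(i in [set: I]%SET) P (f i @^-1` A i))%E =
          (\prod_i \int[P]_w (\1_(A i) (f i w))%:E)%E.
  apply: eq_big => [i|i _]; first by rewrite inE.
  transitivity (\int[P]_w (\1_(f i @^-1` A i) w)%:E)%E => //.
  by rewrite integral_indic// setIT.
move=> <-.
set B := \bigcap_(i in _) _.
have mB : measurable B by apply: fin_bigcap_measurable => // i _; exact: mfA.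
transitivity (\int[P]_w (\1_B w)%:E)%E; last by rewrite integral_indic// setIT.
apply: eq_integral => w _; congr EFin; rewrite indicE.
case: (boolP (w \in B)) => [/set_mem wB|wB].
  rewrite big1// => i _; rewrite indicE mem_set//.
  by apply: wB; rewrite /= inE.
have [i wi] : exists i, ~ A i (f i w).
  apply/existsNP => h; move/negP: wB; apply; apply/mem_set => i _.
  exact: h.
rewrite (bigD1 i)//= indicE memNset//.
by rewrite mul0r.
Qed.

(** Independence settles products of indicators. The factors are then generalised one at a time:
    with the others frozen as a weight, both sides are integrals of the same function of [f k], and
    it suffices to compare them on indicators. *)
Lemma ge0_independent_integral_prod (phi : I -> T -> R) :
  (forall i, measurable_fun setT (phi i)) -> (forall i x, 0 <= phi i x) ->
  (forall i, \int[P]_w (phi i (f i w))%:E < +oo)%E ->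
  (\int[P]_w (\prod_i phi i (f i w))%:E =
   \prod_i \int[P]_w (phi i (f i w))%:E)%E.
Proof.
(* The list [s] holds the indices whose factor is allowed not to be an indicator; the induction is
   on [s]. *)
have : forall s : seq I, forall phi : I -> T -> R,
  (forall i, measurable_fun setT (phi i)) -> (forall i x, 0 <= phi i x) ->
  (forall i, \int[P]_w (phi i (f i w))%:E < +oo)%E ->
  (forall i, i \notin s -> exists2 A, measurable A & phi i = \1_A) ->
  (\int[P]_w (\prod_i phi i (f i w))%:E =
   \prod_i \int[P]_w (phi i (f i w))%:E)%E; last first.
  move=> + mphi phi0 phioo => /(_ (enum I) phi mphi phi0 phioo); apply => i.
  by rewrite mem_enum.
elim => [phi0 mphi phi00 phioo phiE|k s IH {}phi mphi phi0 phioo phiE].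
  have /choice[A AE] : forall i, exists A, measurable A /\ phi0 i = \1_A.
    by move=> i; have [|A mA AE] := phiE i => //; exists A.
  have -> : phi0 = fun i => \1_(A i) by apply/funext => i; rewrite (AE i).2.
  by apply: independent_prod_indic => i; exact: (AE i).1.
pose psi w := \prod_(i | i != k) phi i (f i w).
have mphif i : measurable_fun setT (fun w => phi i (f i w)).
  exact: (measurableT_comp (mphi i) (mf i)).
have mpsi : measurable_fun setT psi by exact: measurable_prod_cond.
have psi0 w : 0 <= psi w by apply: prodr_ge0 => i _.
pose c := (\prod_(i | i != k) \int[P]_w (phi i (f i w))%:E)%E.
have intge0 i : (0 <= \int[P]_w (phi i (f i w))%:E)%E.
  by apply: integral_ge0 => w _; rewrite lee_fin.
have cfin : c \is a fin_num.
  by apply: prode_fin_num => i _; rewrite ge0_fin_numE.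
have c0 : 0 <= fine c.
  by apply: fine_ge0; apply: prode_ge0 => i _; exact: intge0.
transitivity (\int[P]_w (psi w * phi k (f k w))%:E)%E.
  apply: eq_integral => w _; congr EFin; rewrite (bigD1 k)//= mulrC.
  by congr (_ * _).
transitivity (\int[P]_w (cst (fine c) w * phi k (f k w))%:E)%E; last first.
  rewrite [LHS](_ : _ =
    \int[P]_w ((fine c)%:E * (phi k (f k w))%:E))%E//.
  rewrite ge0_integralZl//; last 2 first.
  - exact/measurable_EFinP.
  - by move=> w _; rewrite lee_fin.
  by rewrite fineK// muleC [RHS](bigD1 k).
apply: ge0_eq_integral_comp => // A mA.
have mIA : measurable_fun setT (fun w => \1_A (f k w) : R).
  by apply: (measurableT_comp (measurable_indic mA) (mf k)).
pose phi' i : T -> R := if i == k then \1_A else phi i.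
transitivity (\int[P]_w (\prod_i phi' i (f i w))%:E)%E.
  apply: eq_integral => w _; congr EFin; rewrite (bigD1 k)//= /phi' eqxx mulrC.
  by congr (_ * _); apply: eq_bigr => i /negbTE ->.
rewrite IH.
- rewrite (bigD1 k)//= {1}/phi' eqxx.
  rewrite [RHS](_ : _ =
    \int[P]_w ((fine c)%:E * (\1_A (f k w))%:E))%E//.
  rewrite ge0_integralZl//; last exact/measurable_EFinP.
  rewrite fineK// muleC; congr (_ * _)%E.
  by apply: eq_bigr => i ik; rewrite /phi' (negbTE ik).
- by move=> i; rewrite /phi'; case: ifP => // _; exact: measurable_indic.
- by move=> i x; rewrite /phi'; case: ifP => // _; rewrite indicE ler0n.
- move=> i; rewrite /phi'; case: ifPn => // _.
  have mfiA : measurable (f i @^-1` A).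
    by rewrite -[X in measurable X]setTI; exact: mf.
  rewrite [X in (X < _)%E](_ : _ = \int[P]_w (\1_(f i @^-1` A) w)%:E)%E//.
  by rewrite integral_indic// setIT (le_lt_trans (probability_le1 _ _))// ltry.
- move=> i si; rewrite /phi'; case: (eqVneq i k) => [_|ik]; first by exists A.
  by apply: phiE; rewrite inE negb_or ik.
Qed.

(** Both sides are linear in each factor, so a factor of arbitrary sign is written as the difference
    of the nonnegative functions [phi k + M] and [M], one index at a time. *)
Lemma independent_Rintegral_prod (phi : I -> T -> R) (M : R) :
  (forall i, measurable_fun setT (phi i)) -> (forall i x, `|phi i x| <= M) ->
  \int[P]_w (\prod_i phi i (f i w)) = \prod_i \int[P]_w (phi i (f i w)).
Proof.
move: phi M; have : forall s : seq I, forall (phi : I -> T -> R) (M : R),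
  (forall i, measurable_fun setT (phi i)) -> (forall i x, `|phi i x| <= M) ->
  (forall i, i \notin s -> forall x, 0 <= phi i x) ->
  \int[P]_w (\prod_i phi i (f i w)) = \prod_i \int[P]_w (phi i (f i w));
  last first.
  move=> + phi M mphi phiM => /(_ (enum I) phi M mphi phiM); apply => i.
  by rewrite mem_enum.
have mcomp (phi : I -> T -> R) : (forall i, measurable_fun setT (phi i)) ->
    forall i, measurable_fun setT (fun w => phi i (f i w)).
  by move=> mphi i; exact: (measurableT_comp (mphi i) (mf i)).
have iprod (phi : I -> T -> R) M : (forall i, measurable_fun setT (phi i)) ->
    (forall i x, `|phi i x| <= M) -> forall p : pred I,
    P.-integrable setT (fun w => (\prod_(i | p i) phi i (f i w))%:E).
  move=> mphi phiM p.
  apply: (@bounded_integrable _ _ _ _ _ (\prod_(i | p i) M)).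
    by apply: measurable_prod_cond => i _; exact: mcomp.
  by move=> x; rewrite normr_prod; apply: ler_prod => i _; rewrite normr_ge0 phiM.
elim => [phi M mphi phiM phi0|k s IH phi M mphi phiM phi0].
  have iphi i : P.-integrable setT (fun w => (phi i (f i w))%:E).
    by apply: (@bounded_integrable _ _ _ _ _ M) => //; exact: mcomp.
  have Efin i : (\int[P]_w (phi i (f i w))%:E)%E \is a fin_num.
    exact: integrable_fin_num.
  rewrite /Rintegral ge0_independent_integral_prod//.
  - pose E i := (\int[P]_w (phi i (f i w))%:E)%E.
    rewrite [X in fine X = _](_ : _ = (\prod_i fine (E i))%:E)//.
    by rewrite -prodEFin; apply: eq_bigr => i _; rewrite (fineK (Efin i)).
  - by move=> i x; exact: phi0.
  - move=> i; have := Efin i; rewrite ge0_fin_numE//.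
    by apply: integral_ge0 => w _; rewrite lee_fin; exact: phi0.
pose phi1 i x := if i == k then phi i x + M else phi i x.
pose phi2 i x := if i == k then M else phi i x.
have M0 : forall x : T, 0 <= M by move=> x; exact: le_trans (phiM k x).
have mphi1 i : measurable_fun setT (phi1 i).
  rewrite /phi1; case: (i == k) => //; exact: measurable_funD.
have mphi2 i : measurable_fun setT (phi2 i).
  by rewrite /phi2; case: (i == k).
have phi1M i x : `|phi1 i x| <= M + M.
  rewrite /phi1; case: ifP => _.
    by rewrite (le_trans (ler_normD _ _))// lerD// ger0_norm// (M0 x).
  by rewrite (le_trans (phiM i x))// lerDl (M0 x).
have phi2M i x : `|phi2 i x| <= M.
  by rewrite /phi2; case: ifP => _ //; rewrite ger0_norm// (M0 x).
have E1 := IH phi1 (M + M) mphi1 phi1M.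
have E2 := IH phi2 M mphi2 phi2M.
have {}E1 : \int[P]_w (\prod_i phi1 i (f i w)) =
            \prod_i \int[P]_w (phi1 i (f i w)).
  apply: E1 => i si x; rewrite /phi1; case: (eqVneq i k) => [->|ik].
    by have := phiM k x; rewrite ler_norml => /andP[+ _]; rewrite -subr_ge0 opprK.
  by apply: phi0; rewrite inE negb_or ik.
have {}E2 : \int[P]_w (\prod_i phi2 i (f i w)) =
            \prod_i \int[P]_w (phi2 i (f i w)).
  apply: E2 => i si x; rewrite /phi2; case: (eqVneq i k) => [_|ik].
    exact: (M0 x).
  by apply: phi0; rewrite inE negb_or ik.
have EB (w : Om) : \prod_i phi i (f i w) =
    \prod_i phi1 i (f i w) - \prod_i phi2 i (f i w).
  rewrite (bigD1 k)//= [in RHS](bigD1 k)//= [X in _ - X](bigD1 k)//=.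
  rewrite [X in _ = _ * X - _](eq_bigr (fun i => phi i (f i w))); last first.
    by move=> i /negbTE ik; rewrite /phi1 ik.
  rewrite [X in _ - _ * X](eq_bigr (fun i => phi i (f i w))); last first.
    by move=> i /negbTE ik; rewrite /phi2 ik.
  by rewrite -mulrBl /phi1 /phi2 eqxx addrK.
rewrite [LHS](_ : _ =
    \int[P]_w (\prod_i phi1 i (f i w) - \prod_i phi2 i (f i w))); last first.
  by apply: eq_Rintegral => w _; exact: EB.
rewrite RintegralB//; last 2 first.
- by have := iprod phi1 (M + M) mphi1 phi1M predT.
- by have := iprod phi2 M mphi2 phi2M predT.
rewrite E1 E2.
rewrite (bigD1 k)//= [X in _ - X](bigD1 k)//= [RHS](bigD1 k)//=.
rewrite [X in X - _](_ : _ = \int[P]_w phi1 k (f k w) *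
    \prod_(i | i != k) \int[P]_w phi i (f i w)); last first.
  by congr (_ * _); apply: eq_bigr => i /negbTE ik; rewrite /phi1 ik.
rewrite [X in _ - X](_ : _ = \int[P]_w phi2 k (f k w) *
    \prod_(i | i != k) \int[P]_w phi i (f i w)); last first.
  by congr (_ * _); apply: eq_bigr => i /negbTE ik; rewrite /phi2 ik.
rewrite -mulrBl; congr (_ * _); rewrite /phi1 /phi2 eqxx RintegralD//.
- by rewrite addrK.
- by apply: (@bounded_integrable _ _ _ _ _ M) => //; exact: mcomp.
- by apply: (@bounded_integrable _ _ _ _ _ `|M|).
Qed.

End independent_products.

(** * Gaussian vectors *)

Section gaussian_integrals.
Context {R : realType}.
Notation mu := (@lebesgue_measure R).
Notation phi := (@normal_pdf R 0 1).

Let phiE x : phi x = normal_peak 1 * expR (- x ^+ 2 / 2).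
Proof.
by rewrite normal_pdfE ?oner_neq0// /normal_fun subr0 expr1n.
Qed.

Let phi_ge0 x : 0 <= phi x. Proof. exact: normal_pdf_ge0. Qed.

Let mphi : measurable_fun setT phi. Proof. exact: measurable_normal_pdf. Qed.

Let intphi : mu.-integrable setT (fun x => (phi x)%:E).
Proof. exact: integrable_normal_pdf. Qed.

Lemma integral_expR_normal_pdf t :
  (\int[mu]_x (expR (t * x) * phi x)%:E = (expR (t ^+ 2 / 2))%:E)%E.
Proof.
transitivity (\int[mu]_x ((expR (t ^+ 2 / 2))%:E * (normal_pdf t 1 x)%:E))%E.
  apply: eq_integral => x _; rewrite -EFinM; congr EFin.
  rewrite phiE normal_pdfE ?oner_neq0// /normal_fun expr1n.
  rewrite mulrCA [RHS]mulrCA -!expRD; congr (_ * expR _).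
  by rewrite -[1 *+ 2]/(2%:R); field.
rewrite integralZl//=; last exact: integrable_normal_pdf.
by rewrite integral_normal_pdf mule1.
Qed.

Lemma integral_expR_sqr_normal_pdf s : -1 < s ->
  (\int[mu]_x (expR (- s * x ^+ 2 / 2) * phi x)%:E =
   ((Num.sqrt (1 + s))^-1)%:E)%E.
Proof.
move=> s1; have s0 : 0 < 1 + s by rewrite -ltrBlDl sub0r.
have sq0 : Num.sqrt (1 + s) != 0 by rewrite gt_eqF// sqrtr_gt0.
set sg := (Num.sqrt (1 + s))^-1.
have sg0 : sg != 0 by rewrite invr_eq0.
transitivity (\int[mu]_x (sg%:E * (normal_pdf 0 sg x)%:E))%E.
  apply: eq_integral => x _; rewrite -EFinM; congr EFin.
  rewrite phiE normal_pdfE// /normal_fun subr0 mulrCA [RHS]mulrA; congr (_ * _).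
    have -> : normal_peak sg = sg^-1 * normal_peak (1 : R).
      rewrite /normal_peak expr1n mul1r -mulrnAr sqrtrM ?sqr_ge0//.
      by rewrite sqrtr_sqr ger0_norm ?invr_ge0// invfM.
    by rewrite mulrA divff ?mul1r.
  rewrite -expRD; congr expR; rewrite /sg exprVn sqr_sqrtr ?ltW//.
  rewrite -[_ *+ 2]mulr_natr; field.
  by rewrite gt_eqF.
rewrite integralZl//=; last exact: integrable_normal_pdf.
by rewrite integral_normal_pdf mule1.
Qed.

Let integrable_id_normal_pdf : mu.-integrable setT (fun x => (x * phi x)%:E).
Proof.
apply: (@le_integrable _ _ _ mu setT measurableT _
  (fun x => (expR (1 * x) * phi x)%:E + (expR (-1 * x) * phi x)%:E)%E).
- by apply/measurable_EFinP; exact: measurable_funM.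
- move=> x _ /=; rewrite lee_fin normrM -mulrDl [leRHS]normrM.
  rewrite (ger0_norm (phi_ge0 x)) ler_wpM2r// mul1r mulN1r.
  rewrite [leRHS]ger0_norm ?addr_ge0 ?expR_ge0//.
  have [x0|x0] := leP 0 x.
    rewrite ger0_norm//; apply: le_trans (_ : expR x <= _).
      by rewrite (le_trans _ (expR_ge1Dx x))// lerDr.
    by rewrite lerDl expR_ge0.
  rewrite ltr0_norm//; apply: le_trans (_ : expR (- x) <= _).
    by rewrite (le_trans _ (expR_ge1Dx (- x)))// lerDr.
  by rewrite lerDr expR_ge0.
- have I t : mu.-integrable setT (fun x => (expR (t * x) * phi x)%:E).
    apply/integrableP; split.
      apply/measurable_EFinP; apply: measurable_funM => //.
      by apply: measurableT_comp => //; exact: measurable_funM.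
    under eq_integral do rewrite gee0_abs ?lee_fin ?mulr_ge0 ?expR_ge0//.
    by rewrite integral_expR_normal_pdf ltry.
  by apply: integrableD => //; exact: I.
Qed.

Let is_derive_phi x : is_derive x (1 : R) phi (- x * phi x).
Proof.
have -> : phi = (fun x => normal_peak 1 * expR (- x ^+ 2 / 2)).
  by apply/funext => y; rewrite phiE.
have D2 : is_derive x (1 : R) (fun x : R => - x ^+ 2 / 2) (- x).
  have -> : (fun x : R => - x ^+ 2 / 2) = (- 2^-1 : R) \*: (id ^+ 2).
    by apply/funext => y; rewrite /= mulNr mulrC -mulNr.
  by apply: is_derive_eq; rewrite /GRing.scale/= expr1; field.
have De : is_derive x (1 : R) (fun x : R => expR (- x ^+ 2 / 2))
    (expR (- x ^+ 2 / 2) * - x) by exact: is_derive1_comp.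
have -> : (fun x => normal_peak 1 * expR (- x ^+ 2 / 2)) =
    normal_peak (1 : R) \*: (fun x : R => expR (- x ^+ 2 / 2)).
  by apply/funext.
by apply: is_derive_eq; rewrite /GRing.scale/=; ring.
Qed.

Section characteristic_function.
Variables c t : R.

Let cphase : continuous (fun x : R => t * x + c).
Proof.
move=> x; apply: cvgD; last exact: cvg_cst.
by apply: cvgM; [exact: cvg_cst|exact: cvg_id].
Qed.

Let csin : continuous (fun x : R => sin (t * x + c)).
Proof. by move=> x; apply: continuous_comp; [exact: cphase|exact: continuous_sin]. Qed.

Let ccos : continuous (fun x : R => cos (t * x + c)).
Proof. by move=> x; apply: continuous_comp; [exact: cphase|exact: continuous_cos]. Qed.

Let cphi : continuous phi.
Proof. exact: continuous_normal_pdf (oner_neq0 _). Qed.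

Let g x := x * phi x * sin (t * x + c) - t * (phi x * cos (t * x + c)).

Let cg : continuous g.
Proof.
move=> x; apply: cvgB.
  apply: cvgM; last exact: csin.
  by apply: cvgM; [exact: cvg_id|exact: cphi].
apply: cvgM; first exact: cvg_cst.
by apply: cvgM; [exact: cphi|exact: ccos].
Qed.

Let G x := - (phi x * sin (t * x + c)).

Let is_derive_G x : is_derive x (1 : R) G (g x).
Proof.
have Dp : is_derive x (1 : R) (fun x : R => t * x + c) t.
  have -> : (fun x : R => t * x + c) = (t \*: id) + cst c by apply/funext.
  by apply: is_derive_eq; rewrite /GRing.scale/= mulr1 addr0.
have Ds : is_derive x (1 : R) (fun x : R => sin (t * x + c))
    (cos (t * x + c) * t) by exact: is_derive1_comp.
have -> : G = - (phi * (fun x => sin (t * x + c))) by apply/funext.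
apply: (is_derive_eq (is_deriveN (is_deriveM (is_derive_phi x) Ds))).
by rewrite /g /GRing.scale/=; ring.
Qed.

Let msin : measurable_fun setT (fun x : R => sin (t * x + c)).
Proof. exact: continuous_measurable_fun. Qed.

Let mcos : measurable_fun setT (fun x : R => cos (t * x + c)).
Proof. exact: continuous_measurable_fun. Qed.

Lemma integrable_sin_normal_pdf : mu.-integrable setT
  (fun x => (x * phi x * sin (t * x + c))%:E).
Proof.
apply: (@le_integrable _ _ _ mu setT measurableT _ (fun x => (x * phi x)%:E)).
- apply/measurable_EFinP; apply: measurable_funM => //.
  exact: measurable_funM.
- move=> x _; rewrite /= lee_fin normrM ler_piMr//.
  by rewrite ler_norml sin_geN1 sin_le1.
- exact: integrable_id_normal_pdf.
Qed.

Lemma integrable_cos_normal_pdf : mu.-integrable setT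
  (fun x => (phi x * cos (t * x + c))%:E).
Proof.
apply: (@le_integrable _ _ _ mu setT measurableT _ (fun x => (phi x)%:E)).
- by apply/measurable_EFinP; apply: measurable_funM.
- move=> x _; rewrite /= lee_fin normrM ler_piMr//.
  by rewrite ler_norml cos_geN1 cos_le1.
- exact: intphi.
Qed.

Let integrable_g : mu.-integrable setT (fun x => (g x)%:E).
Proof.
rewrite /g; under eq_fun do rewrite EFinB.
apply: integrableB => //; first exact: integrable_sin_normal_pdf.
under eq_fun do rewrite EFinM.
by apply: integrableZl => //; exact: integrable_cos_normal_pdf.
Qed.

Let cvg_phi : phi n.+1%:R @[n --> \oo] --> (0 : R).
Proof.
have H : normal_peak 1 * (expR 1 * expR (- n.+1%:R)) @[n --> \oo] --> (0 : R).
  rewrite -[X in _ --> X](mulr0 (normal_peak 1)); apply: cvgMr.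
  rewrite -[X in _ --> X](mulr0 (expR 1)); apply: cvgMr.
  have h : (n.+1%:R : R) @[n --> \oo] --> +oo.
    by have := @cvgr_idn R; rewrite -cvg_shiftS.
  exact: (cvg_comp _ _ h (@cvgr_expR R)).
apply: (squeeze_cvgr _ _ H); last exact: cvg_cst.
near=> n; rewrite phi_ge0/= phiE ler_wpM2l ?normal_peak_ge0//.
rewrite -expRD ler_expR.
have : (0 : R) <= (n.+1%:R - 1) ^+ 2 by rewrite sqr_ge0.
nra.
Unshelve. all: by end_near. Qed.

Let phiN x : phi (- x) = phi x.
Proof. by rewrite !phiE sqrrN. Qed.

Let cvg_G (s : R) : s = 1 \/ s = -1 -> G (s * n.+1%:R) @[n --> \oo] --> (0 : R).
Proof.
move=> s1; apply: norm_cvg0.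
apply: (squeeze_cvgr _ _ cvg_phi); last exact: cvg_cst.
near=> n; rewrite normr_ge0/= /G normrN normrM.
have -> : phi (s * n.+1%:R) = phi n.+1%:R.
  by case: s1 => ->; rewrite ?mul1r// mulN1r phiN.
rewrite (ger0_norm (phi_ge0 _)) ler_piMr//.
by rewrite ler_norml sin_geN1 sin_le1.
Unshelve. all: by end_near. Qed.

Let FTC n : (\int[mu]_(x in `[(-1 * n.+1%:R)%R, (1 * n.+1%:R)%R]) (g x)%:E =
  (G (1 * n.+1%:R) - G (-1 * n.+1%:R))%:E)%E.
Proof.
rewrite (@continuous_FTC2 _ g G).
- by rewrite EFinB.
- by rewrite mul1r mulN1r (@lt_trans _ _ 0)// oppr_lt0.
- exact: continuous_subspaceT.
- split.
  + by move=> x _; exact: ex_derive.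
  + apply: cvg_at_right_filter; apply: differentiable_continuous.
    by apply/derivable1_diffP; exact: ex_derive.
  + apply: cvg_at_left_filter; apply: differentiable_continuous.
    by apply/derivable1_diffP; exact: ex_derive.
- by move=> x _; rewrite derive1E; exact: derive_val.
Qed.

Let int_g0 : (\int[mu]_x (g x)%:E = 0)%E.
Proof.
pose I (n : nat) : set R := `[(-1 * n.+1%:R)%R, (1 * n.+1%:R)%R]%classic.
pose gn n x := ((fun x => (g x)%:E) \_ (I n)) x.
have mI n : measurable (I n) by exact: measurable_itv.
have mg : measurable_fun setT (fun x => (g x)%:E).
  by apply/measurable_EFinP; exact: continuous_measurable_fun.
have L : (\int[mu]_x gn n x @[n --> \oo] --> 0)%E.
  under eq_fun => n do rewrite /gn -integral_mkcond FTC.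
  apply: cvg_EFin; first exact: nearW.
  rewrite -[X in _ --> X](subr0 (0 : R)).
  by apply: cvgB; apply: cvg_G; [left|right].
have [| | | | |_ _ H] := @dominated_convergence _ _ _ mu setT measurableT gn
  (fun x => (g x)%:E) (fun x => `|(g x)%:E|)%E.
- move=> n; have := measurable_restrictT (fun x => (g x)%:E) (mI n).
  by move=> [+ _]; apply; exact: measurable_funTS.
- by [].
- apply: aeW => x _; apply: cvg_near_cst.
  near=> n; rewrite /gn patchE ifT//.
  rewrite inE /I/= in_itv/= mul1r mulN1r -ler_norml.
  rewrite (@le_trans _ _ n%:R)//; last by rewrite ler_nat.
  by near: n; exact: nbhs_infty_ger.
- exact: integrable_abse.
- apply: aeW => x n _; rewrite /gn patchE; case: ifP => //.
  by rewrite abse0.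
- by apply: (cvg_unique _ H L).
Unshelve. all: by end_near. Qed.

(** Integration by parts against the normal density: the difference of the integrands is the
    derivative of [G], which vanishes at both ends of the line. The integral over the line is
    reached through the intervals [[-(n+1), n+1]] and dominated convergence. *)
Lemma stein_sin_normal_pdf :
  \int[mu]_x (x * phi x * sin (t * x + c)) =
  t * \int[mu]_x (phi x * cos (t * x + c)).
Proof.
apply/eqP; rewrite -subr_eq0 -RintegralZl//; last exact: integrable_cos_normal_pdf.
rewrite -RintegralB//; last 2 first.
- exact: integrable_sin_normal_pdf.
- exact: (integrableZl measurableT t integrable_cos_normal_pdf).
by rewrite /Rintegral int_g0.
Qed.

End characteristic_function.

(** As a function of [t] the left side satisfies [F' = - t F], by differentiation under the integral
    and Stein's identity; hence [F(t) exp(t^2/2)] is constant, equal to [F(0) = cos c]. *)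
Lemma Rintegral_cos_normal_pdf c t :
  \int[mu]_x (phi x * cos (t * x + c)) = cos c * expR (- t ^+ 2 / 2).
Proof.
pose f t x := phi x * cos (t * x + c).
pose F t := \int[mu]_x f t x.
have Df s (x : R) : is_derive s (1 : R) (f ^~ x) (- (x * phi x * sin (s * x + c))).
  have Dp : is_derive s (1 : R) (fun s : R => s * x + c) x.
    have -> : (fun s : R => s * x + c) = (x \*: id) + cst c.
      by apply/funext => y; rewrite /= mulrC.
    by apply: is_derive_eq; rewrite /GRing.scale/= mulr1 addr0.
  have Dc : is_derive s (1 : R) (fun s : R => cos (s * x + c))
      (- sin (s * x + c) * x) by exact: is_derive1_comp.
  have -> : f ^~ x = phi x \*: (fun s => cos (s * x + c)) by apply/funext.
  by apply: is_derive_eq; rewrite /GRing.scale/=; ring.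
have DF s : is_derive s (1 : R) F (- (s * F s)).
  have I : s \in `]s - 1, s + 1[ by rewrite in_itv/= ltrBlDr ltrDl ltr01.
  have hint x : `]s - 1, s + 1[%classic x -> mu.-integrable setT (EFin \o f x).
    by move=> _; exact: integrable_cos_normal_pdf.
  have hder x y : `]s - 1, s + 1[%classic x -> setT y -> derivable (f ^~ y) x 1.
    by move=> _ _; exact: ex_derive.
  have hG : mu.-integrable setT (EFin \o (fun x => `|x * phi x|)).
    by have := integrable_abse integrable_id_normal_pdf.
  have hb x y : `]s - 1, s + 1[%classic x -> setT y ->
      `|partial1of2 f x y| <= `|y * phi y|.
    move=> _ _; rewrite partial1of2E derive_val normrN normrM ler_piMr//.
    by rewrite ler_norml sin_geN1 sin_le1.
  have h0 y : 0 <= `|y * phi y| by [].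
  have D := @derivable_under_integral R _ _ mu f setT measurableT s _ _ I
    hint hder _ h0 hG hb.
  have E := @differentiation_under_integral R _ _ mu f setT measurableT s _ _ I
    hint hder _ h0 hG hb.
  apply: DeriveDef => //; rewrite -derive1E E.
  under eq_Rintegral do rewrite partial1of2E derive_val -mulN1r.
  rewrite RintegralZl//; last exact: integrable_sin_normal_pdf.
  by rewrite stein_sin_normal_pdf mulN1r.
have Dexp s : is_derive s (1 : R) (fun s : R => expR (s ^+ 2 / 2))
    (expR (s ^+ 2 / 2) * s).
  apply: is_derive1_comp.
  have -> : (fun s : R => s ^+ 2 / 2) = (2^-1 : R) \*: (id ^+ 2).
    by apply/funext => y; rewrite /= mulrC.
  by apply: is_derive_eq; rewrite /GRing.scale/= expr1; field.
pose H s := F s * expR (s ^+ 2 / 2).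
have DH s : is_derive s (1 : R) H 0.
  apply: (is_derive_eq (is_deriveM (DF s) (Dexp s))).
  by rewrite /GRing.scale/=; ring.
have := is_derive_0_is_cst t 0 DH.
rewrite /H expr0n/= mul0r expR0 mulr1.
have -> : F 0 = cos c.
  rewrite /F /f; under eq_Rintegral do rewrite mul0r add0r mulrC.
  by rewrite RintegralZl// /Rintegral integral_normal_pdf mulr1.
move=> <-; rewrite -mulrA -expRD mulNr subrr expR0 mulr1.
by [].
Qed.

End gaussian_integrals.

Lemma normr_prod_le1 (R : realType) (I : finType) (p : pred I) (F : I -> R) :
  (forall i, `|F i| <= 1) -> `|\prod_(i | p i) F i| <= 1.
Proof.
move=> F1; rewrite normr_prod.
apply: (@le_trans _ _ (\prod_(i | p i) (1 : R))); last by rewrite big1_eq.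
by apply: ler_prod => i _; rewrite normr_ge0 F1.
Qed.

Section cosine_of_independent_sum.
Context d (Om : measurableType d) (R : realType) (P : probability Om R).
Context (I : finType) d' (T : measurableType d') (f : I -> Om -> T).
Hypothesis mf : forall i, measurable_fun setT (f i).
Hypothesis indep : mutually_independent P (fun i => sigma_of (f i)).
Variables (theta : I -> T -> R) (a : I -> R).
Hypothesis mtheta : forall i, measurable_fun setT (theta i).
Hypothesis cosE : forall i c,
  \int[P]_w cos (theta i (f i w) + c) = cos c * a i.

Let mcomp (phi : I -> T -> R) : (forall i, measurable_fun setT (phi i)) ->
  forall i, measurable_fun setT (fun w => phi i (f i w)).
Proof. by move=> mphi i; exact: (measurableT_comp (mphi i) (mf i)). Qed.

Let measurable_cos : measurable_fun setT (@cos R).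
Proof. by apply: continuous_measurable_fun; exact: continuous_cos. Qed.

Let measurable_sin : measurable_fun setT (@sin R).
Proof. by apply: continuous_measurable_fun; exact: continuous_sin. Qed.

Let sinE i : \int[P]_w sin (theta i (f i w)) = 0.
Proof.
transitivity (\int[P]_w cos (theta i (f i w) + - (pi / 2))).
  apply: eq_Rintegral => w _.
  by rewrite -[in LHS](subrK (pi / 2) (theta i _)) sinDpihalf.
by rewrite cosE cosN cos_pihalf mul0r.
Qed.

(** Induction on the indices still inside the cosine. The addition formula takes [theta k] out of
    it; the resulting factor [cos] or [sin] joins the bounded factors of the indices outside [s],
    and the remaining sine is a cosine with phase shifted by [- pi / 2]. The sine term drops out
    because [sin (theta k)] has mean 0. *)
Let independent_cos_sum_prod (s : seq I) : uniq s ->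
  forall (c : R) (phi : I -> T -> R),
  (forall i, measurable_fun setT (phi i)) -> (forall i x, `|phi i x| <= 1) ->
  \int[P]_w (cos (c + \sum_(i <- s) theta i (f i w)) *
             \prod_(i | i \notin s) phi i (f i w)) =
  cos c * \prod_(i <- s) a i * \prod_(i | i \notin s) \int[P]_w phi i (f i w).
Proof.
elim: s => [_ c phi mphi phi1|k s IH /= /andP[ks us] c phi mphi phi1].
  rewrite big_nil mulr1.
  under eq_Rintegral do rewrite big_nil addr0.
  rewrite RintegralZl//; last first.
    apply: (@bounded_integrable _ _ _ _ _ 1).
      by apply: measurable_prod_cond => i _; exact: mcomp.
    by move=> w; exact: normr_prod_le1.
  by rewrite (independent_Rintegral_prod mf indep (M := 1)).
pose upd (h : T -> R) i := if i == k then h else phi i.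
pose h1 x := cos (theta k x).
pose h2 x := sin (theta k x).
have mh1 : measurable_fun setT h1 by exact: measurableT_comp.
have mh2 : measurable_fun setT h2 by exact: measurableT_comp.
have mupd h : measurable_fun setT h -> forall i, measurable_fun setT (upd h i).
  by move=> mh i; rewrite /upd; case: ifP.
have upd1 h : (forall x, `|h x| <= 1) -> forall i x, `|upd h i x| <= 1.
  by move=> mh i x; rewrite /upd; case: ifP.
have h11 x : `|h1 x| <= 1 by rewrite ler_norml cos_geN1 cos_le1.
have h21 x : `|h2 x| <= 1 by rewrite ler_norml sin_geN1 sin_le1.
have prodE h (F : (T -> R) -> I -> R) : (forall i, i != k -> F (upd h i) i = F (phi i) i) ->
    \prod_(i | i \notin s) F (upd h i) i =
    F h k * \prod_(i | i \notin k :: s) F (phi i) i.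
  move=> FE; rewrite (bigD1 k)//= {1}/upd eqxx; congr (_ * _).
  under eq_bigl => i do rewrite -negb_or orbC -in_cons.
  by apply: eq_bigr => i; rewrite in_cons negb_or => /andP[ik _]; exact: FE.
have prodE1 h w : \prod_(i | i \notin s) upd h i (f i w) =
    h (f k w) * \prod_(i | i \notin k :: s) phi i (f i w).
  by rewrite (prodE h (fun g i => g (f i w)))// => i /negbTE ik; rewrite /upd ik.
have prodE2 h : \prod_(i | i \notin s) \int[P]_w upd h i (f i w) =
    \int[P]_w h (f k w) * \prod_(i | i \notin k :: s) \int[P]_w phi i (f i w).
  rewrite (prodE h (fun g i => \int[P]_w g (f i w)))// => i /negbTE ik.
  by rewrite /upd ik.
have msum c' : measurable_fun setT
    (fun w => cos (c' + \sum_(i <- s) theta i (f i w))).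
  apply: measurableT_comp => //; apply: measurable_funD => //.
  by apply: measurable_sum => i; exact: mcomp.
have Iint c' (h : T -> R) : measurable_fun setT h -> (forall x, `|h x| <= 1) ->
  P.-integrable setT (fun w => (cos (c' + \sum_(i <- s) theta i (f i w)) *
    \prod_(i | i \notin s) upd h i (f i w))%:E).
  move=> mh h1'; apply: (@bounded_integrable _ _ _ _ _ 1).
    apply: measurable_funM => //; apply: measurable_prod_cond => i _.
    exact: (mcomp (mupd _ mh)).
  move=> w; rewrite normrM mulr_ile1// ?ler_norml ?cos_geN1 ?cos_le1//.
  by rewrite -ler_norml; apply: normr_prod_le1 => i; exact: upd1.
transitivity (\int[P]_w
   (cos (c + \sum_(i <- s) theta i (f i w)) *
      \prod_(i | i \notin s) upd h1 i (f i w) -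
    cos (c - pi / 2 + \sum_(i <- s) theta i (f i w)) *
      \prod_(i | i \notin s) upd h2 i (f i w))).
  apply: eq_Rintegral => w _; rewrite !prodE1 big_cons.
  set S := \sum_(_ <- _) _; set Q := \prod_(_ | _) _; rewrite /h1 /h2.
  have -> : cos (c - pi / 2 + S) = sin (c + S).
    have -> : c + S = (c - pi / 2 + S) + pi / 2 by ring.
    by rewrite sinDpihalf.
  have -> : c + (theta k (f k w) + S) = theta k (f k w) + (c + S) by ring.
  by rewrite cosD; ring.
rewrite RintegralB//; [|exact: Iint..].
rewrite !IH//; [|exact: mupd|exact: upd1|exact: mupd|exact: upd1].
rewrite !prodE2 big_cons.
have -> : \int[P]_w h2 (f k w) = 0 by exact: sinE.
have -> : \int[P]_w h1 (f k w) = a k.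
  by have := cosE k 0; rewrite cos0 mul1r; under eq_Rintegral do rewrite addr0.
by ring.
Qed.

Lemma independent_Rintegral_cos_sum c :
  \int[P]_w cos (c + \sum_i theta i (f i w)) = cos c * \prod_i a i.
Proof.
(* All indices are listed, so the product over the remaining ones is empty and [phi] is only a
   placeholder. *)
have := independent_cos_sum_prod (enum_uniq I) c (phi := fun _ => cst 0).
have E (F : I -> R) : \prod_(i | i \notin enum I) F i = 1.
  by rewrite big_pred0// => i; rewrite mem_enum.
have enumE (F : I -> R) : \prod_(i <- enum I) F i = \prod_i F i.
  by rewrite big_enum.
have enumsE (F : I -> R) : \sum_(i <- enum I) F i = \sum_i F i.
  by rewrite big_enum.
rewrite E enumE mulr1 => <-//.
- by apply: eq_Rintegral => w _; rewrite E mulr1 enumsE.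
- by move=> i x; rewrite normr0.
Qed.

End cosine_of_independent_sum.

Section standard_normal_variable.
Context d (Om : measurableType d) (R : realType) (P : probability Om R).
Variable X : Om -> R.
Hypothesis mX : measurable_fun setT X.
Hypothesis lawX : forall U : set R, measurable U ->
  P [set w | U (X w)] = normal_prob 0 1 U.

Let transfer (h : R -> R) : measurable_fun setT h -> (forall x, 0 <= h x) ->
  (\int[P]_w (h (X w))%:E =
   \int[lebesgue_measure]_x (h x * normal_pdf 0 1 x)%:E)%E.
Proof.
move=> mh h0.
transitivity (\int[P]_w (cst 1 w * h (X w))%:E)%E.
  by apply: eq_integral => x _; rewrite mul1r.
rewrite (@ge0_eq_integral_comp _ _ _ _ (measurableTypeR R) _ R P
  (@lebesgue_measure R) X idfun (cst 1) (normal_pdf 0 1) h)//.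
- by apply: eq_integral => x _; rewrite mulrC.
- exact: measurable_id.
- exact: measurable_normal_pdf.
- by move=> x; exact: normal_pdf_ge0.
- move=> A mA.
  transitivity (\int[P]_w (\1_(X @^-1` A) w)%:E)%E.
    by apply: eq_integral => x _; rewrite mul1r.
  rewrite integral_indic//; last by rewrite -[X in measurable X]setTI; exact: mX.
  rewrite setIT; transitivity (normal_prob 0 1 A); first exact: lawX.
  rewrite /normal_prob [LHS]integral_mkcond.
  apply: eq_integral => x _; rewrite patchE indicE.
  by case: ifPn => xA; rewrite ?mulr1 ?mulr0.
Qed.

Lemma expectation_expR_std_normal t :
  (\int[P]_w (expR (t * X w))%:E = (expR (t ^+ 2 / 2))%:E)%E.
Proof.
rewrite (@transfer (fun x => expR (t * x))).
- exact: integral_expR_normal_pdf.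
- by apply: measurableT_comp => //; exact: measurable_funM.
- by move=> x; rewrite expR_ge0.
Qed.

Lemma expectation_expR_sqr_std_normal s : -1 < s ->
  (\int[P]_w (expR (- s * X w ^+ 2 / 2))%:E = ((Num.sqrt (1 + s))^-1)%:E)%E.
Proof.
move=> s1; rewrite (@transfer (fun x => expR (- s * x ^+ 2 / 2))).
- exact: integral_expR_sqr_normal_pdf.
- apply: measurableT_comp => //; apply: measurable_funM => //.
  by apply: measurable_funM => //; exact: measurable_funX.
- by move=> x; rewrite expR_ge0.
Qed.

Lemma Rintegral_cos_std_normal t c :
  \int[P]_w cos (t * X w + c) = cos c * expR (- t ^+ 2 / 2).
Proof.
have mc : measurable_fun setT (fun x : R => cos (t * x + c)).
  apply: measurableT_comp.
    by apply: continuous_measurable_fun; exact: continuous_cos.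
  by apply: measurable_funD => //; exact: measurable_funM.
have mcX : measurable_fun setT (fun w => cos (t * X w + c)).
  exact: (measurableT_comp mc mX).
(* [transfer] is about nonnegative functions, hence the shift of the cosine by 1. *)
have H : \int[P]_w (1 + cos (t * X w + c)) = 1 + \int[P]_w cos (t * X w + c).
  rewrite RintegralD//.
  - by rewrite Rintegral_cst//= probability_setT/= mulr1.
  - by apply: (@bounded_integrable _ _ _ _ _ 1) => // x; rewrite normr1.
  - apply: (@bounded_integrable _ _ _ _ _ 1) => // x.
    by rewrite ler_norml cos_geN1 cos_le1.
apply: (addrI 1); rewrite -H -Rintegral_cos_normal_pdf.
transitivity (\int[lebesgue_measure]_x (normal_pdf 0 1 x +
  normal_pdf 0 1 x * cos (t * x + c))).
  rewrite /Rintegral (@transfer (fun x => 1 + cos (t * x + c))).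
  - congr fine; apply: eq_integral => x _; congr EFin.
    by rewrite mulrDl mul1r mulrC.
  - exact: measurable_funD.
  - by move=> x; rewrite -lerBlDl sub0r cos_geN1.
rewrite RintegralD//.
- by rewrite [X in X + _]/Rintegral integral_normal_pdf.
- exact: integrable_normal_pdf.
- exact: integrable_cos_normal_pdf.
Qed.

End standard_normal_variable.

(** * Measurable matrices and inner products *)

Section measurable_matrices.
Context {R : realType}.

Lemma measurable_entry p q (i : 'I_p) (j : 'I_q) :
  measurable_fun setT (fun M : 'M[R]_(p, q) => M i j).
Proof.
move=> _ U mU; rewrite setTI.
by apply: sub_sigma_algebra; exists i, j, U.
Qed.

Lemma measurable_mx d (T : measurableType d) p q (F : T -> 'M[R]_(p, q)) :
  (forall i j, measurable_fun setT (fun w => F w i j)) -> measurable_fun setT F.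
Proof.
move=> mF; apply: (@measurability _ _ _ _ _ _ (@matrix_cylinders _ R p q)) => //.
move=> _ [_ [i [j [U mU ->]]] <-].
exact: mF.
Qed.

Lemma measurable_entry_comp d (T : measurableType d) p q
    (F : T -> 'M[R]_(p, q)) i j :
  measurable_fun setT F -> measurable_fun setT (fun w => F w i j).
Proof. by move=> mF; exact: (measurableT_comp (measurable_entry i j) mF). Qed.

Lemma measurable_mulmx d (T : measurableType d) p q r
    (F : T -> 'M[R]_(p, q)) (G : T -> 'M[R]_(q, r)) :
  measurable_fun setT F -> measurable_fun setT G ->
  measurable_fun setT (fun w => F w *m G w).
Proof.
move=> mF mG; apply: measurable_mx => i j.
under eq_fun do rewrite mxE.
apply: measurable_sum => k.
by apply: measurable_funM; exact: measurable_entry_comp.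
Qed.

Lemma measurable_trmx d (T : measurableType d) p q (F : T -> 'M[R]_(p, q)) :
  measurable_fun setT F -> measurable_fun setT (fun w => (F w)^T).
Proof.
move=> mF; apply: measurable_mx => i j.
by under eq_fun do rewrite mxE; exact: measurable_entry_comp.
Qed.

Lemma measurable_row d (T : measurableType d) p q (F : T -> 'M[R]_(p, q)) i :
  measurable_fun setT F -> measurable_fun setT (fun w => row i (F w)).
Proof.
move=> mF; apply: measurable_mx => k j.
by under eq_fun do rewrite mxE; exact: measurable_entry_comp.
Qed.

Lemma measurable_dotp d (T : measurableType d) n (F G : T -> 'rV[R]_n) :
  measurable_fun setT F -> measurable_fun setT G ->
  measurable_fun setT (fun w => dotp (F w) (G w)).
Proof.
move=> mF mG; apply: measurable_entry_comp.
by apply: measurable_mulmx => //; exact: measurable_trmx.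
Qed.

End measurable_matrices.

Section dot_products.
Context {R : realType}.

Lemma dotpE n (u w : 'rV[R]_n) : dotp u w = \sum_i u ord0 i * w ord0 i.
Proof. by rewrite /dotp mxE; apply: eq_bigr => i _; rewrite mxE. Qed.

Lemma dotpC n (u w : 'rV[R]_n) : dotp u w = dotp w u.
Proof. by rewrite !dotpE; apply: eq_bigr => i _; rewrite mulrC. Qed.

Lemma dotpDl n (u v w : 'rV[R]_n) : dotp (u + v) w = dotp u w + dotp v w.
Proof. by rewrite /dotp mulmxDl mxE. Qed.

Lemma dotpZl n a (u w : 'rV[R]_n) : dotp (a *: u) w = a * dotp u w.
Proof. by rewrite /dotp -scalemxAl mxE. Qed.

Lemma dotpDr n (u v w : 'rV[R]_n) : dotp u (v + w) = dotp u v + dotp u w.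
Proof. by rewrite dotpC dotpDl !(dotpC u). Qed.

Lemma dotpZr n a (u w : 'rV[R]_n) : dotp u (a *: w) = a * dotp u w.
Proof. by rewrite dotpC dotpZl dotpC. Qed.

Lemma dotpNl n (u w : 'rV[R]_n) : dotp (- u) w = - dotp u w.
Proof. by rewrite -scaleN1r dotpZl mulN1r. Qed.

Lemma dotpNr n (u w : 'rV[R]_n) : dotp u (- w) = - dotp u w.
Proof. by rewrite dotpC dotpNl dotpC. Qed.

Lemma dotp0l n (w : 'rV[R]_n) : dotp 0 w = 0.
Proof. by rewrite /dotp mul0mx mxE. Qed.

Lemma dotp0r n (w : 'rV[R]_n) : dotp w 0 = 0.
Proof. by rewrite dotpC dotp0l. Qed.

Lemma dotp_suml n (I : finType) (p : pred I) (F : I -> 'rV[R]_n) w :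
  dotp (\sum_(i | p i) F i) w = \sum_(i | p i) dotp (F i) w.
Proof. by rewrite /dotp mulmx_suml summxE. Qed.

Lemma dotp_sumr n (I : finType) (p : pred I) (F : I -> 'rV[R]_n) w :
  dotp w (\sum_(i | p i) F i) = \sum_(i | p i) dotp w (F i).
Proof. by rewrite dotpC dotp_suml; apply: eq_bigr => i _; exact: dotpC. Qed.

Lemma dotp_mulmxr n m (u : 'rV[R]_n) (A : 'M[R]_(m, n)) (w : 'rV[R]_m) :
  dotp u (w *m A) = dotp (u *m A^T) w.
Proof. by rewrite /dotp trmx_mul mulmxA. Qed.

Lemma dotp_rowE n m (z : 'rV[R]_n) (N : 'M[R]_(n, m)) u :
  dotp u (z *m N) = \sum_i z ord0 i * dotp u (row i N).
Proof.
rewrite mulmx_sum_row dotp_sumr; apply: eq_bigr => i _; exact: dotpZr.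
Qed.

Lemma dotp_ge0 n (u : 'rV[R]_n) : 0 <= dotp u u.
Proof. by rewrite dotpE sumr_ge0// => i _; rewrite -expr2 sqr_ge0. Qed.

Lemma dotp_eq0 n (u : 'rV[R]_n) : (dotp u u == 0) = (u == 0).
Proof.
apply/idP/eqP => [|->]; last by rewrite dotp0l.
rewrite dotpE psumr_eq0 => [/allP/= u0|i _]; last by rewrite -expr2 sqr_ge0.
apply/rowP => i; rewrite mxE.
by have := u0 i (mem_index_enum _); rewrite -expr2 sqrf_eq0 => /eqP.
Qed.

Lemma enorm_ge0 n (u : 'rV[R]_n) : 0 <= enorm u.
Proof. exact: sqrtr_ge0. Qed.

Lemma enorm_sqr n (u : 'rV[R]_n) : enorm u ^+ 2 = dotp u u.
Proof. by rewrite sqr_sqrtr// dotp_ge0. Qed.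

Lemma dotp_sqr_le n (u w : 'rV[R]_n) : dotp u w ^+ 2 <= dotp u u * dotp w w.
Proof.
have [->|w0] := eqVneq w 0; first by rewrite !dotp0r expr0n mulr0.
have ww0 : 0 < dotp w w by rewrite lt_neqAle dotp_ge0 andbT eq_sym dotp_eq0.
have := dotp_ge0 (dotp w w *: u - dotp u w *: w).
rewrite dotpDl !dotpDr !dotpNl !dotpNr !dotpZl !dotpZr (dotpC w u) => h.
have {}h : 0 <= dotp w w * (dotp u u * dotp w w - dotp u w ^+ 2).
  by apply: le_trans h _; rewrite le_eqVlt; apply/orP; left; apply/eqP; ring.
by rewrite pmulr_rge0// subr_ge0 in h.
Qed.

Lemma normr_dotp_le n (u w : 'rV[R]_n) : `|dotp u w| <= enorm u * enorm w.
Proof.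
rewrite -ler_sqr ?nnegrE ?normr_ge0 ?mulr_ge0 ?enorm_ge0//.
by rewrite real_normK ?num_real// exprMn !enorm_sqr dotp_sqr_le.
Qed.

Lemma enormD n (u w : 'rV[R]_n) : enorm (u + w) <= enorm u + enorm w.
Proof.
rewrite -ler_sqr ?nnegrE ?addr_ge0 ?enorm_ge0// sqrrD !enorm_sqr.
rewrite dotpDl !dotpDr (dotpC w u).
have := normr_dotp_le u w; have := ler_norm (dotp u w).
lra.
Qed.

Lemma enormZ n a (u : 'rV[R]_n) : enorm (a *: u) = `|a| * enorm u.
Proof.
by rewrite /enorm dotpZl dotpZr mulrA -expr2 sqrtrM ?sqr_ge0// sqrtr_sqr.
Qed.

Lemma enormN n (u : 'rV[R]_n) : enorm (- u) = enorm u.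
Proof. by rewrite -scaleN1r enormZ normrN1 mul1r. Qed.

Lemma enorm_sum n (I : finType) (p : pred I) (F : I -> 'rV[R]_n) :
  enorm (\sum_(i | p i) F i) <= \sum_(i | p i) enorm (F i).
Proof.
elim/big_rec2: _ => [|i x y _ h]; first by rewrite /enorm dotp0l sqrtr0.
by rewrite (le_trans (enormD _ _))// lerD2l.
Qed.

End dot_products.

Lemma eq_law_Rintegral d1 d2 d' (T1 : measurableType d1)
    (T2 : measurableType d2) (T' : measurableType d') (R : realType)
    (P1 : probability T1 R) (P2 : probability T2 R)
    (f1 : T1 -> T') (f2 : T2 -> T') (phi : T' -> R) (M : R) :
  measurable_fun setT f1 -> measurable_fun setT f2 ->
  (forall A, measurable A -> P1 (f1 @^-1` A) = P2 (f2 @^-1` A)) ->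
  measurable_fun setT phi -> (forall x, `|phi x| <= M) ->
  \int[P1]_x phi (f1 x) = \int[P2]_x phi (f2 x).
Proof.
move=> mf1 mf2 E mphi phiM; apply: (addIr M).
have H d (T : measurableType d) (P : probability T R) (f : T -> T') :
    measurable_fun setT f ->
    \int[P]_x phi (f x) + M = \int[P]_x (phi (f x) + M).
  move=> mf; rewrite RintegralD//.
  - by rewrite Rintegral_cst//= probability_setT/= mulr1.
  - apply: (@bounded_integrable _ _ _ _ _ M) => //.
    exact: (measurableT_comp mphi mf).
  - by apply: (@bounded_integrable _ _ _ _ _ `|M|).
rewrite (H _ _ P1)// (H _ _ P2)// /Rintegral.
rewrite (@eq_law_ge0_integral _ _ _ _ _ _ _ P1 P2 f1 f2 (fun x => phi x + M))//.
- exact: measurable_funD.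
- by move=> x; have := phiM x; rewrite ler_norml => /andP[+ _]; rewrite -subr_ge0 opprK.
Qed.

(** * Exponential moments and cosine transforms of Gaussian vectors *)

Section standard_normal_vector.
Context d (Om : measurableType d) (R : realType) (P : probability Om R).
Context n (g : Om -> 'rV[R]_n).
Hypothesis gP : standard_normal P g.

Let mg : measurable_fun setT g. Proof. by case: gP. Qed.
Let indep : mutually_independent P (fun l : 'I_n => sigma_of (fun w => g w ord0 l)).
Proof. by case: gP. Qed.
Let law (l : 'I_n) (U : set R) : measurable U ->
  P [set w | U (g w ord0 l)] = normal_prob 0 1 U.
Proof. by case: gP => _ _; apply. Qed.
Let mgl l : measurable_fun setT (fun w => g w ord0 l).
Proof. exact: measurable_entry_comp. Qed.

Lemma expectation_expR_standard_normal u :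
  (\int[P]_w (expR (dotp u (g w)))%:E = (expR (dotp u u / 2))%:E)%E.
Proof.
pose phi l (x : R) := expR (u ord0 l * x).
have E l : (\int[P]_w (phi l (g w ord0 l))%:E = (expR (u ord0 l ^+ 2 / 2))%:E)%E.
  exact: (expectation_expR_std_normal (mgl l) (@law l)).
transitivity (\int[P]_w (\prod_l phi l (g w ord0 l))%:E)%E.
  by apply: eq_integral => w _; congr EFin; rewrite dotpE expR_sum.
rewrite (ge0_independent_integral_prod mgl indep).
- rewrite (eq_bigr _ (fun l _ => E l)) prodEFin -expR_sum; congr ((expR _)%:E).
  by rewrite dotpE mulr_suml; apply: eq_bigr => l _; rewrite expr2.
- by move=> l; apply: measurableT_comp => //; exact: measurable_funM.
- by move=> l x; rewrite expR_ge0.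
- by move=> l; rewrite E ltry.
Qed.

(** The selection [D] of coordinates serves the noise covariance, which has rank [d - 1]: after a
    rotation its quadratic form omits exactly one coordinate. *)
Lemma expectation_expR_sqr_standard_normal s (D : pred 'I_n) : -1 < s ->
  (\int[P]_w (expR (- s * (\sum_(l | D l) g w ord0 l ^+ 2) / 2))%:E =
   ((Num.sqrt (1 + s))^-1 ^+ #|D|)%:E)%E.
Proof.
move=> s1.
pose phi l (x : R) := if D l then expR (- s * x ^+ 2 / 2) else 1.
have E l : (\int[P]_w (phi l (g w ord0 l))%:E =
            (if D l then (Num.sqrt (1 + s))^-1 else 1)%:E)%E.
  rewrite /phi; case: (D l).
    exact: (expectation_expR_sqr_std_normal (mgl l) (@law l) s1).
  by rewrite integral_cst//= probability_setT mule1.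
transitivity (\int[P]_w (\prod_l phi l (g w ord0 l))%:E)%E.
  apply: eq_integral => w _; congr EFin; rewrite -big_mkcond/= -expR_sum.
  by rewrite mulr_sumr mulr_suml.
rewrite (ge0_independent_integral_prod mgl indep).
- rewrite (eq_bigr _ (fun l _ => E l)) prodEFin -big_mkcond/=.
  by rewrite (prodr_const D).
- move=> l; rewrite /phi; case: (D l) => //.
  apply: measurableT_comp => //; apply: measurable_funM => //.
  by apply: measurable_funM => //; exact: measurable_funX.
- by move=> l x; rewrite /phi; case: ifP => // _; rewrite expR_ge0.
- by move=> l; rewrite E ltry.
Qed.

Lemma Rintegral_cos_standard_normal u c :
  \int[P]_w cos (dotp u (g w) + c) = cos c * expR (- dotp u u / 2).
Proof.
have := @independent_Rintegral_cos_sum _ _ _ P _ _ _ _ mgl indep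
  (fun l x => u ord0 l * x) (fun l => expR (- u ord0 l ^+ 2 / 2)).
move=> /(_ _ _ c) H.
transitivity (\int[P]_w cos (c + \sum_l u ord0 l * g w ord0 l)).
  by apply: eq_Rintegral => w _; rewrite dotpE addrC.
rewrite H.
- rewrite -expR_sum; congr (_ * expR _); rewrite dotpE mulNr mulr_suml -sumrN.
  by apply: eq_bigr => l _; rewrite expr2 mulNr.
- by move=> l; exact: measurable_funM.
- by move=> l c'; exact: (Rintegral_cos_std_normal (mgl l) (@law l)).
Qed.

End standard_normal_vector.

Section gaussian_vector.
Context d (Om : measurableType d) (R : realType) (P : probability Om R).
Context n (Z : Om -> 'rV[R]_n) (Sigma : 'M[R]_n).
Hypothesis ZP : centered_gaussian P Z Sigma.

Let transfer_quad (S : 'M[R]_n) u x : S^T = S -> S *m S = Sigma ->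
  dotp u (x *m S) = dotp (u *m S) x /\
  dotp (u *m S) (u *m S) = dotp (u *m Sigma) u.
Proof.
move=> ST SS; split; first by rewrite dotp_mulmxr ST.
by rewrite dotp_mulmxr ST -mulmxA SS.
Qed.

Lemma expectation_expR_gaussian u :
  (\int[P]_w (expR (dotp u (Z w)))%:E = (expR (dotp (u *m Sigma) u / 2))%:E)%E.
Proof.
case: ZP => mZ [S [ST _ SS [d' [Om' [P' [g [gP lawZ]]]]]]].
have mg : measurable_fun setT g by case: gP.
rewrite (@eq_law_ge0_integral _ _ _ _ _ _ _ P P' Z (fun w => g w *m S)
  (fun x => expR (dotp u x)))//.
- under eq_integral do rewrite (transfer_quad u _ ST SS).1.
  by rewrite (expectation_expR_standard_normal gP) (transfer_quad u u ST SS).2.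
- exact: measurable_mulmx.
- by apply: measurableT_comp => //; exact: measurable_dotp.
Qed.

Lemma Rintegral_cos_gaussian u c :
  \int[P]_w cos (dotp u (Z w) + c) = cos c * expR (- dotp (u *m Sigma) u / 2).
Proof.
case: ZP => mZ [S [ST _ SS [d' [Om' [P' [g [gP lawZ]]]]]]].
have mg : measurable_fun setT g by case: gP.
rewrite (@eq_law_Rintegral _ _ _ _ _ _ _ P P' Z (fun w => g w *m S)
  (fun x => cos (dotp u x + c)) 1)//.
- under eq_Rintegral do rewrite (transfer_quad u _ ST SS).1.
  by rewrite (Rintegral_cos_standard_normal gP) (transfer_quad u u ST SS).2.
- exact: measurable_mulmx.
- apply: measurableT_comp.
    by apply: continuous_measurable_fun; exact: continuous_cos.
  by apply: measurable_funD => //; exact: measurable_dotp.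
- by move=> x; rewrite ler_norml cos_geN1 cos_le1.
Qed.

(** The hypothesis says [|uS|^2 = 0], so [<u, gS> = <uS, g>] vanishes identically. Applied to [v],
    it makes the noise exactly orthogonal to the signal. *)
Lemma gaussian_orthogonal u : dotp (u *m Sigma) u = 0 ->
  P [set w | dotp u (Z w) = 0] = 1%E.
Proof.
case: ZP => mZ [S [ST _ SS [d' [Om' [P' [g [gP lawZ]]]]]]] u0.
have mu0 : measurable [set x : 'rV[R]_n | dotp u x = 0].
  rewrite (_ : [set x | _] = (dotp u) @^-1` [set 0])//.
  by rewrite -[X in measurable X]setTI; exact: measurable_dotp.
rewrite [LHS](lawZ _ mu0) (_ : [set _ | _] = setT) ?probability_setT//.
apply/seteqP; split => // w _ /=; rewrite (transfer_quad u _ ST SS).1.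
have /eqP -> : u *m S == 0.
  by rewrite -dotp_eq0 (transfer_quad u u ST SS).2 u0.
by rewrite dotp0l.
Qed.

End gaussian_vector.

Lemma probability_le_integral d (Om : measurableType d) (R : realType)
    (P : probability Om R) (A : set Om) (F : Om -> R) :
  measurable A -> measurable_fun setT F -> (forall w, 0 <= F w) ->
  (forall w, A w -> 1 <= F w) -> (P A <= \int[P]_w (F w)%:E)%E.
Proof.
move=> mA mF F0 F1.
have -> : P A = (\int[P]_w (\1_A w)%:E)%E by rewrite integral_indic// setIT.
apply: ge0_le_integral => //.
- by apply/measurable_EFinP; exact: measurable_indic.
- exact/measurable_EFinP.
- move=> w _; rewrite lee_fin indicE; case: (boolP (w \in A)) => [/set_mem/F1//|_].
  exact: F0.
Qed.

Lemma bounded_Rintegral_swap d1 d2 (T1 : measurableType d1)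
    (T2 : measurableType d2) (R : realType) (P1 : probability T1 R)
    (P2 : probability T2 R) (F : T1 * T2 -> R) (M : R) :
  measurable_fun setT F -> (forall z, `|F z| <= M) ->
  \int[P1]_x \int[P2]_y F (x, y) = \int[P2]_y \int[P1]_x F (x, y).
Proof.
move=> mF FM.
have iF : (P1 \x P2)%E.-integrable setT (fun z => (F z)%:E).
  exact: (@bounded_integrable _ _ _ (P1 \x P2)%E).
have i1 x : P2.-integrable setT (fun y => (F (x, y))%:E).
  apply: (@bounded_integrable _ _ _ _ _ M) => //.
  exact: (measurableT_comp mF (measurable_pair1 x)).
have i2 y : P1.-integrable setT (fun x => (F (x, y))%:E).
  apply: (@bounded_integrable _ _ _ _ _ M) => //.
  exact: (measurableT_comp mF (measurable_pair2 y)).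
rewrite /Rintegral.
under eq_integral do rewrite (fineK (integrable_fin_num measurableT (i1 _))).
under [in RHS]eq_integral do
  rewrite (fineK (integrable_fin_num measurableT (i2 _))).
by congr fine; exact: (Fubini iF).
Qed.

Section gaussian_rows.
Context d0 (Om : measurableType d0) (R : realType) (P : probability Om R).
Context d n (N : Om -> 'M[R]_(n, d)) (Sigma : 'M[R]_d).
Hypothesis gaussN : forall i, centered_gaussian P (fun w => row i (N w)) Sigma.
Hypothesis indepN : mutually_independent P
  (fun i : 'I_n => sigma_of (fun w => row i (N w))).
Variable z : 'rV[R]_n.

Notation quad u := (dotp (u *m Sigma) u).

Let mrow i : measurable_fun setT (fun w => row i (N w)).
Proof. by case: (gaussN i). Qed.

Let quadZ a (u : 'rV[R]_d) : quad (a *: u) = a ^+ 2 * quad u.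
Proof. by rewrite -scalemxAl dotpZl dotpZr mulrA expr2. Qed.

Lemma expectation_expR_gaussian_rows u :
  (\int[P]_w (expR (dotp u (z *m N w)))%:E =
   (expR (dotp z z * quad u / 2))%:E)%E.
Proof.
pose phi i (x : 'rV[R]_d) := expR (dotp (z ord0 i *: u) x).
have E i : (\int[P]_w (phi i (row i (N w)))%:E =
    (expR (z ord0 i ^+ 2 * quad u / 2))%:E)%E.
  by rewrite -quadZ; exact: (expectation_expR_gaussian (gaussN i)).
transitivity (\int[P]_w (\prod_i phi i (row i (N w)))%:E)%E.
  apply: eq_integral => w _; congr EFin; rewrite dotp_rowE expR_sum.
  by apply: eq_bigr => i _; rewrite /phi dotpZl.
rewrite (ge0_independent_integral_prod mrow indepN).
- rewrite (eq_bigr _ (fun l _ => E l)) prodEFin -expR_sum; congr ((expR _)%:E).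
  rewrite (dotpE z) mulr_suml mulr_suml.
  by apply: eq_bigr => l _; rewrite expr2.
- by move=> l; apply: measurableT_comp => //; exact: measurable_dotp.
- by move=> l x; rewrite expR_ge0.
- by move=> l; rewrite E ltry.
Qed.

Lemma Rintegral_cos_gaussian_rows u :
  \int[P]_w cos (dotp u (z *m N w)) = expR (- (dotp z z * quad u) / 2).
Proof.
have := @independent_Rintegral_cos_sum _ _ _ P _ _ _ _ mrow indepN
  (fun i x => dotp (z ord0 i *: u) x)
  (fun i => expR (- (z ord0 i ^+ 2 * quad u) / 2)).
move=> /(_ _ _ 0) H.
transitivity (\int[P]_w cos (0 + \sum_i dotp (z ord0 i *: u) (row i (N w)))).
  apply: eq_Rintegral => w _; rewrite add0r dotp_rowE; congr cos.
  by apply: eq_bigr => i _; rewrite dotpZl.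
rewrite H.
- rewrite cos0 mul1r -expR_sum; congr (expR _).
  rewrite (dotpE z) -mulr_suml; congr (_ / _); rewrite sumrN mulr_suml.
  by congr (- _); apply: eq_bigr => i _; rewrite expr2.
- by move=> l; exact: measurable_dotp.
- by move=> i c; rewrite -quadZ; exact: (Rintegral_cos_gaussian (gaussN i)).
Qed.

Context d1 (Om' : measurableType d1) (P' : probability Om' R).
Variable g : Om' -> 'rV[R]_d.
Hypothesis gP : standard_normal P' g.

Let mg : measurable_fun setT g. Proof. by case: gP. Qed.

Let mzN : measurable_fun setT (fun w => z *m N w).
Proof.
apply: measurable_mulmx => //; apply: measurable_mx => i j.
have := measurable_entry_comp ord0 j (mrow i).
by under eq_fun do rewrite mxE.
Qed.

(* Both sides are the expectation of cos <gA, zN> over the product space. *)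
Lemma Rintegral_expR_gaussian_rows (A : 'M[R]_d) :
  \int[P]_w expR (- dotp (z *m N w *m A^T) (z *m N w *m A^T) / 2) =
  \int[P']_w expR (- (dotp z z * quad (g w *m A)) / 2).
Proof.
pose F (p : Om * Om') := cos (dotp (g p.2 *m A) (z *m N p.1)).
have mF : measurable_fun setT F.
  apply: measurableT_comp.
    by apply: continuous_measurable_fun; exact: continuous_cos.
  apply: measurable_dotp.
    by apply: measurable_mulmx => //; exact: (measurableT_comp mg).
  exact: (measurableT_comp mzN).
have F1 p : `|F p| <= 1 by rewrite ler_norml cos_geN1 cos_le1.
transitivity (\int[P]_w \int[P']_w' F (w, w')).
  apply: eq_Rintegral => w _; rewrite -[LHS]mul1r -[X in X * _]cos0.
  rewrite -(Rintegral_cos_standard_normal gP); apply: eq_Rintegral => w' _.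
  by rewrite /F/= addr0 [in RHS]dotpC dotp_mulmxr dotpC.
rewrite (bounded_Rintegral_swap P P' mF F1); apply: eq_Rintegral => w' _.
by rewrite -Rintegral_cos_gaussian_rows.
Qed.

(** [exp(|x|^2/2)] is the mean of [exp <g,x>]; Tonelli's theorem then integrates over [N] first.
    Both sides may be infinite. *)
Lemma expectation_expR_sqr_gaussian_rows a :
  (\int[P]_w (expR (a ^+ 2 * dotp (z *m N w) (z *m N w) / 2))%:E =
   \int[P']_w (expR (a ^+ 2 * dotp z z * quad (g w) / 2))%:E)%E.
Proof.
pose F (p : Om * Om') : \bar R := (expR (dotp (a *: g p.2) (z *m N p.1)))%:E.
have mF : measurable_fun setT F.
  apply/measurable_EFinP; apply: measurableT_comp => //.
  apply: measurable_dotp; last exact: (measurableT_comp mzN).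
  apply: measurable_mx => i j; under eq_fun do rewrite mxE.
  apply: measurable_funM => //; apply: measurable_entry_comp.
  exact: (measurableT_comp mg).
have F0 p : (0 <= F p)%E by rewrite lee_fin expR_ge0.
transitivity (\int[P]_w \int[P']_w' F (w, w'))%E.
  apply: eq_integral => w _.
  have -> : a ^+ 2 * dotp (z *m N w) (z *m N w) =
    dotp (a *: (z *m N w)) (a *: (z *m N w)) by rewrite dotpZl dotpZr mulrA expr2.
  rewrite -(expectation_expR_standard_normal gP); apply: eq_integral => w' _.
  by rewrite /F/= dotpZl [in RHS]dotpZl dotpC.
rewrite fubini_tonelli//; apply: eq_integral => w' _.
rewrite (mulrC (a ^+ 2)) -(mulrA (dotp z z)) -quadZ.
by rewrite -expectation_expR_gaussian_rows.
Qed.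

End gaussian_rows.

(** * The noise matrix *)

Section projection_covariance.
Context {R : realType} {d : nat}.
Implicit Types u v x : 'rV[R]_d.

Lemma mulmx_tr_dotp u v : u *m v^T = (dotp u v)%:M.
Proof. by rewrite [LHS]mx11_scalar. Qed.

Lemma dotp_noise_cov u v :
  dotp (u *m noise_cov v) u = d%:R^-1 * (dotp u u - dotp u v ^+ 2).
Proof.
rewrite /noise_cov -scalemxAr dotpZl mulmxBr mulmx1 dotpDl dotpNl.
by rewrite mulmxA mulmx_tr_dotp mul_scalar_mx dotpZl (dotpC v) -expr2.
Qed.

Lemma dotp_delta u l : dotp u (delta_mx ord0 l) = u ord0 l.
Proof.
rewrite dotpE (bigD1 l)//= mxE !eqxx mulr1 big1 ?addr0// => i il.
by rewrite mxE eqxx (negbTE il) mulr0.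
Qed.

(** The reflection in the hyperplane orthogonal to [e - v] exchanges the unit vectors [e] and [v];
    when they coincide the identity does. *)
Let householder v l : dotp v v = 1 -> exists H : 'M[R]_d,
  [/\ H^T = H, H *m H = 1%:M & delta_mx ord0 l *m H = v].
Proof.
move=> v1; set e : 'rV[R]_d := delta_mx ord0 l.
have e1 : dotp e e = 1 by rewrite dotp_delta mxE !eqxx.
have [->|ev] := eqVneq v e.
  by exists 1%:M; rewrite trmx1 !mulmx1.
pose u := e - v; have u0 : dotp u u != 0 by rewrite dotp_eq0 subr_eq0 eq_sym.
have uuE : dotp u u = 2 * (1 - dotp e v).
  by rewrite /u dotpDl !dotpDr !dotpNl !dotpNr e1 v1 (dotpC v e); ring.
have uT : (u^T *m u)^T = u^T *m u by rewrite trmx_mul trmxK.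
exists (1%:M - (2 / dotp u u) *: (u^T *m u)); split.
- by rewrite linearB/= linearZ/= trmx1 uT.
- set c := 2 / dotp u u; set B := u^T *m u.
  have BB : B *m B = dotp u u *: B.
    by rewrite /B -mulmxA (mulmxA u) mulmx_tr_dotp mul_scalar_mx -scalemxAr.
  have ccB : c *: (c *: (B *m B)) = c *: B + c *: B.
    rewrite BB -scalerDl !scalerA; congr (_ *: B); rewrite /c; field.
    exact: u0.
  rewrite mulmxBl !mulmxBr !mul1mx mulmx1 -scalemxAl -scalemxAr ccB.
  by rewrite opprB addrK subrK.
- rewrite mulmxBr mulmx1 -scalemxAr mulmxA mulmx_tr_dotp mul_scalar_mx scalerA.
  have -> : dotp e u = 1 - dotp e v by rewrite /u dotpDr dotpNr e1.
  rewrite uuE [X in X *: _](_ : _ = 1) ?scale1r; last first.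
    field; rewrite uuE in u0.
    by move: u0; rewrite mulf_eq0 negb_or => /andP[].
  by rewrite /u opprB addrC subrK.
Qed.

(** [A] erases coordinate [l] and then applies the reflection sending [e_l] to [v], so its range is
    orthogonal to [v]. On vectors [xA] the form of [noise_cov v] becomes [1/d] times a sum of
    [d - 1] squares of coordinates of [x], and [A^T] shortens vectors, which is the direction a
    lower tail can afford. *)
Lemma orthogonal_projection_frame v l : dotp v v = 1 -> exists A : 'M[R]_d,
  [/\ forall x, dotp (x *m A) v = 0,
      forall x, dotp (x *m A) (x *m A) = \sum_(i | i != l) x ord0 i ^+ 2 &
      forall x, dotp (x *m A^T) (x *m A^T) <= dotp x x].
Proof.
move=> v1; have [H [HT HH eH]] := householder l v1.
set e : 'rV[R]_d := delta_mx ord0 l.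
have ee : e *m e^T = 1%:M.
  by rewrite mulmx_tr_dotp dotp_delta mxE !eqxx.
pose D : 'M[R]_d := 1%:M - e^T *m e.
have DT : D^T = D by rewrite /D linearB/= trmx1 trmx_mul trmxK.
have De : D *m e^T = 0.
  by rewrite /D mulmxBl mul1mx -mulmxA ee mulmx1 subrr.
have xD x : x *m D = x - x ord0 l *: e.
  by rewrite /D mulmxBr mulmx1 mulmxA mulmx_tr_dotp mul_scalar_mx dotp_delta.
have xDxD x : dotp (x *m D) (x *m D) = \sum_(i | i != l) x ord0 i ^+ 2.
  rewrite xD dotpE (bigD1 l)//= !mxE !eqxx mulr1 subrr mul0r add0r.
  by apply: eq_bigr => i /negbTE il; rewrite !mxE il mulr0 subr0 expr2.
exists (D *m H); split => x.
- by rewrite /dotp -eH trmx_mul HT !mulmxA -(mulmxA _ H H) HH mulmx1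
    -(mulmxA x) De mulmx0 mxE.
- rewrite mulmxA dotp_mulmxr HT -mulmxA HH mulmx1.
  exact: xDxD.
- rewrite trmx_mul HT DT mulmxA xDxD.
  have -> : dotp x x = dotp (x *m H) (x *m H).
    by rewrite dotp_mulmxr HT -mulmxA HH mulmx1.
  rewrite dotpE [leRHS](bigD1 l)//= -expr2.
  under [in leRHS]eq_bigr do rewrite -expr2.
  by rewrite lerDr sqr_ge0.
Qed.

End projection_covariance.

Section noise_tails.
Context d0 (Om : measurableType d0) (R : realType) (P : probability Om R).
Context d n (v : 'rV[R]_d) (N : Om -> 'M[R]_(n, d)).
Hypothesis d_gt0 : (0 < d)%N.
Hypothesis v1 : dotp v v = 1.
Hypothesis gaussN :
  forall i, centered_gaussian P (fun w => row i (N w)) (noise_cov v).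
Hypothesis indepN : mutually_independent P
  (fun i : 'I_n => sigma_of (fun w => row i (N w))).
Variable z : 'rV[R]_n.
Hypothesis z0 : z != 0.

Let zz : 0 < dotp z z.
Proof. by rewrite lt_neqAle dotp_ge0 andbT eq_sym dotp_eq0. Qed.

Let dR : (0 : R) < d%:R. Proof. by rewrite ltr0n. Qed.

Let n_gt0 : (0 < n)%N.
Proof.
case: n z z0 => [|//] y /eqP; rewrite (_ : y = 0)// ; apply/rowP => -[]//.
Qed.

Let i0 : 'I_n := Ordinal n_gt0.

Lemma measurable_gaussian_matrix : measurable_fun setT N.
Proof.
apply: measurable_mx => i j.
have [mrow _] := gaussN i.
have := measurable_entry_comp ord0 j mrow.
by under eq_fun do rewrite mxE.
Qed.

Let mzN : measurable_fun setT (fun w => z *m N w).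
Proof. by apply: measurable_mulmx => //; exact: measurable_gaussian_matrix. Qed.

Let mnorm : measurable_fun setT (fun w => dotp (z *m N w) (z *m N w)).
Proof. exact: measurable_dotp. Qed.

Let quadZ a (u : 'rV[R]_d) : dotp (a *: u *m noise_cov v) (a *: u) =
  a ^+ 2 * dotp (u *m noise_cov v) u.
Proof. by rewrite -scalemxAl dotpZl dotpZr mulrA expr2. Qed.

(** Markov's inequality for [exp(d/2 - a^2 |zNA^T|^2 / 2)]. By duality the mean is [exp(d/2)] times
    that of [exp(- s Q / 2)], with [Q] a sum of [d - 1] squared independent normals, that is
    [(1 + s)^(-(d-1)/2) <= rho^(d-1)]. *)
Lemma noise_lower_tail (rho : R) : 0 < rho ->
  (P [set w | dotp (z *m N w) (z *m N w) <= rho ^+ 2 * dotp z z]%R <=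
   (expR (d%:R / 2) * rho ^+ d.-1)%:E)%E.
Proof.
move=> rho0.
(* A row exists because [z] is nonzero; its Gaussian law supplies the auxiliary space and the
   standard normal [g] of the duality. *)
have [_ [S [_ _ _ [d' [Om' [P' [g [gP _]]]]]]]] := gaussN i0.
have [A [Av AA AT]] := orthogonal_projection_frame (Ordinal d_gt0) v1.
(* With this [s], [a^2 |zN|^2 <= d] on the event, which is exactly what the factor [exp(d/2)]
   compensates. *)
pose s := (rho ^+ 2)^-1; have s0 : 0 < s by rewrite invr_gt0 exprn_gt0.
pose a := Num.sqrt (s * d%:R / dotp z z).
have a2 : a ^+ 2 = s * d%:R / dotp z z.
  by rewrite sqr_sqrtr// divr_ge0 ?ltW// mulr_gt0.
pose F w := expR (d%:R / 2) *
  expR (- dotp (z *m N w *m (a *: A)^T) (z *m N w *m (a *: A)^T) / 2).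
have mF : measurable_fun setT F.
  apply: measurable_funM => //; apply: measurableT_comp => //.
  apply: measurable_funM => //; apply: measurableT_comp => //.
  by apply: measurable_dotp; apply: measurable_mulmx.
have F0 w : 0 <= F w by rewrite mulr_ge0 ?expR_ge0.
have normE w : dotp (z *m N w *m (a *: A)^T) (z *m N w *m (a *: A)^T) =
    a ^+ 2 * dotp (z *m N w *m A^T) (z *m N w *m A^T).
  by rewrite linearZ/= -scalemxAr dotpZl dotpZr mulrA expr2.
apply: (@le_trans _ _ (\int[P]_w (F w)%:E)%E).
  apply: probability_le_integral => //.
    rewrite (_ : [set w | _] = (fun w => dotp (z *m N w) (z *m N w)) @^-1`
      `]-oo, rho ^+ 2 * dotp z z]%classic); last first.
      by apply/seteqP; split => w /=; rewrite in_itv.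
    by rewrite -[X in measurable X]setTI; exact: mnorm.
  move=> w /= h; rewrite /F -expRD -[leLHS]expR0 ler_expR normE a2.
  have H : s * d%:R / dotp z z * dotp (z *m N w *m A^T) (z *m N w *m A^T) <= d%:R.
    apply: (@le_trans _ _ (s * d%:R / dotp z z * (rho ^+ 2 * dotp z z))).
      apply: ler_wpM2l; last exact: le_trans (AT _) h.
      by apply: divr_ge0; [apply: mulr_ge0|]; exact: ltW.
    rewrite le_eqVlt; apply/orP; left; apply/eqP; rewrite /s; field.
    by rewrite !gt_eqF.
  lra.
have expR1 w : 0 <= expR (- dotp (z *m N w *m (a *: A)^T) (z *m N w *m (a *: A)^T) / 2) <= 1.
  rewrite expR_ge0/= -[leRHS]expR0 ler_expR mulNr oppr_le0.
  by rewrite divr_ge0// dotp_ge0.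
have iF : P.-integrable setT (fun w => (expR (- dotp (z *m N w *m (a *: A)^T)
    (z *m N w *m (a *: A)^T) / 2))%:E).
  apply: (@bounded_integrable _ _ _ _ _ 1).
    apply: measurableT_comp => //.
    apply: measurable_funM => //; apply: measurableT_comp => //.
    by apply: measurable_dotp; apply: measurable_mulmx.
  by move=> w; have /andP[? ?] := expR1 w; rewrite ger0_norm.
under eq_integral do rewrite /F EFinM.
rewrite integralZl// EFinM lee_wpmul2l ?lee_fin ?expR_ge0//.
rewrite -(fineK (integrable_fin_num measurableT iF)) lee_fin.
rewrite -/(Rintegral P setT _).
rewrite (Rintegral_expR_gaussian_rows gaussN indepN z gP (a *: A)).
have E w : - (dotp z z * dotp (g w *m (a *: A) *m noise_cov v) (g w *m (a *: A))) / 2 =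
    - s * (\sum_(l | l != Ordinal d_gt0) g w ord0 l ^+ 2) / 2.
  have -> : g w *m (a *: A) = a *: (g w *m A) by rewrite -scalemxAr.
  rewrite quadZ dotp_noise_cov Av AA expr0n/= subr0 a2.
  by field; rewrite !gt_eqF.
under eq_Rintegral do rewrite E.
rewrite /Rintegral (expectation_expR_sqr_standard_normal gP); last first.
  by rewrite (lt_trans _ s0)// oppr_lt0.
rewrite /= (_ : #|_| = d.-1); last by rewrite cardC1 card_ord.
have sq0 : 0 < Num.sqrt (1 + s) by rewrite sqrtr_gt0 addr_gt0.
have rhoV : rho^-1 <= Num.sqrt (1 + s).
  rewrite -[leLHS]ger0_norm; last by rewrite invr_ge0 ltW.
  by rewrite -sqrtr_sqr ler_wsqrtr// exprVn lerDr.
apply: lerXn2r; rewrite ?nnegrE ?invr_ge0; [exact: ltW..|].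
by rewrite -[leRHS]invrK lef_pV2 ?posrE ?invr_gt0.
Qed.

(** Markov's inequality for [exp(a^2 |zN|^2 / 2)]. Dropping the component along [v] only enlarges
    the dual quadratic form, so all [d] coordinates enter and the mean is at most [(1 - s)^(-d/2)]
    with [s = 1/2], hence at most [2^d]. *)
Lemma noise_upper_tail (K : R) :
  (P [set w | K ^+ 2 * dotp z z <= dotp (z *m N w) (z *m N w)]%R <=
   (expR (- (K ^+ 2 * d%:R / 4)) * 2 ^+ d)%:E)%E.
Proof.
have [_ [S [_ _ _ [d' [Om' [P' [g [gP _]]]]]]]] := gaussN i0.
have mg : measurable_fun setT g by case: gP.
pose s : R := 2^-1.
pose a := Num.sqrt (s * d%:R / dotp z z).
have a2 : a ^+ 2 = s * d%:R / dotp z z.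
  by rewrite sqr_sqrtr// divr_ge0 ?ltW// mulr_gt0// invr_gt0.
pose F w := expR (- (K ^+ 2 * d%:R / 4)) *
  expR (a ^+ 2 * dotp (z *m N w) (z *m N w) / 2).
have mexp : measurable_fun setT
    (fun w => expR (a ^+ 2 * dotp (z *m N w) (z *m N w) / 2)).
  apply: measurableT_comp => //.
  by apply: measurable_funM => //; apply: measurable_funM.
apply: (@le_trans _ _ (\int[P]_w (F w)%:E)%E).
  apply: probability_le_integral => //.
  - rewrite (_ : [set w | _] = (fun w => dotp (z *m N w) (z *m N w)) @^-1`
      `[K ^+ 2 * dotp z z, +oo[%classic); last first.
      by apply/seteqP; split => w /=; rewrite in_itv/= andbT.
    by rewrite -[X in measurable X]setTI; exact: mnorm.
  - exact: measurable_funM.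
  - by move=> w; rewrite mulr_ge0 ?expR_ge0.
  - move=> w /= h; rewrite /F -expRD -[leLHS]expR0 ler_expR a2.
    have H : s * d%:R / dotp z z * (K ^+ 2 * dotp z z) <=
        s * d%:R / dotp z z * dotp (z *m N w) (z *m N w).
      by rewrite ler_wpM2l// divr_ge0 ?ltW// mulr_gt0// invr_gt0.
    have E : s * d%:R / dotp z z * (K ^+ 2 * dotp z z) = K ^+ 2 * d%:R / 2.
      by rewrite /s; field; rewrite gt_eqF.
    rewrite E in H; lra.
under eq_integral do rewrite /F EFinM.
rewrite ge0_integralZl//; last exact/measurable_EFinP.
rewrite EFinM lee_wpmul2l ?lee_fin ?expR_ge0//.
rewrite (expectation_expR_sqr_gaussian_rows gaussN indepN z gP).
apply: (@le_trans _ _ (\int[P']_w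
    (expR (- (- s) * (\sum_(l | xpredT l) g w ord0 l ^+ 2) / 2))%:E)%E).
  apply: ge0_le_integral => //.
  - apply/measurable_EFinP; apply: measurableT_comp => //.
    apply: measurable_funM => //; apply: measurable_funM => //.
    by apply: measurable_dotp => //; exact: measurable_mulmx.
  - apply/measurable_EFinP; apply: measurableT_comp => //.
    apply: measurable_funM => //; apply: measurable_funM => //.
    apply: measurable_sum => l; apply: measurable_funX.
    exact: measurable_entry_comp.
  - move=> w _; rewrite lee_fin ler_expR opprK dotp_noise_cov a2.
    rewrite ler_wpM2r ?invr_ge0//.
    have -> : s * d%:R / dotp z z * dotp z z *
        (d%:R^-1 * (dotp (g w) (g w) - dotp (g w) v ^+ 2)) =
        s * (dotp (g w) (g w) - dotp (g w) v ^+ 2).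
      by field; rewrite !gt_eqF.
    rewrite ler_wpM2l ?invr_ge0// dotpE.
    under eq_bigr do rewrite -expr2.
    by rewrite gerBl sqr_ge0.
rewrite (expectation_expR_sqr_standard_normal gP); last first.
  by rewrite /s; lra.
have sq0 : 0 < Num.sqrt (1 + - s) by rewrite sqrtr_gt0 /s; lra.
have sqV : 2^-1 <= Num.sqrt (1 + - s).
  rewrite -[leLHS]ger0_norm ?invr_ge0// -sqrtr_sqr ler_wsqrtr//.
  by rewrite /s; lra.
rewrite lee_fin card_ord; apply: lerXn2r; rewrite ?nnegrE ?invr_ge0 ?(ltW sq0)//.
by rewrite -[leRHS]invrK lef_pV2 ?posrE ?invr_gt0.
Qed.

End noise_tails.

(** * Rounding to integer vectors *)

Section integer_net.
Context {R : realType}.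

(** A sign and a modulus per coordinate, so that the net is a finite type. A zero coordinate has two
    codes, which only enlarges the count. *)
Definition net n L := {ffun 'I_n -> bool * 'I_L.+1}.

Definition net_vec n L (f : net n L) : 'rV[R]_n :=
  \row_i ((-1) ^+ (f i).1 * (f i).2%:R).

Definition in_ball n M (f : net n (M * n)) : bool :=
  (\sum_i (f i).2 <= M * n)%N.

Lemma bernoulli_le (t : R) j : 0 <= t <= 1 -> 1 - j%:R * t <= (1 - t) ^+ j.
Proof.
move=> /andP[t0 t1]; elim: j => [|j IH]; first by rewrite mul0r subr0 expr0.
rewrite exprS; apply: (@le_trans _ _ ((1 - t) * (1 - j%:R * t))).
  have : 0 <= j%:R * t * t by rewrite !mulr_ge0.
  rewrite -natr1; lra.
by rewrite ler_wpM2l// subr_ge0.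
Qed.

(* Each net point carries the weight x^|z|_1 with x = 1 - 1/M, so the weights
   of all points add up to at most (2M)^n, and a point of the ball weighs at
   least x^(Mn) >= 4^(-n). *)
Lemma card_ball n M : (0 < M)%N -> ~~ odd M ->
  (#|[pred f : net n (M * n) | in_ball f]|%:R : R) <= (8 * M%:R) ^+ n.
Proof.
move=> M0 oM; have M0R : (0 : R) < M%:R by rewrite ltr0n.
pose x : R := 1 - M%:R^-1.
have M1 : M%:R^-1 <= (1 : R) by rewrite invf_le1// ler1n.
have x0 : 0 <= x by rewrite subr_ge0.
have x1 : x <= 1 by rewrite gerBl invr_ge0 ltW.
(* [M] is even, so Bernoulli's inequality at exponent [M/2] gives [x^(M/2) >= 1/2], and one
   squares. *)
have xM : 4^-1 <= x ^+ M.
  have -> : M = (M./2 * 2)%N by rewrite muln2 even_halfK.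
  rewrite exprM (_ : 4^-1 = (2^-1) ^+ 2 :> R); last by rewrite exprVn -natrX.
  apply: lerXn2r; rewrite ?nnegrE ?exprn_ge0 ?invr_ge0//.
  apply: le_trans (bernoulli_le M./2 (t := M%:R^-1) _); last first.
    by rewrite invr_ge0 ltW.
  rewrite le_eqVlt; apply/orP; left; apply/eqP.
  have {2}-> : M = (2 * M./2)%N by rewrite mul2n even_halfK.
  have h0 : (M./2%:R : R) != 0.
    rewrite pnatr_eq0 -lt0n half_gt0.
    by case: (M) M0 oM => [|[|]].
  by rewrite natrM; field.
pose w (f : net n (M * n)) := \prod_i x ^+ (f i).2.
have w0 f : 0 <= w f by apply: prodr_ge0 => i _; exact: exprn_ge0.
have wball f : in_ball f -> (4^-1) ^+ n <= w f.
  move=> fb; apply: (@le_trans _ _ (x ^+ (M * n))).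
    by rewrite exprM; apply: lerXn2r; rewrite ?nnegrE ?exprn_ge0 ?invr_ge0.
  by rewrite /w prodrXr ler_wiXn2l.
(* The sum factors over the coordinates; each contributes two signs and a geometric sum bounded by
   [1/(1 - x) = M]. *)
have sumw : \sum_f w f <= (2 * M%:R) ^+ n.
  rewrite /w -(bigA_distr_bigA (fun _ (c : bool * 'I_(M * n).+1) => x ^+ c.2)).
  rewrite prodr_const card_ord; apply: lerXn2r.
  - by rewrite nnegrE sumr_ge0// => c _; exact: exprn_ge0.
  - by rewrite nnegrE mulr_ge0.
  rewrite -(pair_big xpredT xpredT (fun _ (i : 'I_(M * n).+1) => x ^+ i))/=.
  have G : (1 - x) * (\sum_(i < (M * n).+1) x ^+ i) <= 1.
    rewrite -[X in X * _]opprB mulNr -subrX1 opprB gerBl.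
    exact: exprn_ge0.
  have {}G : \sum_(i < (M * n).+1) x ^+ i <= M%:R.
    move: G; rewrite /x opprB addrC subrK mulrC -ler_pdivlMr ?invr_gt0//.
    by rewrite invrK mul1r.
  by rewrite big_bool/= (mulr_natl _ 2) mulr2n lerD.
have : #|[pred f : net n (M * n) | in_ball f]|%:R * (4^-1) ^+ n <= (2 * M%:R) ^+ n :> R.
  apply: le_trans sumw; rewrite mulr_natl -sumr_const.
  rewrite [leRHS](bigID (@in_ball n M))/= -[leLHS]addr0 lerD//.
    exact: ler_sum.
  by rewrite sumr_ge0.
move=> h; have -> : (8 * M%:R) ^+ n = (2 * M%:R) ^+ n * 4 ^+ n :> R.
  by rewrite -exprMn; congr (_ ^+ n); ring.
by rewrite -ler_pdivrMr ?exprn_gt0// -exprVn.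
Qed.

(** By Cauchy-Schwarz a vector of norm [M sqrt n] has l1-norm at most [Mn]; truncating coordinates
    towards 0 does not increase it, so the rounded vector stays in the ball. *)
Lemma net_roundP n M (p : 'rV[R]_n) : (0 < n)%N -> (0 < M)%N ->
  dotp p p = (M%:R) ^+ 2 * n%:R -> exists2 f : net n (M * n), in_ball f &
    forall i, `|p ord0 i - net_vec f ord0 i| <= 1.
Proof.
move=> n0 M0 pp.
have l1 : \sum_i `|p ord0 i| <= (M * n)%:R.
  rewrite -ler_sqr ?nnegrE ?sumr_ge0//.
  have := dotp_sqr_le (\row_i `|p ord0 i|) (const_mx 1).
  have -> : dotp (\row_i `|p ord0 i|) (const_mx 1) = \sum_i `|p ord0 i|.
    by rewrite dotpE; apply: eq_bigr => i _; rewrite !mxE mulr1.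
  have -> : dotp (\row_i `|p ord0 i|) (\row_i `|p ord0 i|) = dotp p p.
    rewrite !dotpE; apply: eq_bigr => i _.
    by rewrite !mxE -expr2 real_normK ?num_real// expr2.
  have -> : dotp (const_mx 1 : 'rV[R]_n) (const_mx 1) = n%:R.
    rewrite dotpE; under eq_bigr do rewrite !mxE mulr1.
    by rewrite sumr_const card_ord.
  by rewrite pp natrM exprMn -mulrA -expr2.
pose t i := Num.truncn `|p ord0 i|.
have tP i : (t i)%:R <= `|p ord0 i| < (t i).+1%:R.
  by apply: Num.Theory.truncn_itv.
have tsum : (\sum_i t i <= M * n)%N.
  rewrite -(ler_nat R) (le_trans _ l1)// natr_sum.
  by apply: ler_sum => i _; have /andP[] := tP i.
have tle i : (t i < (M * n).+1)%N.
  by rewrite ltnS (leq_trans _ tsum)// (bigD1 i)//= leq_addr.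
exists [ffun i => (p ord0 i < 0, Ordinal (tle i))].
  by rewrite /in_ball; under eq_bigr do rewrite ffunE/=.
move=> i; rewrite mxE ffunE/=; have /andP[h1 h2] := tP i.
have [p0|p0] := ltP (p ord0 i) 0.
  move: h1 h2; rewrite ltr0_norm// expr1 mulN1r opprK -natr1 => h1 h2.
  by rewrite ler_norml; apply/andP; split; lra.
move: h1 h2; rewrite ger0_norm// expr0 mul1r -natr1 => h1 h2.
by rewrite ler_norml; apply/andP; split; lra.
Qed.

Lemma sign_in_net n M (e : 'rV[R]_n) : (0 < n)%N -> (0 < M)%N ->
  (forall i, e ord0 i = 1 \/ e ord0 i = -1) ->
  exists2 f : net n (M * n), in_ball f & net_vec f = e.
Proof.
move=> n0 M0 he.
have L1 : (1 < (M * n).+1)%N by rewrite ltnS muln_gt0 M0.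
exists [ffun i => (e ord0 i == -1, Ordinal L1)].
  rewrite /in_ball; under eq_bigr do rewrite ffunE/=.
  by rewrite sum1_card card_ord leq_pmull.
apply/rowP => i; rewrite mxE ffunE/= mulr1.
have [->|] := eqVneq (e ord0 i) (-1); first by rewrite expr1.
by case: (he i) => ->; rewrite ?eqxx.
Qed.

(* Rounding a multiple of a real vector to the net turns the lower bound into
   [net_good_lower]; the upper one, used at sign vectors, bounds the sum of the
   |<w, N_i>|. *)
Definition net_good n d M (N : 'M[R]_(n, d)) : Prop :=
  forall f : net n (M * n), in_ball f -> net_vec f != 0 ->
  16 / M%:R * dotp (net_vec f) (net_vec f)
    <= dotp (net_vec f *m N) (net_vec f *m N)
    <= M%:R * dotp (net_vec f) (net_vec f).

Section net_good_consequences.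
Context (n d M : nat) (N : 'M[R]_(n, d)).
Hypotheses (n0 : (0 < n)%N) (M2 : (1 < M)%N) (good : net_good M N).

Let M0 : (0 < M)%N. Proof. exact: ltnW. Qed.
Let nR : (0 : R) < n%:R. Proof. by rewrite ltr0n. Qed.
Let MR : (2 : R) <= M%:R. Proof. by rewrite ler_nat. Qed.

Let sgn_row (x : 'I_n -> R) : 'rV[R]_n := \row_i (-1) ^+ (x i < 0)%R.

Let sgn_row_dotp x : dotp (sgn_row x) (sgn_row x) = n%:R.
Proof.
rewrite dotpE; under eq_bigr do rewrite !mxE -expr2 sqrr_sign.
by rewrite sumr_const card_ord.
Qed.

Let sgn_row_norm x : enorm (sgn_row x *m N) <= Num.sqrt (M%:R * n%:R).
Proof.
have [|f fb fE] := @sign_in_net n M (sgn_row x) n0 M0.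
  by move=> i; rewrite mxE; case: (x i < 0)%R; rewrite ?expr1 ?expr0; [right|left].
have z0 : net_vec f != 0 by rewrite fE -dotp_eq0 sgn_row_dotp gt_eqF.
have /andP[_] := good fb z0; rewrite fE sgn_row_dotp => h.
by rewrite /enorm ler_wsqrtr.
Qed.

Lemma net_good_sum_abs (w : 'rV[R]_d) :
  \sum_i `|dotp w (row i N)| <= Num.sqrt (M%:R * n%:R) * enorm w.
Proof.
pose s := sgn_row (fun i => dotp w (row i N)).
have -> : \sum_i `|dotp w (row i N)| = dotp w (s *m N).
  rewrite dotp_rowE; apply: eq_bigr => i _; rewrite mxE.
  have [h|h] := ltP (dotp w (row i N)) 0.
    by rewrite expr1 mulN1r ltr0_norm.
  by rewrite expr0 mul1r ger0_norm.
rewrite (le_trans (ler_norm _))// (le_trans (normr_dotp_le _ _))// mulrC.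
by rewrite ler_wpM2r ?enorm_ge0//; exact: sgn_row_norm.
Qed.

(** Scale [p] to a vector [q] of norm [M sqrt n] and round it to [z]. The net gives
    [|zN| >= (4 / sqrt M) |z|], of order [4 sqrt(Mn)], while the rounding error costs only
    [sqrt(Mn)]. *)
Lemma net_good_lower (p : 'rV[R]_n) : dotp p p <= M%:R * dotp (p *m N) (p *m N).
Proof.
have [->|p0] := eqVneq p 0; first by rewrite dotp0l mulr_ge0 ?dotp_ge0.
have pp : 0 < dotp p p by rewrite lt_neqAle dotp_ge0 andbT eq_sym dotp_eq0.
pose t := M%:R * Num.sqrt (n%:R / dotp p p).
have t0 : 0 < t by rewrite mulr_gt0 ?ltr0n// sqrtr_gt0 divr_gt0.
have tp : dotp (t *: p) (t *: p) = M%:R ^+ 2 * n%:R.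
  rewrite dotpZl dotpZr mulrA -expr2 exprMn sqr_sqrtr ?divr_ge0 ?ltW//.
  by rewrite -!mulrA mulVf ?gt_eqF// mulr1.
suff H : dotp (t *: p) (t *: p) <= M%:R * dotp ((t *: p) *m N) ((t *: p) *m N).
  have tt : 0 < t * t by rewrite mulr_gt0.
  move: H; rewrite -scalemxAl !dotpZl !dotpZr => H.
  by rewrite -(ler_pM2l tt); lra.
move: (t *: p) tp => {t t0 p0 pp} q qq.
have [f fb fq] := net_roundP n0 M0 qq.
set z := net_vec f in fq *; pose r := q - z.
have qE : q = z + r by rewrite /r addrC subrK.
have sn0 : 0 < Num.sqrt n%:R :> R by rewrite sqrtr_gt0.
have rn : enorm r <= Num.sqrt n%:R.
  rewrite /enorm ler_wsqrtr// dotpE.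
  apply: (@le_trans _ _ (\sum_(i < n) (1 : R))); last by rewrite sumr_const card_ord.
  apply: ler_sum => i _; rewrite -expr2 -real_normK ?num_real// expr_le1//.
  by have := fq i; rewrite !mxE.
have qn : enorm q = M%:R * Num.sqrt n%:R.
  by rewrite /enorm qq sqrtrM ?sqr_ge0// sqrtr_sqr ger0_norm.
have zn : (M%:R - 1) * Num.sqrt n%:R <= enorm z.
  rewrite mulrBl mul1r -qn qE lerBlDr (le_trans (enormD _ _))//.
  by rewrite lerD2l.
have z0 : z != 0.
  apply/eqP => z0; move: zn; rewrite z0 /enorm dotp0l sqrtr0.
  rewrite pmulr_lle0// subr_le0 => h.
  by have := MR; lra.
(* The coordinates of [r] are at most 1, so [|rN|^2 = sum_i r_i <rN, N_i>] is bounded by the sum of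
   the [|<w, N_i>|] at [w = rN]; one then divides by [|rN|]. *)
have rN : enorm (r *m N) <= Num.sqrt (M%:R * n%:R).
  have [->|rN0] := eqVneq (r *m N) 0; first by rewrite /enorm dotp0l sqrtr0 sqrtr_ge0.
  have e0 : 0 < enorm (r *m N).
    by rewrite lt_neqAle enorm_ge0 andbT eq_sym sqrtr_eq0 -ltNge lt_neqAle
      dotp_ge0 andbT eq_sym dotp_eq0.
  rewrite -(ler_pM2r e0) -expr2 enorm_sqr dotp_rowE.
  apply: le_trans (net_good_sum_abs _); apply: ler_sum => i _.
  rewrite (le_trans (ler_norm _))// normrM ler_piMl//.
  by have := fq i; rewrite !mxE.
have /andP[zN _] := good fb z0; rewrite -/z in zN.
have sM0 : 0 < Num.sqrt M%:R :> R by rewrite sqrtr_gt0 ltr0n.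
have zN' : 4 / Num.sqrt M%:R * enorm z <= enorm (z *m N).
  rewrite -ler_sqr ?nnegrE ?mulr_ge0 ?enorm_ge0 ?invr_ge0 ?(ltW sM0)//.
  rewrite exprMn !enorm_sqr exprMn exprVn sqr_sqrtr//.
  by have -> : 4 ^+ 2 = 16 :> R by ring.
have qN : enorm (z *m N) <= enorm (q *m N) + enorm (r *m N).
  have -> : z *m N = q *m N - r *m N by rewrite qE mulmxDl addrK.
  by rewrite (le_trans (enormD _ _))// enormN.
suff : Num.sqrt M%:R * Num.sqrt n%:R <= enorm (q *m N).
  move=> h; rewrite qq.
  have h2 : (Num.sqrt M%:R * Num.sqrt n%:R) ^+ 2 <= enorm (q *m N) ^+ 2.
    by apply: lerXn2r; rewrite ?nnegrE ?mulr_ge0 ?enorm_ge0 ?sqrtr_ge0.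
  move: h2; rewrite exprMn !enorm_sqr.
  rewrite !(sqr_sqrtr (ler0n _ _)) => h2.
  by rewrite expr2 -mulrA ler_wpM2l.
rewrite sqrtrM// in rN.
set a := Num.sqrt M%:R in sM0 zN' rN *.
set b := Num.sqrt n%:R in sn0 zn rN *.
have aa : a * a = M%:R by rewrite -expr2 sqr_sqrtr.
(* With [a = sqrt M] and [b = sqrt n]: of the [4ab], the difference between [M - 1] and [M] costs at
   most [2ab] since [M >= 2], the rounding error [ab], and [ab] remains. This accounts for the 16 in
   [net_good]. *)
have h1 : 4 / a * ((M%:R - 1) * b) <= enorm (z *m N).
  by rewrite (le_trans _ zN')// ler_wpM2l// divr_ge0// ltW.
have h2 : 4 / a * ((M%:R - 1) * b) = 4 * a * b - 4 / a * b.
  by rewrite -aa; field; rewrite gt_eqF.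
have h3 : 4 / a * b <= 2 * (a * b).
  rewrite mulrA ler_wpM2r ?(ltW sn0)// ler_pdivrMr// -mulrA aa.
  by have := MR; lra.
rewrite h2 in h1; lra.
Qed.

End net_good_consequences.

End integer_net.

Section finite_events.
Context d0 (Om : measurableType d0) (R : realType).

Lemma measurable_forall_fin (I : finType) (A : I -> set Om) :
  (forall i, measurable (A i)) -> measurable [set w | forall i, A i w].
Proof.
move=> mA; rewrite (_ : [set w | _] = \bigcap_(i in [set: I]) A i).
  by apply: fin_bigcap_measurable => // i _; exact: mA.
by apply/seteqP; split => [w h i _|w h i]; exact: h.
Qed.

Lemma measurable_le_fun (f g : Om -> R) :
  measurable_fun setT f -> measurable_fun setT g ->
  measurable [set w | f w <= g w].
Proof.
move=> mf mg; have := measurable_fun_le measurableT mf mg.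
by rewrite setTI.
Qed.

Lemma measurable_lt_fun (f g : Om -> R) :
  measurable_fun setT f -> measurable_fun setT g ->
  measurable [set w | f w < g w].
Proof.
move=> mf mg; rewrite (_ : [set w | _] = ~` [set w | g w <= f w]).
  by apply: measurableC; exact: measurable_le_fun.
by apply/seteqP; split => w /=; [rewrite ltNge => /negP|move/negP; rewrite -ltNge].
Qed.

Lemma measurable_eq_fun (f g : Om -> R) :
  measurable_fun setT f -> measurable_fun setT g ->
  measurable [set w | f w = g w].
Proof.
move=> mf mg; rewrite (_ : [set w | _] = [set w | f w <= g w] `&` [set w | g w <= f w]).
  by apply: measurableI; exact: measurable_le_fun.
apply/seteqP; split => w /=; first by move=> ->.
by move=> [h1 h2]; apply/eqP; rewrite eq_le h1.
Qed.

Lemma measurable_propI (Q : Prop) (A : set Om) :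
  measurable A -> measurable [set w | Q -> A w].
Proof.
move=> mA; have [q|nq] := pselect Q.
  by rewrite (_ : [set w | _] = A)//; apply/seteqP; split => w /=; [apply|].
rewrite (_ : [set w | _] = setT)//.
by apply/seteqP; split => w //= _ /nq.
Qed.

Lemma union_bound (P : probability Om R) (I : finType) (A : I -> set Om) :
  (forall i, measurable (A i)) ->
  (P [set w | exists i, A i w] <= \sum_i P (A i))%E.
Proof.
move=> mA; rewrite (_ : [set w | _] = \big[setU/set0]_(i <- enum I) A i).
  rewrite (_ : \sum_i P (A i) = \sum_(i <- enum I) P (A i))%E; last by rewrite big_enum.
  elim: (enum I) => [|i s IH]; first by rewrite !big_nil measure0.
  rewrite !big_cons (le_trans (measureU2 _ _ _))//.
    by apply: bigsetU_measurable.
  by rewrite leeD2l.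
rewrite -bigcup_seq; apply/seteqP; split => w /=.
  by move=> [i Ai]; exists i => //=; rewrite mem_enum.
by move=> [i _ Ai]; exists i.
Qed.

End finite_events.

(** * Union bound over the net *)

Section net_probability.
Context d0 (Om : measurableType d0) (R : realType) (P : probability Om R).

Lemma measurable_net_good (n d M : nat) :
  measurable [set N : 'M[R]_(n, d) | net_good M N].
Proof.
pose B (f : net n (M * n)) : set 'M[R]_(n, d) :=
  [set N : 'M[R]_(n, d) | 16 / M%:R * dotp (net_vec f) (net_vec f) <=
     dotp (net_vec f *m N) (net_vec f *m N)] `&`
  [set N | dotp (net_vec f *m N) (net_vec f *m N) <=
     M%:R * dotp (net_vec f) (net_vec f)].
have mB f : measurable (B f).
  have mz : measurable_fun setT (fun N : 'M[R]_(n, d) => net_vec (R := R) f *m N).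
    by apply: measurable_mulmx; [exact: measurable_cst|exact: measurable_id].
  by apply: measurableI; apply: measurable_le_fun => //; exact: measurable_dotp.
rewrite (_ : [set N | _] = [set N | forall f, in_ball f ->
    net_vec (R := R) f != 0 -> B f N]).
  apply: (@measurable_forall_fin _ _ _
    (fun f => [set N | in_ball f -> net_vec (R := R) f != 0 -> B f N])) => f.
  by apply: (@measurable_propI _ _ _
    [set N | net_vec (R := R) f != 0 -> B f N]); exact: measurable_propI.
apply/seteqP; split => N /= h f fb z0; have := h f fb z0; first by move/andP.
by move=> [/= -> ->].
Qed.

Context (n d : nat) (v : 'rV[R]_d) (N : Om -> 'M[R]_(n, d)).
Hypotheses (n0 : (0 < n)%N) (dn : (8 * n <= d)%N).
Hypothesis v1 : dotp v v = 1.
Hypothesis gaussN :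
  forall i, centered_gaussian P (fun w => row i (N w)) (noise_cov v).
Hypothesis indepN : mutually_independent P
  (fun i : 'I_n => sigma_of (fun w => row i (N w))).

Let d0' : (0 < d)%N. Proof. by rewrite (leq_trans _ dn)// muln_gt0. Qed.

Let expR_half_le2 : expR 2^-1 <= 2 :> R.
Proof.
have : (2 : R)^-1 <= expR (- 2^-1).
  by apply: le_trans (expR_ge1Dx _); lra.
by rewrite expRN lef_pV2 ?posrE ?expR_gt0.
Qed.

Let expRN1_le : expR (-1) <= 2^-1 :> R.
Proof.
rewrite expRN lef_pV2 ?posrE ?expR_gt0//.
by apply: le_trans (expR_ge1Dx _); lra.
Qed.

(** The two tails at [rho = 4/K] and [K = 2^q], each below [2^(3d) / 2^(q(d-1))]: the lower one
    through [exp(1/2) <= 2], the upper one through [exp(-1) <= 1/2] and [K^2/4 = 4^(q-1) >= q]. *)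
Let tail_bound (q : nat) : (0 < q)%N ->
  expR (d%:R / 2) * (4 / 2 ^+ q) ^+ d.-1 +
  expR (- ((2 ^+ q) ^+ 2 * d%:R / 4)) * 2 ^+ d <=
  2 ^+ (3 * d).+1 / 2 ^+ (q * d.-1) :> R.
Proof.
move=> q0.
have p2 k : 0 < 2 ^+ k :> R by rewrite exprn_gt0.
have -> : 2 ^+ (3 * d).+1 / 2 ^+ (q * d.-1) =
    2 ^+ (3 * d) / 2 ^+ (q * d.-1) + 2 ^+ (3 * d) / 2 ^+ (q * d.-1) :> R.
  by rewrite exprS -mulrDl; congr (_ / _); ring.
apply: lerD.
  rewrite expr_div_n -exprM mulrA ler_wpM2r ?invr_ge0 ?exprn_ge0//.
  rewrite expRM_natl.
  apply: (@le_trans _ _ (2 ^+ d * 2 ^+ (2 * d))); last first.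
    by rewrite -exprD -{1}(mul1n d) -mulnDl.
  apply: ler_pM; rewrite ?exprn_ge0 ?expR_ge0//.
    by apply: lerXn2r; rewrite ?nnegrE ?expR_ge0.
  rewrite exprM (_ : 2 ^+ 2 = 4 :> R); last by ring.
  by rewrite ler_weXn2l ?leq_pred//; lra.
have E : (2 ^+ q) ^+ 2 / 4 = (4 ^ q.-1)%:R :> R.
  case: q q0 => // q _ /=; rewrite -exprM mulnC exprM natrX exprS.
  rewrite (_ : 2 ^+ 2 = 4 :> R); last by ring.
  by field.
have -> : (2 ^+ q) ^+ 2 * d%:R / 4 = (4 ^ q.-1 * d)%:R :> R.
  by rewrite natrM -E; ring.
rewrite -mulrN1 expRM_natl mulrC.
apply: ler_pM; rewrite ?exprn_ge0 ?expR_ge0//.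
  by rewrite ler_weXn2l ?leq_pmull//; lra.
rewrite -exprVn; apply: (@le_trans _ _ (2^-1 ^+ (4 ^ q.-1 * d))).
  by apply: lerXn2r; rewrite ?nnegrE ?expR_ge0 ?invr_ge0.
apply: ler_wiXn2l; rewrite ?invr_ge0//; first by lra.
apply: leq_mul; last exact: leq_pred.
by case: q q0 E => // q _ _ /=; exact: ltn_expl.
Qed.

(** With [q = 16r] and [M = K^2 = 2^(2q)], the net contributes the exponent [(3 + 32r)n] of 2 and a
    single point [3d + 1 - 16r(d-1)]. Since [8n <= d] and [d >= 8], the positive terms stay below
    [11rd], which leaves [-5rd]. *)
Lemma net_bad_probability (r M : nat) : (0 < r)%N ->
  M = (2 ^ (16 * r) * 2 ^ (16 * r))%N ->
  (P [set w | ~ net_good M (N w)] <= (2^-1 ^+ (5 * r * d))%:E)%E.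
Proof.
move=> r0 ME; set q := (16 * r)%N in ME.
have q0 : (0 < q)%N by rewrite muln_gt0.
pose K : R := 2 ^+ q.
have K0 : 0 < K by rewrite exprn_gt0.
have MK : M%:R = K ^+ 2 by rewrite ME natrM natrX expr2.
have M0 : (0 < M)%N by rewrite ME muln_gt0 !expn_gt0.
have oM : ~~ odd M by rewrite ME oddM oddX andbb; case: (q) q0.
pose z (f : net n (M * n)) : 'rV[R]_n := net_vec f.
pose A (f : net n (M * n)) := if in_ball f && (z f != 0) then
  [set w | dotp (z f *m N w) (z f *m N w) <= (4 / K) ^+ 2 * dotp (z f) (z f)] `|`
  [set w | K ^+ 2 * dotp (z f) (z f) <= dotp (z f *m N w) (z f *m N w)] else set0.
have mN : measurable_fun setT N by exact: measurable_gaussian_matrix gaussN.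
have mn f : measurable_fun setT (fun w => dotp (z f *m N w) (z f *m N w)).
  by apply: measurable_dotp; apply: measurable_mulmx.
have mA f : measurable (A f).
  rewrite /A; case: ifP => // _.
  by apply: measurableU; apply: measurable_le_fun.
pose c : R := 2 ^+ (3 * d).+1 / 2 ^+ (q * d.-1).
have c0 : 0 <= c by rewrite divr_ge0 ?exprn_ge0.
have PA f : (P (A f) <= (if in_ball f then c else 0)%:E)%E.
  rewrite /A; have [fb/=|] := boolP (in_ball f); last by rewrite measure0.
  have [_|z0] /= := eqVneq (z f) 0; first by rewrite measure0 lee_fin.
  rewrite (le_trans (measureU2 _ _ _))//; [exact: measurable_le_fun..|].
  have rho0 : 0 < 4 / K by rewrite divr_gt0.
  have h1 := noise_lower_tail d0' v1 gaussN indepN z0 rho0.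
  have h2 := noise_upper_tail d0' gaussN indepN z0 K.
  rewrite (le_trans (leeD h1 h2))// -EFinD lee_fin.
  exact: tail_bound.
apply: (@le_trans _ _ (P [set w | exists f, A f w])).
  apply: le_measure; rewrite ?inE.
  - have := mN measurableT _ (@measurable_net_good n d M).
    by rewrite setTI => /measurableC.
  - rewrite (_ : [set w | _] = \bigcup_f A f).
      by apply: fin_bigcup_measurable => [|f _]; [exact: finite_finset|exact: mA].
    by apply/seteqP; split => [w [f Af]|w [f _ Af]]; exists f.
  move=> w /= /existsNP[f] /not_implyP[fb] /not_implyP[z0 h].
  exists f; rewrite /A fb z0/=.
  have e16 : (4 / K) ^+ 2 = 16 / K ^+ 2 by rewrite exprMn exprVn; congr (_ / _); ring.
  move: h => /negP; rewrite negb_and -!ltNge MK => /orP[h|h].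
    by left; rewrite /= e16; exact: ltW.
  by right; exact: ltW.
rewrite (le_trans (union_bound P mA))//.
rewrite (le_trans (lee_sum _ (fun f _ => PA f)))// sumEFin lee_fin.
rewrite -big_mkcond/= sumr_const -[X in X <= _]mulr_natl.
apply: (@le_trans _ _ ((8 * M%:R) ^+ n * c)).
  by rewrite ler_wpM2r// card_ball.
have -> : (8 * M%:R) ^+ n = 2 ^+ ((3 + q * 2) * n) :> R.
  rewrite exprM exprD MK /K -exprM; congr ((_ * _) ^+ _).
  by ring.
rewrite /c mulrA -exprD ler_pdivrMr ?exprn_gt0// exprVn mulrC ler_pdivlMr ?exprn_gt0//.
rewrite -exprD ler_weXn2l//; first by lra.
rewrite /q; have rn : (r * (8 * n) <= r * d)%N by rewrite leq_mul2l dn orbT.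
have rd : (d <= r * d)%N by rewrite leq_pmull.
have d8 : (8 <= d)%N by rewrite (leq_trans _ dn)// leq_pmulr.
have r8 : (r * 8 <= r * d)%N by rewrite leq_mul2l d8 orbT.
have E1 : ((3 + 16 * r * 2) * n = 3 * n + 32 * (r * n))%N by ring.
have E2 : (5 * r * d = 5 * (r * d))%N by ring.
have E3 : (r * (8 * n) = 8 * (r * n))%N by ring.
have E4 : (16 * r * d.-1 + 16 * r = 16 * (r * d))%N.
  by rewrite -mulnSr prednK ?(leq_trans _ d8)// mulnA.
move: rn E1 E2 E4 rd r8 dn d8 r0; rewrite E3 => rn -> -> E4 rd r8 dn8 d8 r1.
set a := (r * n)%N in rn *; set b := (r * d)%N in rn E4 rd r8 *.
set e := (16 * r * d.-1)%N in E4 *.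
lia.
Qed.

End net_probability.

(** * Gradient descent on separable data *)

Section leaky_relu_facts.
Context {R : realType} (alpha : R).
Hypothesis alpha01 : 0 < alpha <= 1.

Let a0 : 0 < alpha. Proof. by case/andP: alpha01. Qed.
Let a1 : alpha <= 1. Proof. by case/andP: alpha01. Qed.

Lemma leaky_reluE z : leaky_relu alpha z = leaky_relu' alpha z * z.
Proof.
rewrite /leaky_relu /leaky_relu'; have [z0|z0] := leP 0 z.
  by rewrite mul1r max_l// ler_piMl.
by rewrite max_r// ler_niMl// ltW.
Qed.

Lemma leaky_relu'_itv z : alpha <= leaky_relu' alpha z <= 1.
Proof. by rewrite /leaky_relu'; case: ifP => _; rewrite ?lexx ?a1. Qed.

Lemma leaky_relu_lip x y : `|leaky_relu alpha x - leaky_relu alpha y| <= `|x - y|.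
Proof.
rewrite !leaky_reluE /leaky_relu'.
have H (u w : R) : w < u -> `|(if 0 <= u then 1 else alpha) * u -
    (if 0 <= w then 1 else alpha) * w| <= `|u - w|.
  move=> uw; have uw0 : 0 <= u - w by rewrite subr_ge0 ltW.
  rewrite (ger0_norm uw0) ler_norml.
  have b0 : 0 <= 1 - alpha by rewrite subr_ge0.
  have p1 := mulr_ge0 b0 uw0; have p2 := mulr_ge0 (ltW a0) uw0.
  have [u0|u0] := leP 0 u; have [w0|w0] := leP 0 w; try by apply/andP; split; lra.
  have w0' : 0 <= - w by rewrite oppr_ge0 ltW.
  have p3 := mulr_ge0 b0 w0'; have p4 := mulr_ge0 (ltW a0) w0'.
  by apply/andP; split; lra.
have [xy|yx|->] := ltgtP x y; last by rewrite !subrr normr0.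
  by rewrite distrC (distrC x) H.
exact: H.
Qed.

End leaky_relu_facts.

Section network_facts.
Context {R : realType} {d m : nat} (alpha : R).
Hypothesis alpha01 : 0 < alpha <= 1.
Implicit Types (W : 'M[R]_(m.*2, d)) (x : 'rV[R]_d).

Lemma out_sign_sqr (j : 'I_m.*2) : out_sign (R := R) j * out_sign j = 1.
Proof. by rewrite /out_sign -expr2 sqrr_sign. Qed.

Lemma normr_out_sign (j : 'I_m.*2) : `|out_sign (R := R) j| = 1.
Proof. by rewrite /out_sign normrX normrN1 expr1n. Qed.

Lemma network_lip W x x' :
  `|network alpha W x - network alpha W x'| <=
  \sum_(j < m.*2) `|dotp (row j W) (x - x')|.
Proof.
rewrite /network -sumrB (le_trans (ler_norm_sum _ _ _))//.
apply: ler_sum => j _; rewrite -mulrBr normrM normr_out_sign mul1r.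
by rewrite (le_trans (leaky_relu_lip alpha01 _ _))// dotpDr dotpNr.
Qed.

End network_facts.

Lemma sumr_const_double (R : realType) m (c : R) :
  \sum_(j < m.*2) c = 2 * m%:R * c.
Proof.
by rewrite sumr_const card_ord -[LHS]mulr_natl -muln2 natrM (mulrC m%:R).
Qed.

Section gradient_descent.
Context {R : realType} {d n m : nat} (alpha eta lam : R).
Context (X : 'M[R]_(n, d)) (yh : 'rV[R]_n) (W0 : 'M[R]_(m.*2, d)).
Context (ws : 'rV[R]_d).
Hypotheses (n0 : (0 < n)%N) (m0 : (0 < m)%N).
Hypothesis alpha01 : 0 < alpha <= 1.
Hypothesis yh1 : forall i, yh ord0 i = 1 \/ yh ord0 i = -1.
Hypothesis margin : forall i, 1 <= yh ord0 i * dotp ws (row i X).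
Hypothesis adm : gd_admissible alpha X eta lam W0.

Notation W t := (gd alpha eta X yh W0 t).
Notation F t := (active_set alpha (W t) X yh).
Notation U t := (\sum_(j < m.*2) enorm (row j (W t))).

Let a0 : 0 < alpha. Proof. by case/andP: alpha01. Qed.
Let a1 : alpha <= 1. Proof. by case/andP: alpha01. Qed.
Let eta0 : 0 < eta. Proof. by case: adm. Qed.
Let mR : (0 : R) < m%:R. Proof. by rewrite ltr0n. Qed.
Let nR : (0 : R) < n%:R. Proof. by rewrite ltr0n. Qed.

Let yhn i : `|yh ord0 i| = 1.
Proof. by case: (yh1 i) => ->; rewrite ?normrN1 ?normr1. Qed.

Let r := enorm ws.

Let xr i : 1 <= r * enorm (row i X).
Proof.
apply: le_trans (margin i) _; rewrite (le_trans (ler_norm _))//.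
by rewrite normrM yhn mul1r normr_dotp_le.
Qed.

Let r0 : 0 < r.
Proof.
rewrite lt_neqAle enorm_ge0 andbT; apply/eqP => h.
by have := xr (Ordinal n0); rewrite -h mul0r ler10.
Qed.

(** Margin 1 forces [|x_i| >= 1/r] for every [i], so the initial rows together have norm at most
    [2r], comparable with the separator itself. *)
Let lam_le : lam <= r / m%:R.
Proof.
case: adm => _ lam0 _ hl _.
have mn : r^-1 <= min_norm X.
  have xi i : r^-1 <= enorm (row i X).
    by rewrite -[leLHS]mul1r ler_pdivrMr// mulrC.
  rewrite /min_norm; apply: le_bigmin => [|i _]; last exact: xi.
  apply: le_trans (xi (Ordinal n0)) _.
  by rewrite /max_norm (le_bigmax (0 : R) (fun i => enorm (row i X))).
have mn0 : 0 < min_norm X by apply: lt_le_trans mn; rewrite invr_gt0.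
apply: le_trans hl _; rewrite invfM mulrA mulrAC ler_pM2r ?invr_gt0//.
apply: (@le_trans _ _ (1 * (min_norm X)^-1)).
  by rewrite ler_wpM2r ?invr_ge0 ?(ltW mn0)// -sqrtr1 ler_wsqrtr.
by rewrite mul1r -[leRHS]invrK lef_pV2 ?posrE ?invr_gt0.
Qed.

Let V := 2 * m%:R * lam.

Let U0V : U 0 <= V.
Proof.
case: adm => _ _ _ _ hW; rewrite /gd/=.
apply: (@le_trans _ _ (\sum_(j < m.*2) lam)); first by apply: ler_sum => j _.
by rewrite sumr_const_double.
Qed.

Let V2r : V <= 2 * r.
Proof.
rewrite /V -mulrA ler_wpM2l//; have := lam_le.
by rewrite ler_pdivlMr// mulrC.
Qed.

(** The clock of the perceptron argument: each active example at each step counts once. *)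
Definition updates t : nat := \sum_(s < t) #|F s|.

Let update t j := \sum_(i in F t)
  (yh ord0 i * leaky_relu' alpha (dotp (row j (W t)) (row i X))) *: row i X.

Let rowS t j : row j (W t.+1) = row j (W t) + (eta * out_sign j) *: update t j.
Proof. by rewrite /gd iterS /gd_step rowK. Qed.

(** The two signs cancel in [out_sign j * out_sign j], so every active example pushes all [2m]
    neurons towards [ws], each by at least [eta alpha]: the slope is at least [alpha] and the margin
    at least 1. *)
Let signal t : 2 * m%:R * alpha * eta * (updates t)%:R <=
  \sum_(j < m.*2) out_sign j * dotp (row j (W t)) ws -
  \sum_(j < m.*2) out_sign j * dotp (row j W0) ws.
Proof.
elim: t => [|t IH]; first by rewrite /updates big_ord0 mulr0 subrr.
rewrite /updates big_ord_recr/= -/(updates t) natrD mulrDr.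
have step j : out_sign j * dotp (row j (W t.+1)) ws =
    out_sign j * dotp (row j (W t)) ws + eta * dotp (update t j) ws.
  rewrite rowS dotpDl dotpZl mulrDr; congr (_ + _).
  by rewrite mulrA mulrCA out_sign_sqr mulr1.
rewrite (eq_bigr _ (fun j _ => step j)) big_split/= addrAC lerD//.
rewrite -mulr_sumr.
have h j : alpha * #|F t|%:R <= dotp (update t j) ws.
  rewrite /update dotp_suml mulr_natr -sumr_const; apply: ler_sum => i _.
  rewrite dotpZl mulrAC (dotpC _ ws).
  have /andP[s1 _] := leaky_relu'_itv alpha01 (dotp (row j (W t)) (row i X)).
  rewrite (le_trans s1)// ler_peMl//.
  exact: le_trans (ltW a0) s1.
apply: (@le_trans _ _ (eta * \sum_(j < m.*2) alpha * #|F t|%:R)).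
  rewrite sumr_const_double.
  by rewrite le_eqVlt; apply/orP; left; apply/eqP; ring.
by rewrite ler_wpM2l ?(ltW eta0)//; apply: ler_sum.
Qed.

Let sq t := \sum_(j < m.*2) enorm (row j (W t)) ^+ 2.

(** The triangle inequality gives [|F|^2 max |x_i|^2]; one factor [|F|] is bounded by [n], and the
    step size absorbs [m n max |x_i|^2]. *)
Let update_norm t j : eta * m%:R * enorm (update t j) ^+ 2 <= #|F t|%:R.
Proof.
have u1 : enorm (update t j) <= \sum_(i in F t) enorm (row i X).
  rewrite (le_trans (enorm_sum _ _))//; apply: ler_sum => i _.
  rewrite enormZ normrM yhn mul1r ler_piMl ?enorm_ge0//.
  have /andP[s1 s2] := leaky_relu'_itv alpha01 (dotp (row j (W t)) (row i X)).
  by rewrite ger0_norm// (le_trans (ltW a0)).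
pose M := max_sqnorm X.
have xM i : enorm (row i X) <= Num.sqrt M.
  rewrite -[leLHS]ger0_norm ?enorm_ge0// -sqrtr_sqr ler_wsqrtr//.
  by rewrite /M /max_sqnorm (le_bigmax (0 : R) (fun i => enorm (row i X) ^+ 2)).
have M0 : 0 < M.
  have := xr (Ordinal n0) => h; have := xM (Ordinal n0).
  rewrite -sqrtr_gt0; apply: lt_le_trans.
  by rewrite -(pmulr_rgt0 _ r0) (lt_le_trans _ h).
have u2 : enorm (update t j) ^+ 2 <= #|F t|%:R * (n%:R * M).
  have h : enorm (update t j) <= #|F t|%:R * Num.sqrt M.
    rewrite (le_trans u1)// mulr_natl -sumr_const; apply: ler_sum => i _.
    exact: xM.
  apply: (@le_trans _ _ ((#|F t|%:R * Num.sqrt M) ^+ 2)).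
    by apply: lerXn2r; rewrite ?nnegrE ?enorm_ge0 ?mulr_ge0 ?sqrtr_ge0.
  rewrite exprMn sqr_sqrtr ?(ltW M0)// expr2 -mulrA ler_wpM2l//.
  rewrite ler_wpM2r ?(ltW M0)// ler_nat.
  by rewrite (leq_trans (max_card _))// card_ord.
have : eta * (m%:R * n%:R * M) <= 1.
  by case: adm => _ _ he _ _; rewrite -ler_pdivlMr// !mulr_gt0.
move=> he; apply: (@le_trans _ _ (eta * m%:R * (#|F t|%:R * (n%:R * M)))).
  by rewrite ler_wpM2l// mulr_ge0 ?ltW.
have -> : eta * m%:R * (#|F t|%:R * (n%:R * M)) =
  (eta * (m%:R * n%:R * M)) * #|F t|%:R by ring.
by rewrite ler_piMl.
Qed.

(** Expanding the squares, the cross terms and the squared updates each contribute at most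
    [2 eta |F|] per step. *)
Let energy t : sq t <= sq 0 + 4 * eta * (updates t)%:R.
Proof.
elim: t => [|t IH]; first by rewrite /updates big_ord0 mulr0 addr0.
have step j : enorm (row j (W t.+1)) ^+ 2 = enorm (row j (W t)) ^+ 2 +
    2 * eta * (out_sign j * dotp (row j (W t)) (update t j)) +
    eta ^+ 2 * enorm (update t j) ^+ 2.
  rewrite !enorm_sqr rowS dotpDl !dotpDr !dotpZl !dotpZr.
  rewrite (dotpC (update t j) (row j (W t))).
  set A := dotp _ _; set B := dotp _ _; set C := dotp _ _.
  by have -> : eta ^+ 2 * C = eta * eta * (out_sign j * out_sign j) * C;
    [rewrite out_sign_sqr mulr1 expr2|ring].
(* Homogeneity, [sigma(z) = sigma'(z) z], turns the sum over neurons into the sum of [yh_i f(x_i)]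
   over the active examples, each of which is below 1. *)
have cross : \sum_(j < m.*2) out_sign j * dotp (row j (W t)) (update t j) <=
    #|F t|%:R.
  have -> : \sum_(j < m.*2) out_sign j * dotp (row j (W t)) (update t j) =
      \sum_(i in F t) yh ord0 i * network alpha (W t) (row i X).
    transitivity (\sum_(j < m.*2) \sum_(i in F t) out_sign j *
       (yh ord0 i * leaky_relu alpha (dotp (row j (W t)) (row i X)))).
      apply: eq_bigr => j _; rewrite /update dotp_sumr mulr_sumr.
      by apply: eq_bigr => i _; rewrite dotpZr leaky_reluE// -(mulrA (yh _ _)).
    rewrite exchange_big/=; apply: eq_bigr => i _; rewrite /network mulr_sumr.
    by apply: eq_bigr => j _; rewrite mulrCA.
  rewrite -sum1_card natr_sum; apply: ler_sum => i.
  by rewrite inE => /ltW.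
rewrite /updates big_ord_recr/= -/(updates t) natrD mulrDr addrA.
rewrite {1}/sq (eq_bigr _ (fun j _ => step j)) !big_split/= -!mulr_sumr -/(sq t).
have quad : eta ^+ 2 * \sum_(j < m.*2) enorm (update t j) ^+ 2 <=
    2 * eta * #|F t|%:R.
  set S := \sum_(j < m.*2) _.
  have h : eta * S <= 2 * #|F t|%:R.
    rewrite -(ler_pM2l mR); apply: (@le_trans _ _ (\sum_(j < m.*2) #|F t|%:R)).
      rewrite mulrA (mulrC m%:R) /S mulr_sumr; apply: ler_sum => j _.
      exact: update_norm.
    by rewrite sumr_const_double le_eqVlt; apply/orP; left; apply/eqP; ring.
  have -> : 2 * eta * #|F t|%:R = eta * (2 * #|F t|%:R) by ring.
  by rewrite expr2 -mulrA ler_wpM2l ?(ltW eta0).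
have crossE : 2 * eta * (\sum_(j < m.*2) out_sign j * dotp (row j (W t)) (update t j))
    <= 2 * eta * #|F t|%:R.
  by rewrite ler_wpM2l// mulr_ge0// ltW.
move: IH quad crossE; lra.
Qed.

Let U_ge0 t : 0 <= U t. Proof. by apply: sumr_ge0 => j _; exact: enorm_ge0. Qed.

(* Perceptron argument: [G] counts the updates; the correlation with [ws] grows
   at least linearly in [G], the squared norm at most linearly. *)
Let G t := 2 * m%:R * eta * (updates t)%:R.

Let G_le t : alpha * G t <= r * (U t + V).
Proof.
have h t' : `|\sum_(j < m.*2) out_sign j * dotp (row j (W t')) ws| <= r * U t'.
  rewrite (le_trans (ler_norm_sum _ _ _))// mulr_sumr; apply: ler_sum => j _.
  by rewrite normrM normr_out_sign mul1r mulrC normr_dotp_le.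
have h0 := h 0; have ht := h t; have s := signal t.
rewrite /gd/= in h0.
have : alpha * G t <= r * U t + r * U 0.
  have -> : alpha * G t = 2 * m%:R * alpha * eta * (updates t)%:R.
    by rewrite /G; ring.
  apply: le_trans s _; apply: lerD.
    by rewrite (le_trans (ler_norm _)).
  by rewrite (le_trans (ler_norm _))// normrN.
move=> h1; apply: le_trans h1 _; rewrite mulrDr lerD2l.
by rewrite ler_wpM2l ?(ltW r0).
Qed.

Let U_sqr t : U t ^+ 2 <= V ^+ 2 + 4 * G t.
Proof.
have cs t' : U t' ^+ 2 <= 2 * m%:R * sq t'.
  have := dotp_sqr_le (\row_(j < m.*2) enorm (row j (W t'))) (const_mx 1).
  have -> : dotp (\row_(j < m.*2) enorm (row j (W t'))) (const_mx 1) = U t'.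
    by rewrite dotpE; apply: eq_bigr => j _; rewrite !mxE mulr1.
  have -> : dotp (const_mx 1 : 'rV[R]_m.*2) (const_mx 1) = 2 * m%:R.
    rewrite dotpE; under eq_bigr do rewrite !mxE mulr1.
    by rewrite sumr_const_double mulr1.
  rewrite mulrC; congr (_ <= _ * _).
  by rewrite dotpE; apply: eq_bigr => j _; rewrite !mxE expr2.
have sq0 : 2 * m%:R * sq 0 <= V ^+ 2.
  have lam0 : 0 <= lam by case: adm => _ /ltW.
  have : sq 0 <= 2 * m%:R * lam ^+ 2.
    apply: (@le_trans _ _ (\sum_(j < m.*2) lam ^+ 2)).
      apply: ler_sum => j _; apply: lerXn2r; rewrite ?nnegrE ?enorm_ge0//.
      by case: adm => _ _ _ _; apply.
    by rewrite sumr_const_double.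
  move=> h; apply: (@le_trans _ _ (2 * m%:R * (2 * m%:R * lam ^+ 2))).
    by rewrite ler_wpM2l// mulr_ge0.
  by rewrite /V le_eqVlt; apply/orP; left; apply/eqP; ring.
apply: le_trans (cs t) _.
apply: (@le_trans _ _ (2 * m%:R * (sq 0 + 4 * eta * (updates t)%:R))).
  by rewrite ler_wpM2l ?energy// mulr_ge0.
rewrite mulrDr lerD// /G le_eqVlt; apply/orP; left; apply/eqP; ring.
Qed.

(** Linear growth of the correlation bounds the clock by [U], and the clock bounds [U^2];
    eliminating it leaves a quadratic inequality for [U]. *)
Lemma gd_norm_bound t : U t <= 6 * r / alpha.
Proof.
set T := r / alpha; have T0 : 0 < T by rewrite divr_gt0.
have rT : r <= T by rewrite ler_pdivlMr// ler_piMr// ltW.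
have VT : V <= 2 * T by rewrite (le_trans V2r)// ler_wpM2l.
have V0 : 0 <= V by rewrite (le_trans (U_ge0 0)).
have GT : G t <= T * (U t + V).
  have := G_le t; rewrite mulrC -ler_pdivlMr// => h; apply: le_trans h _.
  by rewrite mulrAC.
have h := U_sqr t; have u0 := U_ge0 t.
have -> : 6 * r / alpha = 6 * T by rewrite mulrA.
rewrite leNgt; apply/negP => uT.
set u := U t in GT h u0 uT *; set g := G t in GT h.
(* [V <= 2T] contributes [4T^2] and [8T^2]. The positive root of [u^2 = 12 T^2 + 4 T u] is [6T]. *)
have h1 : u ^+ 2 <= 12 * T ^+ 2 + 4 * (T * u).
  have : V ^+ 2 <= (2 * T) ^+ 2
    by apply: lerXn2r; rewrite ?nnegrE// mulr_ge0// ltW.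
  have : T * V <= T * (2 * T) by rewrite ler_wpM2l ?(ltW T0).
  nra.
nra.
Qed.

Let updates_bounded : exists K : R, forall t, (updates t)%:R <= K.
Proof.
exists (r * (6 * r / alpha + V) / (alpha * (2 * m%:R * eta))) => t.
rewrite ler_pdivlMr; last by rewrite !mulr_gt0.
apply: (@le_trans _ _ (alpha * G t)).
  by rewrite /G le_eqVlt; apply/orP; left; apply/eqP; ring.
apply: le_trans (G_le t) _; rewrite ler_wpM2l ?(ltW r0)// lerD2r.
exact: gd_norm_bound.
Qed.

(** Otherwise every step would add at least one update, against the uniform bound on their
    number. *)
Lemma gd_active_set_empty : exists T, F T = finset.set0.
Proof.
apply: contrapT => /forallNP noempty.
have [K HK] := updates_bounded.
have ut t : (t <= updates t)%N.
  elim: t => // t IH; rewrite /updates big_ord_recr/= -/(updates t) -addn1.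
  by rewrite leq_add// card_gt0; apply/eqP; exact: noempty.
have [N _ /(_ N (leqnn N)) /= KN] := nbhs_infty_gtr K.
have := HK N; apply/negP; rewrite -ltNge (lt_le_trans KN)// ler_nat.
exact: ut.
Qed.

Let step_stable T : F T = finset.set0 -> forall t, (T <= t)%N -> W t = W T.
Proof.
move=> FT t /subnK <-; elim: (t - T)%N => // k IH.
rewrite addSn {1}/gd iterS -/(gd alpha eta X yh W0 (k + T)) IH.
apply/row_matrixP => j; rewrite rowK FT big_pred0 ?scaler0 ?addr0// => i.
by rewrite inE.
Qed.

Lemma gd_converges : exists T,
  [/\ F T = finset.set0, forall t, (T <= t)%N -> W t = W T &
      gd_output alpha eta X yh W0 = W T].
Proof.
have [T FT] := gd_active_set_empty; exists T; split => //.
  exact: step_stable.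
apply/cvg_lim => //; apply: cvg_near_cst; near=> t.
by apply: step_stable => //; near: t; exact: nbhs_infty_ge.
Unshelve. all: by end_near. Qed.

Lemma gd_terminates_margin : gd_terminates alpha eta X yh W0.
Proof. by have [T [_ h _]] := gd_converges; exists T. Qed.

Lemma gd_output_fits i :
  1 <= yh ord0 i * network alpha (gd_output alpha eta X yh W0) (row i X).
Proof.
have [T [FT _ ->]] := gd_converges.
rewrite leNgt; apply/negP => h; have iF : i \in F T by rewrite inE.
by rewrite FT finset.in_set0 in iF.
Qed.

Lemma gd_output_loss :
  hinge_loss alpha (gd_output alpha eta X yh W0) X yh = 0.
Proof.
rewrite /hinge_loss big1// => i _; apply/max_l.
by rewrite subr_le0; exact: gd_output_fits.
Qed.

Lemma gd_output_norm :
  \sum_(j < m.*2) enorm (row j (gd_output alpha eta X yh W0)) <= 6 * r / alpha.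
Proof. by have [T [_ _ ->]] := gd_converges; exact: gd_norm_bound. Qed.

End gradient_descent.

(** * A separating vector for the observed labels *)

Section margin_vector.
Context {R : realType} {n d : nat} (M : R) (N : 'M[R]_(n, d)).
Hypothesis M0 : 0 <= M.
Hypothesis lower : forall p : 'rV[R]_n, dotp p p <= M * dotp (p *m N) (p *m N).

(** The lower bound makes the Gram matrix [G = N N^T] invertible, and [q = z G^-1] solves the
    equations. *)
Lemma interpolation (z : 'rV[R]_n) : exists q : 'rV[R]_n,
  (forall i, dotp (q *m N) (row i N) = z ord0 i) /\
  dotp (q *m N) (q *m N) <= M * dotp z z.
Proof.
pose G := N *m N^T.
have GE q : dotp (q *m N) (q *m N) = dotp (q *m G) q.
  by rewrite dotp_mulmxr -mulmxA.
have Gu : G \in unitmx.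
  rewrite -row_free_unit; apply: inj_row_free => p pG.
  apply/eqP; rewrite -dotp_eq0 eq_le dotp_ge0 andbT.
  by have := lower p; rewrite GE pG dotp0l mulr0.
pose q := z *m invmx G.
have qG : q *m G = z by rewrite /q mulmxKV.
exists q; split => [i|].
  have -> : dotp (q *m N) (row i N) = (q *m G) ord0 i.
    rewrite /G mulmxA /dotp !mxE; apply: eq_bigr => j _; rewrite !mxE.
    by [].
  by rewrite qG.
have uE : dotp (q *m N) (q *m N) = dotp z q by rewrite GE qG.
have [->|u0] := eqVneq (dotp (q *m N) (q *m N)) 0.
  by rewrite mulr_ge0// dotp_ge0.
have u1 : 0 < dotp (q *m N) (q *m N) by rewrite lt_neqAle eq_sym u0 dotp_ge0.
rewrite -(ler_pM2r u1).
(* [|qN|^2 = <z,q>]; Cauchy-Schwarz followed by the lower bound at [q] allows one factor [|qN|^2] to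
   be cancelled. *)
have h1 : dotp (q *m N) (q *m N) * dotp (q *m N) (q *m N) <= dotp z z * dotp q q.
  by rewrite !uE -expr2 dotp_sqr_le.
apply: le_trans h1 _.
apply: (@le_trans _ _ (dotp z z * (M * dotp (q *m N) (q *m N)))).
  by rewrite ler_wpM2l ?dotp_ge0.
by rewrite le_eqVlt; apply/orP; left; apply/eqP; ring.
Qed.

Context (gamma : R) (v : 'rV[R]_d) (y : 'rV[R]_n) (B : {set 'I_n}).
Hypothesis gamma01 : 0 < gamma < 1.
Hypothesis v1 : dotp v v = 1.
Hypothesis Nv : forall i, dotp v (row i N) = 0.
Hypothesis y1 : forall i, y ord0 i = 1 \/ y ord0 i = -1.

Lemma margin_vector : exists ws : 'rV[R]_d,
  (forall i, flip_labels B y ord0 i *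
             dotp ws (row i (data_matrix gamma v y N)) = 1) /\
  (1 - gamma) * dotp ws ws <= gamma^-1 + 4 * #|B|%:R * M.
Proof.
have /andP[g0 g1] := gamma01.
(* The multiple of [v] alone yields [y_i] at every point; the noise part adds [- 2 y_i] on the
   flipped set, so that [<ws, x_i>] equals the observed label. *)
pose z : 'rV[R]_n := \row_i (if i \in B then - 2 * y ord0 i else 0).
have [q [qz qn]] := interpolation z.
set u := q *m N in qz qn.
have uv : dotp u v = 0.
  by rewrite dotpC dotp_rowE big1// => i _; rewrite Nv mulr0.
have yy i : y ord0 i * y ord0 i = 1 by case: (y1 i) => ->; ring.
have zz : dotp z z = 4 * #|B|%:R.
  rewrite dotpE (bigID (mem B))/= [X in _ + X]big1 ?addr0; last first.
    by move=> i /negbTE iB; rewrite mxE iB mulr0.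
  rewrite mulr_natr -sumr_const; apply: eq_bigr => i iB; rewrite mxE iB.
  by rewrite mulrACA yy mulr1; ring.
have g1' : 0 < 1 - gamma by rewrite subr_gt0.
set a := Num.sqrt gamma; set th := Num.sqrt (1 - gamma).
have a0 : a != 0 by rewrite gt_eqF// sqrtr_gt0.
have th0 : th != 0 by rewrite gt_eqF// sqrtr_gt0.
have aa : a * a = gamma by rewrite -expr2 sqr_sqrtr// ltW.
have thth : th * th = 1 - gamma by rewrite -expr2 sqr_sqrtr// ltW.
pose ws := a^-1 *: v + th^-1 *: u.
have wsv : dotp ws v = a^-1.
  by rewrite /ws dotpDl !dotpZl v1 uv mulr0 addr0 mulr1.
have wsN i : dotp ws (row i N) = th^-1 * z ord0 i.
  by rewrite /ws dotpDl !dotpZl Nv qz mulr0 add0r.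
exists ws; split => [i|].
  rewrite /data_matrix rowK /data_point dotpDr !dotpZr wsv wsN.
  have -> : a * y ord0 i * a^-1 + th * (th^-1 * z ord0 i) = y ord0 i + z ord0 i.
    by field; rewrite a0 th0.
  rewrite /flip_labels !mxE; case: ifP => _; last by rewrite addr0 yy.
  have -> : - y ord0 i * (y ord0 i + - 2 * y ord0 i) = y ord0 i * y ord0 i by ring.
  exact: yy.
have -> : dotp ws ws = gamma^-1 + (1 - gamma)^-1 * dotp u u.
  rewrite /ws dotpDl !dotpDr !dotpZl !dotpZr v1 uv (dotpC v u) uv -thth -aa.
  by field; rewrite a0 th0.
rewrite mulrDr mulVKf ?gt_eqF//; apply: lerD.
  by rewrite ler_piMl ?invr_ge0 ?(ltW g0)// gerBl ltW.
by rewrite (le_trans qn)// zz mulrC.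
Qed.

End margin_vector.

Section signal_margin.
Context {R : realType} {n d m : nat} (alpha gamma : R).
Context (v : 'rV[R]_d) (y : 'rV[R]_n) (N : 'M[R]_(n, d)) (B : {set 'I_n}).
Context (W : 'M[R]_(m.*2, d)) (b : R).
Hypothesis alpha01 : 0 < alpha <= 1.

Notation U := (\sum_(j < m.*2) enorm (row j W)).
Notation th := (Num.sqrt (1 - gamma)).

Hypothesis noise : forall w, \sum_i `|dotp w (row i N)| <= b * enorm w.
Hypothesis fits : forall i, 1 <= flip_labels B y ord0 i *
  network alpha W (row i (data_matrix gamma v y N)).

(* Otherwise every clean training point with label s would need its noise
   vector to move the output by at least 1/2. *)
Lemma signal_margin (s : R) : s = 1 \/ s = -1 ->
  b * (th * U) < (#|[set i | y ord0 i == s]%SET|%:R - #|B|%:R) / 2 ->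
  2^-1 <= s * network alpha W ((Num.sqrt gamma * s) *: v).
Proof.
move=> s1 hb; rewrite leNgt; apply/negP => hs.
pose A := ([set i | y ord0 i == s] :\: B)%SET.
have cA : #|[set i | y ord0 i == s]%SET|%:R - #|B|%:R <= #|A|%:R :> R.
  rewrite lerBlDr -natrD ler_nat cardsD.
  have := subset_leq_card (finset.subsetIr [set i | y ord0 i == s]%SET B).
  by move=> h; rewrite addnC -leq_subLR leq_sub2l.
(* A clean point with label [s] is the signal point plus noise; moving between them changes [s f]
   from below [1/2] to at least 1. *)
have hA i : i \in A -> 2^-1 <= th * \sum_(j < m.*2) `|dotp (row j W) (row i N)|.
  rewrite !inE => /andP[iB /eqP yi].
  have := fits i; rewrite /flip_labels mxE (negbTE iB) yi => hf.
  have hl := network_lip alpha01 W (row i (data_matrix gamma v y N))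
    ((Num.sqrt gamma * s) *: v).
  have E : row i (data_matrix gamma v y N) - (Num.sqrt gamma * s) *: v =
      th *: row i N.
    by rewrite /data_matrix rowK /data_point yi addrC addKr.
  rewrite E in hl.
  rewrite mulr_sumr; under eq_bigr do
    rewrite -[X in X * _]ger0_norm ?sqrtr_ge0// -normrM -dotpZr.
  have ns : `|s| = 1 by case: s1 => ->; rewrite ?normrN1 ?normr1.
  apply: le_trans hl; rewrite -[leRHS]mul1r -[X in X * _]ns.
  rewrite -normrM mulrBr (le_trans _ (ler_norm _))//; lra.
have h1 : #|A|%:R / 2 <=
    th * \sum_(i in A) \sum_(j < m.*2) `|dotp (row j W) (row i N)|.
  rewrite mulr_natl -sumr_const mulr_sumr; apply: ler_sum => i iA.
  exact: hA.
have h2 : \sum_(i in A) \sum_(j < m.*2) `|dotp (row j W) (row i N)| <= b * U.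
  rewrite exchange_big/= mulr_sumr; apply: ler_sum => j _.
  apply: le_trans (noise _).
  rewrite [leRHS](bigID (mem A))/= lerDl.
  by apply: sumr_ge0 => i _.
have h3 := ler_wpM2l (sqrtr_ge0 (1 - gamma)) h2.
have h4 : th * (b * U) = b * (th * U) by rewrite mulrCA.
rewrite h4 in h3.
lra.
Qed.

End signal_margin.

(** * Good training data *)

Section good_training_data.
Context {R : realType} {n d : nat} (gamma : R) (v : 'rV[R]_d).
Implicit Types (X N : 'M[R]_(n, d)) (y yh : 'rV[R]_n).

(** Noise and true labels are read off from [X], so that goodness can be stated for the data alone:
    the component along [v] carries the label, its orthogonal complement the noise. *)
Definition noise_part X : 'M[R]_(n, d) :=
  \matrix_(i < n)
    ((Num.sqrt (1 - gamma))^-1 *: (row i X - dotp (row i X) v *: v)).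

Definition label_part X : 'rV[R]_n :=
  \row_(i < n) (dotp (row i X) v / Num.sqrt gamma).

Definition labels_ok (k : nat) y yh : Prop :=
  [/\ forall i, y ord0 i = 1 \/ y ord0 i = -1,
      forall i, yh ord0 i = y ord0 i \/ yh ord0 i = - y ord0 i &
      (#|[set i | yh ord0 i != y ord0 i]%SET| <= k)%N].

Definition balanced y : Prop :=
  (n <= 8 * #|[set i | y ord0 i == 1%R]%SET|)%N /\
  (n <= 8 * #|[set i | y ord0 i == -1%R]%SET|)%N.

Hypothesis gamma01 : 0 < gamma < 1.
Hypothesis v1 : dotp v v = 1.

Let a0 : Num.sqrt gamma != 0.
Proof. by case/andP: gamma01 => g0 _; rewrite gt_eqF// sqrtr_gt0. Qed.

Let th0 : 0 < Num.sqrt (1 - gamma).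
Proof. by case/andP: gamma01 => _ g1; rewrite sqrtr_gt0 subr_gt0. Qed.

Lemma dotp_noise_part X i : dotp v (row i (noise_part X)) = 0.
Proof.
rewrite /noise_part rowK dotpZr dotpDr dotpNr dotpZr v1 mulr1.
by rewrite (dotpC v) subrr mulr0.
Qed.

Lemma data_matrix_parts X : data_matrix gamma v (label_part X) (noise_part X) = X.
Proof.
apply/row_matrixP => i; rewrite /data_matrix rowK /data_point /noise_part rowK.
rewrite scalerA divff ?gt_eqF// scale1r /label_part mxE mulrC divfK//.
by rewrite addrC subrK.
Qed.

(** Orthogonality, which holds almost surely under the model, is what separates signal from noise in
    each row. *)
Lemma parts_data_matrix y N : (forall i, dotp v (row i N) = 0) ->
  noise_part (data_matrix gamma v y N) = N /\
  label_part (data_matrix gamma v y N) = y.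
Proof.
move=> Nv.
have E i : dotp (row i (data_matrix gamma v y N)) v = Num.sqrt gamma * y ord0 i.
  rewrite /data_matrix rowK /data_point dotpDl !dotpZl v1 mulr1.
  by rewrite (dotpC (row i N)) Nv mulr0 addr0.
split.
  apply/row_matrixP => i; rewrite /noise_part rowK E /data_matrix rowK.
  by rewrite /data_point addrAC subrr add0r scalerA mulVf ?gt_eqF// scale1r.
by apply/rowP => i; rewrite /label_part mxE E mulrC mulKf.
Qed.

Lemma flip_labels_diff k y yh : labels_ok k y yh ->
  flip_labels [set i | yh ord0 i != y ord0 i]%SET y = yh.
Proof.
move=> [_ yyh _]; apply/rowP => i; rewrite /flip_labels mxE inE.
have [->//|] := eqVneq (yh ord0 i) (y ord0 i).
by case: (yyh i) => ->; rewrite ?eqxx.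
Qed.

Lemma labels_ok_flip (B : {set 'I_n}) y :
  (forall i, y ord0 i = 1 \/ y ord0 i = -1) -> labels_ok #|B| y (flip_labels B y).
Proof.
move=> y1; split => //.
  by move=> i; rewrite /flip_labels mxE; case: ifP => _; [right|left].
apply: subset_leq_card; apply/fintype.subsetP => i; rewrite inE /flip_labels mxE.
by case: ifP => // _; rewrite eqxx.
Qed.

Section consequences.
Context (m M k : nat) (alpha eta lam : R) (X : 'M[R]_(n, d)) (yh : 'rV[R]_n).
Context (W0 : 'M[R]_(m.*2, d)).
Hypotheses (n0 : (0 < n)%N) (m0 : (0 < m)%N) (M2 : (1 < M)%N).
Hypothesis alpha01 : 0 < alpha <= 1.
Hypothesis net : net_good M (noise_part X).
Hypothesis labels : labels_ok k (label_part X) yh.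
Hypothesis adm : gd_admissible alpha X eta lam W0.

Let yh1 i : yh ord0 i = 1 \/ yh ord0 i = -1.
Proof.
case: labels => y1 yyh _.
by case: (yyh i) => ->; case: (y1 i) => ->; rewrite ?opprK; [left|right|right|left].
Qed.

Let margin : exists ws : 'rV[R]_d,
  (forall i, 1 <= yh ord0 i * dotp ws (row i X)) /\
  (1 - gamma) * dotp ws ws <= gamma^-1 + 4 * k%:R * M%:R.
Proof.
have [y1 _ Bk] := labels.
have low := net_good_lower n0 M2 net.
have Nv := dotp_noise_part X.
have [ws [h1 h2]] := margin_vector (ler0n R M) low
  [set i | yh ord0 i != label_part X ord0 i]%SET gamma01 v1 Nv y1.
exists ws; split => [i|].
  by have := h1 i; rewrite (flip_labels_diff labels) data_matrix_parts => ->.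
apply: le_trans h2 _; rewrite lerD2l ler_wpM2r// ler_wpM2l// ler_nat.
exact: Bk.
Qed.

Lemma gd_interpolates : gd_terminates alpha eta X yh W0 /\
  hinge_loss alpha (gd_output alpha eta X yh W0) X yh = 0.
Proof.
have [ws [h _]] := margin; split.
  exact: (gd_terminates_margin n0 m0 alpha01 yh1 h adm).
exact: (gd_output_loss n0 m0 alpha01 yh1 h adm).
Qed.

Hypothesis bal : balanced (label_part X).
Hypothesis gamma_k : k%:R^-1 <= gamma.
Hypothesis k0 : (0 < k)%N.
Hypothesis k_n : k%:R * (200 ^+ 2 * M%:R * (1 + 4 * M%:R)) <= alpha ^+ 2 * n%:R.

Notation W := (gd_output alpha eta X yh W0).
Notation S := (Num.sqrt (1 - gamma) * \sum_(j < m.*2) enorm (row j W)).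

Let kR : (0 : R) < k%:R. Proof. by rewrite ltr0n. Qed.
Let MR : (2 : R) <= M%:R. Proof. by rewrite ler_nat. Qed.

(** The norm bound of gradient descent multiplied by [sqrt(1 - gamma)]; the condition [1/gamma <= k]
    merges the two terms of the squared separator norm into [(1 + 4M) k]. *)
Lemma gd_output_noise_norm : alpha * S <= 6 * Num.sqrt ((1 + 4 * M%:R) * k%:R).
Proof.
have [ws [h1 h2]] := margin.
have /andP[g0 g1] := gamma01.
have al0 : 0 < alpha by case/andP: alpha01.
have hU := gd_output_norm n0 m0 alpha01 yh1 h1 adm.
have hws : Num.sqrt (1 - gamma) * enorm ws <= Num.sqrt ((1 + 4 * M%:R) * k%:R).
  rewrite /enorm -sqrtrM ?subr_ge0 ?(ltW g1)// ler_wsqrtr//.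
  apply: le_trans h2 _.
  have : gamma^-1 <= k%:R.
    by rewrite -[leRHS]invrK lef_pV2 ?posrE ?invr_gt0.
  lra.
have : S <= Num.sqrt (1 - gamma) * (6 * enorm ws / alpha) by rewrite ler_wpM2l.
move=> h; have := ler_wpM2l (ltW al0) h => {}h; apply: le_trans h _.
have -> : alpha * (Num.sqrt (1 - gamma) * (6 * enorm ws / alpha)) =
    6 * (Num.sqrt (1 - gamma) * enorm ws) by field; rewrite gt_eqF.
by rewrite ler_wpM2l.
Qed.

Lemma gd_output_signal (s : R) : s = 1 \/ s = -1 ->
  2^-1 <= s * network alpha W ((Num.sqrt gamma * s) *: v).
Proof.
move=> s1; have [y1 _ Bk] := labels.
have al0 : 0 < alpha by case/andP: alpha01.
have al1 : alpha <= 1 by case/andP: alpha01.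
have [ws [h1 _]] := margin.
have fits := gd_output_fits n0 m0 alpha01 yh1 h1 adm.
have noise := net_good_sum_abs n0 M2 net.
pose B := [set i | yh ord0 i != label_part X ord0 i]%SET.
apply: (@signal_margin _ _ _ _ alpha gamma v (label_part X) (noise_part X) B
  _ _ alpha01 noise) => //.
  by move=> i; rewrite (flip_labels_diff labels) data_matrix_parts; exact: fits.
have cs : n%:R / 8 <= #|[set i | label_part X ord0 i == s]%SET|%:R :> R.
  rewrite ler_pdivrMr// mulrC -natrM ler_nat.
  by case: s1 => ->; case: bal.
have cB : #|B|%:R <= k%:R :> R by rewrite ler_nat.
have MM : (1 : R) <= M%:R by have := MR; lra.
have kn : k%:R <= n%:R / 16 :> R.
  rewrite ler_pdivlMr//; apply: le_trans (_ : alpha ^+ 2 * n%:R <= _); last first.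
    by rewrite ler_piMl// expr_le1// ltW.
  apply: le_trans k_n; rewrite ler_wpM2l//.
  have := MM; nra.
have hS := gd_output_noise_norm.
have kn2 := k_n; set K := (1 + 4 * M%:R) in hS kn2.
have K0 : 0 < K by rewrite /K; have := MM; lra.
(* At least [n/8] points carry the label [s] and at most [n/16] are flipped; half the difference is
   at least [n/32]. *)
apply: (@lt_le_trans _ _ (n%:R / 32)); last by move: cs cB kn; lra.
have nR : (0 : R) < n%:R by rewrite ltr0n.
have S0 : 0 <= S.
  by rewrite mulr_ge0 ?sqrtr_ge0// sumr_ge0// => j _; exact: enorm_ge0.
have b0 : 0 <= Num.sqrt (M%:R * n%:R) * S by rewrite mulr_ge0 ?sqrtr_ge0.
rewrite -ltr_sqr ?nnegrE ?divr_ge0 ?(ltW nR)//.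
rewrite -(ltr_pM2l (exprn_gt0 2 al0)).
have h2 : (alpha * S) ^+ 2 <= 36 * (K * k%:R).
  apply: (@le_trans _ _ ((6 * Num.sqrt (K * k%:R)) ^+ 2)).
    apply: lerXn2r; rewrite ?nnegrE ?mulr_ge0 ?sqrtr_ge0 ?(ltW al0)//.
    by apply: sumr_ge0 => j _; exact: enorm_ge0.
  rewrite exprMn sqr_sqrtr; last by rewrite mulr_ge0 ?(ltW K0) ?(ltW kR).
  by rewrite le_eqVlt; apply/orP; left; apply/eqP; ring.
have -> : alpha ^+ 2 * (Num.sqrt (M%:R * n%:R) * S) ^+ 2 =
    (M%:R * n%:R) * (alpha * S) ^+ 2.
  by rewrite exprMn sqr_sqrtr ?mulr_ge0//; ring.
apply: (@le_lt_trans _ _ ((M%:R * n%:R) * (36 * (K * k%:R)))).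
  by rewrite ler_wpM2l// mulr_ge0.
have h3 : n%:R * (k%:R * (200 ^+ 2 * M%:R * K)) <= n%:R * (alpha ^+ 2 * n%:R).
  by rewrite ler_wpM2l.
have h4 : 0 < n%:R * (k%:R * (M%:R * K)).
  by rewrite !mulr_gt0//; apply: lt_le_trans MM.
(* Origin of the constant 200: after squaring, [36 * 1024 = 36864] must be below [200^2]. *)
have -> : alpha ^+ 2 * (n%:R / 32) ^+ 2 = n%:R * (alpha ^+ 2 * n%:R) / 1024 :> R.
  by field.
lra.
Qed.

End consequences.

Lemma test_error (m : nat) (alpha : R) (W : 'M[R]_(m.*2, d)) (yt : R) (z : 'rV[R]_d) :
  0 < alpha <= 1 -> yt = 1 \/ yt = -1 ->
  2^-1 <= yt * network alpha W ((Num.sqrt gamma * yt) *: v) ->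
  yt * network alpha W (data_point gamma v yt z) <= 0 ->
  2^-1 <= Num.sqrt (1 - gamma) * \sum_(j < m.*2) `|dotp (row j W) z|.
Proof.
move=> alpha01 yt1 h1 h2.
have hl := network_lip alpha01 W (data_point gamma v yt z)
  ((Num.sqrt gamma * yt) *: v).
have E : data_point gamma v yt z - (Num.sqrt gamma * yt) *: v =
    Num.sqrt (1 - gamma) *: z.
  by rewrite /data_point addrC addKr.
rewrite E in hl.
rewrite mulr_sumr; under eq_bigr do
  rewrite -[X in X * _]ger0_norm ?sqrtr_ge0// -normrM -dotpZr.
have ns : `|yt| = 1 by case: yt1 => ->; rewrite ?normrN1 ?normr1.
apply: le_trans hl; rewrite -[leRHS]mul1r -[X in X * _]ns.
rewrite -normrM -normrN (le_trans _ (ler_norm _))// mulrBr; lra.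
Qed.

End good_training_data.

(** * Measurability of the output of gradient descent *)

Section measurable_limits.
Context d0 (T : measurableType d0) {R : realType} {p q : nat}.
Variable u : nat -> T -> 'M[R]_(p, q).
Hypothesis mu : forall t, measurable_fun setT (u t).

Let cvg_matrixP w : cvg (u t w @[t --> \oo]) <->
  forall k : nat, exists N : nat, forall t : nat, forall i j, (N <= t)%N ->
    `|u N w i j - u t w i j| < k.+1%:R^-1.
Proof.
split.
  move=> /cvg_cauchy/cauchyP uC k.
  have e0 : (0 : R) < k.+1%:R^-1 / 2 by rewrite divr_gt0.
  have [x [N _ HN]] := uC _ e0.
  exists N => t i j Nt; have [_ h1] := HN _ Nt; have [_ h2] := HN _ (leqnn N).
  have := ball_triangle (ball_sym (h2 i j)) (h1 i j).
  by rewrite -splitr.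
move=> H; apply/cauchy_cvgP/cauchyP => e e0.
have [k _ /(_ _ (leqnn k)) ke] := near_infty_natSinv_lt (PosNum e0).
have [N HN] := H k.
exists (u N w); exists N => // t /= Nt.
split => // i j; apply: lt_trans ke.
exact: HN.
Qed.

Let measurable_cvg : measurable [set w | cvg (u t w @[t --> \oo])].
Proof.
rewrite (_ : [set w | _] = \bigcap_(k in [set: nat]) \bigcup_(N in [set: nat])
  \bigcap_(t in [set: nat]) [set w | forall i j, (N <= t)%N ->
    `|u N w i j - u t w i j| < k.+1%:R^-1]).
  apply: bigcapT_measurable => k; apply: bigcupT_measurable => N.
  apply: bigcapT_measurable => t.
  apply: (@measurable_forall_fin _ _ _ (fun i => [set w | forall j, (N <= t)%N ->
    `|u N w i j - u t w i j| < k.+1%:R^-1])) => i.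
  apply: (@measurable_forall_fin _ _ _ (fun j => [set w | (N <= t)%N ->
    `|u N w i j - u t w i j| < k.+1%:R^-1])) => j.
  apply: measurable_propI; apply: measurable_lt_fun => //.
  apply: measurableT_comp => //.
  by apply: measurable_funB; exact: measurable_entry_comp.
apply/seteqP; split => w /=.
  move=> /cvg_matrixP H k _; have [N HN] := H k.
  by exists N => // t _ i j; exact: HN.
move=> H; apply/cvg_matrixP => k; have [N _ HN] := H k I.
by exists N => t i j; exact: HN t I i j.
Qed.

(** Where the sequence diverges, [lim] takes the default value [point]. The convergence set is
    measurable by the Cauchy criterion with countably many tolerances; the entries are pointwise
    limits on it and constant off it. *)
Lemma measurable_lim_matrix :
  measurable_fun setT (fun w => lim (u t w @[t --> \oo])).
Proof.
apply: measurable_mx => i j.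
pose C := [set w | cvg (u t w @[t --> \oo])].
pose c : 'M[R]_(p, q) := point.
pose h t w := if w \in C then u t w i j else c i j.
apply: (@measurable_fun_cvg _ _ _ setT h).
  move=> t; apply: measurable_fun_ifT; last exact: measurable_cst.
    apply: (measurable_fun_bool true); rewrite setTI.
    rewrite (_ : _ @^-1` _ = C)//; apply/seteqP; split => w /=.
      exact: set_mem.
    exact: mem_set.
  exact: measurable_entry_comp.
move=> w _; rewrite /h; have [wC|wC] := boolP (w \in C).
  have wcvg : cvg (u t w @[t --> \oo]) by exact: set_mem wC.
  exact: (cvg_comp (fun t => u t w) (fun M => M i j) wcvg (@coord_continuous R p q i j _)).
have -> : lim (u t w @[t --> \oo]) = c.
  by rewrite dvgP// => ?; move/negP: wC; apply; exact: mem_set.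
exact: cvg_cst.
Qed.

End measurable_limits.

Section measurable_gradient_descent.
Context d0 (T : measurableType d0) {R : realType} {n d m : nat} (alpha : R).

Lemma measurable_leaky (f : T -> R) : measurable_fun setT f ->
  measurable_fun setT (fun w => leaky_relu alpha (f w)).
Proof.
move=> mf; apply: measurable_maxr => //.
exact: measurable_funM.
Qed.

Lemma measurable_leaky' (f : T -> R) : measurable_fun setT f ->
  measurable_fun setT (fun w => leaky_relu' alpha (f w)).
Proof.
move=> mf; apply: measurable_fun_ifT => //.
exact: measurable_fun_ler.
Qed.

Lemma measurable_network (W : T -> 'M[R]_(m.*2, d)) (x : T -> 'rV[R]_d) :
  measurable_fun setT W -> measurable_fun setT x ->
  measurable_fun setT (fun w => network alpha (W w) (x w)).
Proof.
move=> mW mx; apply: measurable_sum => j; apply: measurable_funM => //.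
apply: measurable_leaky; apply: measurable_dotp => //.
exact: measurable_row.
Qed.

Context (eta : T -> R) (X : T -> 'M[R]_(n, d)) (yh : T -> 'rV[R]_n).
Context (W0 : T -> 'M[R]_(m.*2, d)).
Hypotheses (meta : measurable_fun setT eta) (mX : measurable_fun setT X).
Hypotheses (myh : measurable_fun setT yh) (mW0 : measurable_fun setT W0).

Let measurable_gd t :
  measurable_fun setT (fun w => gd alpha (eta w) (X w) (yh w) (W0 w) t).
Proof.
elim: t => // t IH; set W := fun w => gd _ _ _ _ _ t in IH.
have myi i : measurable_fun setT (fun w => yh w ord0 i).
  exact: measurable_entry_comp.
apply: measurable_mx => j c.
pose h w i := if yh w ord0 i * network alpha (W w) (row i (X w)) < 1
  then yh w ord0 i * leaky_relu' alpha (dotp (row j (W w)) (row i (X w))) * X w i c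
  else 0.
rewrite (_ : (fun w => _) = (fun w => W w j c + eta w * out_sign j * \sum_i h w i)).
  apply: measurable_funD; first exact: measurable_entry_comp.
  apply: measurable_funM; first exact: measurable_funM.
  apply: measurable_sum => i.
  apply: measurable_fun_ifT.
  - apply: measurable_fun_ltr => //; apply: measurable_funM => //.
    by apply: measurable_network => //; exact: measurable_row.
  - apply: measurable_funM; last exact: measurable_entry_comp.
    apply: measurable_funM => //; apply: measurable_leaky'.
    by apply: measurable_dotp; exact: measurable_row.
  - exact: measurable_cst.
apply/funext => w; rewrite /gd iterS -/(gd _ _ _ _ _ t) -/(W w) /gd_step mxE.
rewrite mxE [row j (W w) _ _]mxE mxE summxE; congr (_ + _ * _).
rewrite big_mkcond/=; apply: eq_bigr => i _; rewrite inE /h.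
by case: ifP => // _; rewrite !mxE.
Qed.

Lemma measurable_gd_output :
  measurable_fun setT (fun w => gd_output alpha (eta w) (X w) (yh w) (W0 w)).
Proof. exact: measurable_lim_matrix. Qed.

End measurable_gradient_descent.

Lemma measurable_card_cond d0 (T : measurableType d0) (I : finType)
    (b : I -> T -> bool) (Q : pred nat) :
  (forall i, measurable [set w | b i w]) ->
  measurable [set w | Q #|[set i | b i w]%SET|].
Proof.
move=> mb; rewrite (_ : [set w | _] = \bigcup_(S in [set S : {set I} | Q #|S|])
    [set w | forall i, (i \in S) = b i w]).
  apply: fin_bigcup_measurable => [|S _]; first exact: finite_finset.
  apply: (@measurable_forall_fin _ _ _ (fun i => [set w | (i \in S) = b i w])) => i.
  case: (i \in S).
    by rewrite (_ : [set w | _] = [set w | b i w])//; apply/seteqP; split => w /=; [move=> <-|move=> ->].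
  rewrite (_ : [set w | _] = ~` [set w | b i w]); first exact: measurableC.
  by apply/seteqP; split => w /=; [move=> <-|move=> /negP/negbTE ->].
apply/seteqP; split => w /=.
  by move=> Qw; exists [set i | b i w]%SET => // i; rewrite inE.
move=> [S /= QS HS]; rewrite (_ : [set i | _]%SET = S)//.
by apply/setP => i; rewrite inE HS.
Qed.

(** * Frequency of the two labels *)

Section balanced_labels.
Context d0 (Om : measurableType d0) (R : realType) (P : probability Om R).
Context (n : nat) (y : Om -> 'rV[R]_n).
Hypothesis yunif : forall i, uniform_sign P (fun w => y w ord0 i).
Hypothesis yindep :
  mutually_independent P (fun i : 'I_n => sigma_of (fun w => y w ord0 i)).

Let my i : measurable_fun setT (fun w => y w ord0 i).
Proof. by case: (yunif i). Qed.

Let measurable_label i (s : R) : measurable [set w | y w ord0 i = s].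
Proof. by apply: measurable_eq_fun => //; exact: measurable_cst. Qed.

Lemma measurable_label_count (Q : pred nat) (s : R) :
  measurable [set w | Q #|[set i | y w ord0 i == s]%SET|].
Proof.
apply: (measurable_card_cond (b := fun i w => y w ord0 i == s)) => i.
rewrite (_ : [set w | _] = [set w | y w ord0 i = s])//.
by apply/seteqP; split => w /= /eqP.
Qed.

Lemma label_count_tail (s : R) : s = 1 \/ s = -1 ->
  (P [set w | (8 * #|[set i | y w ord0 i == s]%SET| < n)%N] <= ((4 / 5) ^+ n)%:E)%E.
Proof.
move=> s1.
(* Chernoff bound: each label equal to [s] is weighted by [b], so the product is [a^(8 count)], at
   least [a^n] on the event. As [b <= 1/4], one label has mean weight at most [5/8], and
   [(5/8)/(4/5) = 25/32 <= 4/5]. *)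
pose a : R := 4 / 5; pose b := a ^+ 8.
have a0 : 0 < a by rewrite /a; lra.
have b0 : 0 < b by rewrite exprn_gt0.
have b4 : b <= 4^-1.
  have a2 : a ^+ 2 <= 2 / 3 by rewrite /a expr2; lra.
  have a4 : a ^+ 4 <= 2^-1.
    have : (a ^+ 2) ^+ 2 <= (2 / 3) ^+ 2.
      by apply: lerXn2r; rewrite ?nnegrE ?sqr_ge0//; lra.
    rewrite -exprM => h; apply: le_trans h _; rewrite expr2; lra.
  have : (a ^+ 4) ^+ 2 <= (2^-1) ^+ 2.
    by apply: lerXn2r; rewrite ?nnegrE ?exprn_ge0 ?(ltW a0)//; lra.
  rewrite -exprM => h; apply: le_trans h _; rewrite expr2; lra.
pose phi (x : R) := if x == s then b else 1.
have mphi : measurable_fun setT phi.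
  apply: measurable_fun_ifT => //.
  exact: measurable_fun_eqr.
have Ephi i : (\int[P]_w (phi (y w ord0 i))%:E = ((1 + b) / 2)%:E)%E.
  have Ps : P [set w | y w ord0 i = s] = (2^-1)%:E.
    by case: (yunif i) => _ p1 p2; case: s1 => ->.
  pose A := [set w | y w ord0 i = s].
  have mA : measurable A by exact: measurable_label.
  transitivity (\int[P]_w (b%:E * (\1_A w)%:E + (\1_(~` A) w)%:E))%E.
    apply: eq_integral => w _; rewrite /phi -EFinM -EFinD; congr EFin.
    rewrite !indicE; have [yw|yw] := eqVneq (y w ord0 i) s.
      by rewrite mem_set// memNset ?mulr1 ?addr0//; exact.
    by rewrite memNset ?mulr0 ?add0r ?mem_set//; apply/eqP.
  have mI (B : set Om) : measurable B -> measurable_fun setT (fun w : Om => (\1_B w : R)%:E).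
    by move=> mB; apply/measurable_EFinP; exact: measurable_indic.
  have bI : (0 <= b%:E)%E by rewrite lee_fin ltW.
  rewrite (@ge0_integralD _ _ _ P _ measurableT (fun w => b%:E * (\1_A w)%:E)%E
    (fun w => (\1_(~` A) w)%:E)); first last.
  - by apply: mI; exact: measurableC.
  - by move=> w _; rewrite lee_fin.
  - by apply: emeasurable_funM => //; exact: mI.
  - by move=> w _; rewrite mule_ge0// lee_fin.
  rewrite (@ge0_integralZl _ _ _ P _ measurableT (fun w => (\1_A w)%:E)) //; last exact: mI.
  rewrite !integral_indic//; last exact: measurableC.
  have PA : P (~` A) = (2^-1)%:E.
    by rewrite probability_setC// Ps -EFinB; congr EFin; field.
  rewrite !setIT [X in (_ + X)%E]PA [X in (_ * X + _)%E]Ps -EFinM -EFinD.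
  by congr EFin; field.
pose F w := a ^- n * \prod_i phi (y w ord0 i).
have mF : measurable_fun setT F.
  apply: measurable_funM => //; apply: measurable_prod_cond => i _.
  exact: (measurableT_comp mphi).
have phi0 x : 0 <= phi x by rewrite /phi; case: ifP => // _; exact: ltW.
have F0 w : 0 <= F w.
  by rewrite mulr_ge0 ?invr_ge0 ?exprn_ge0 ?(ltW a0)// prodr_ge0.
apply: (@le_trans _ _ (\int[P]_w (F w)%:E)%E).
  apply: probability_le_integral => //.
    exact: (measurable_label_count (fun k => (8 * k < n)%N)).
  move=> w /= h; rewrite /F.
  have -> : \prod_i phi (y w ord0 i) = a ^+ (8 * #|[set i | y w ord0 i == s]%SET|).
    rewrite exprM -prodr_const [RHS]big_mkcond/=; apply: eq_bigr => i _.
    by rewrite inE.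
  rewrite mulrC ler_pdivlMr ?exprn_gt0// mul1r.
  by apply: ler_wiXn2l; rewrite ?(ltW a0) ?(ltnW h)//; rewrite /a; lra.
rewrite [leLHS](_ : _ = \int[P]_w ((a ^- n)%:E *
  (\prod_i phi (y w ord0 i))%:E))%E//.
rewrite (@ge0_integralZl _ _ _ P _ measurableT
  (fun w => (\prod_i phi (y w ord0 i))%:E)); first last.
- by rewrite lee_fin invr_ge0 exprn_ge0// ltW.
- by move=> w _; rewrite lee_fin prodr_ge0.
- apply/measurable_EFinP; apply: measurable_prod_cond => i _.
  exact: (measurableT_comp mphi).
rewrite (ge0_independent_integral_prod (phi := fun _ => phi) my yindep)//; last first.
  by move=> i; rewrite Ephi ltry.
rewrite (eq_bigr _ (fun i _ => Ephi i)) prodEFin prodr_const card_ord -EFinM lee_fin.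
rewrite -exprVn -exprMn; apply: lerXn2r.
- by rewrite nnegrE mulr_ge0 ?invr_ge0 ?(ltW a0)// divr_ge0// addr_ge0// ltW.
- by rewrite nnegrE; lra.
- by rewrite /a invf_div; move: b4; lra.
Qed.

Lemma ae_labels_sign : {ae P, forall w, forall i, y w ord0 i = 1 \/ y w ord0 i = -1}.
Proof.
have H i : {ae P, forall w, y w ord0 i = 1 \/ y w ord0 i = -1}.
  pose A := [set w | y w ord0 i = 1] `|` [set w | y w ord0 i = -1].
  have mA : measurable A by apply: measurableU; exact: measurable_label.
  exists (~` A); split => //; first exact: measurableC.
  rewrite probability_setC// measureU//.
  - case: (yunif i) => _ p1 p2; rewrite [X in (_ - (X + _))%E]p1.
    rewrite [X in (_ - (_ + X))%E]p2.
    have -> : ((2^-1)%:E + (2^-1)%:E = 1 :> \bar R)%E by rewrite -EFinD; congr EFin; field.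
    by rewrite subee.
  - apply/seteqP; split => // w [/= -> h]; lra.
exact: filter_forall.
Qed.

End balanced_labels.

(** * Tail of the test noise for fixed weights *)

Section test_tail.
Context d0 (Om : measurableType d0) (R : realType) (P : probability Om R).
Context (d m : nat) (v : 'rV[R]_d) (Z : Om -> 'rV[R]_d) (W : 'M[R]_(m, d)).
Hypothesis d_gt0 : (0 < d)%N.
Hypothesis gaussZ : centered_gaussian P Z (noise_cov v).

Let dR : (0 : R) < d%:R. Proof. by rewrite ltr0n. Qed.

Let mZ : measurable_fun setT Z. Proof. by case: gaussZ. Qed.

Let abs_mgf (u : 'rV[R]_d) :
  (\int[P]_w (expR `|dotp u (Z w)|)%:E <= (2 * expR (dotp u u / d%:R / 2))%:E)%E.
Proof.
have mdot u' : measurable_fun setT (fun w => expR (dotp u' (Z w))).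
  by apply: measurableT_comp => //; exact: measurable_dotp.
have E u' : dotp u' u' = dotp u u ->
    (\int[P]_w (expR (dotp u' (Z w)))%:E <= (expR (dotp u u / d%:R / 2))%:E)%E.
  move=> uu; rewrite (expectation_expR_gaussian gaussZ) lee_fin ler_expR.
  rewrite ler_wpM2r ?invr_ge0// dotp_noise_cov uu mulrC.
  by rewrite ler_wpM2r ?invr_ge0 ?(ltW dR)// gerBl sqr_ge0.
have EN : dotp (- u) (- u) = dotp u u by rewrite dotpNl dotpNr opprK.
apply: (@le_trans _ _ (\int[P]_w ((expR (dotp u (Z w)))%:E +
   (expR (dotp (- u) (Z w)))%:E))%E).
  apply: ge0_le_integral => //.
  - by apply/measurable_EFinP; do 2 apply: measurableT_comp => //;
      exact: measurable_dotp.
  - by apply: emeasurable_funD; apply/measurable_EFinP.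
  - move=> w _; rewrite -EFinD lee_fin dotpNl.
    have := expR_ge0 (dotp u (Z w)); have := expR_ge0 (- dotp u (Z w)).
    by case: (ltrgt0P (dotp u (Z w))) => [||->]; rewrite ?expR0; lra.
rewrite (@ge0_integralD _ _ _ P _ measurableT (fun w => (expR (dotp u (Z w)))%:E)
  (fun w => (expR (dotp (- u) (Z w)))%:E)); first last.
- exact/measurable_EFinP.
- by move=> w _; rewrite lee_fin expR_ge0.
- exact/measurable_EFinP.
- by move=> w _; rewrite lee_fin expR_ge0.
by rewrite (le_trans (leeD (E u erefl) (E _ EN)))// -EFinD lee_fin mulr2n mulrDl mul1r.
Qed.

(* The exponential moment is bounded through Jensen's inequality, the weights
   |w_j| / S being completed to a probability vector by a term equal to 1. *)
Lemma test_noise_tail (th S : R) : 0 <= th -> 0 < S ->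
  th * (\sum_(j < m) enorm (row j W)) <= S ->
  (P [set w | (2^-1 <= th * \sum_(j < m) `|dotp (row j W) (Z w)|)%R] <=
   (2 * expR (- (d%:R / (8 * S ^+ 2))))%:E)%E.
Proof.
move=> th0 S0 hS.
(* Minimises the exponent [- lam/2 + (lam S)^2 / (2d)]; the minimum is [- d/(8 S^2)]. *)
pose lam : R := d%:R / (2 * S ^+ 2).
have lam0 : 0 < lam by rewrite divr_gt0// mulr_gt0// exprn_gt0.
pose p j := th * enorm (row j W) / S.
(* A zero row yields the zero vector, by the convention for the inverse of 0. *)
pose e j : 'rV[R]_d := (enorm (row j W))^-1 *: row j W.
have p0 j : 0 <= p j.
  by rewrite divr_ge0 ?(ltW S0)// mulr_ge0 ?enorm_ge0.
have psum : \sum_j p j <= 1.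
  by rewrite /p -mulr_suml ler_pdivrMr// mul1r -mulr_sumr.
have enormE j : enorm (row j W) *: e j = row j W.
  have [h|h] := eqVneq (enorm (row j W)) 0; last by rewrite /e scalerA divff// scale1r.
  rewrite h scale0r; apply/esym/eqP; rewrite -dotp_eq0.
  by rewrite -enorm_sqr h expr0n.
have ee j : dotp (e j) (e j) <= 1.
  rewrite /e dotpZl dotpZr -enorm_sqr.
  have [->|h] := eqVneq (enorm (row j W)) 0; first by rewrite invr0 mul0r.
  by rewrite expr2 mulrA mulrACA mulVf// mulr1.
pose A (w : Om) (j : 'I_m) := `|dotp ((lam * S) *: e j) (Z w)|.
have AE w : \sum_j p j * A w j = lam * (th * \sum_j `|dotp (row j W) (Z w)|).
  rewrite !mulr_sumr; apply: eq_bigr => j _; rewrite /A /p dotpZl normrM.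
  rewrite -[in RHS](enormE j) dotpZl [in RHS]normrM.
  rewrite (ger0_norm (enorm_ge0 _)) (ger0_norm (ltW (mulr_gt0 lam0 S0))).
  by field; rewrite gt_eqF.
pose F w := expR (- lam / 2) *
  (\sum_j p j * expR (A w j) + (1 - \sum_j p j)).
have mA j : measurable_fun setT (fun w => expR (A w j)).
  apply: measurableT_comp => //; apply: measurableT_comp => //.
  exact: measurable_dotp.
have mS : measurable_fun setT (fun w => \sum_j p j * expR (A w j)).
  by apply: measurable_sum => j; exact: measurable_funM.
have mF : measurable_fun setT F.
  by apply: measurable_funM => //; exact: measurable_funD.
have S00 w : 0 <= \sum_j p j * expR (A w j).
  by apply: sumr_ge0 => j _; rewrite mulr_ge0 ?expR_ge0.
have F0 w : 0 <= F w by rewrite mulr_ge0 ?expR_ge0// addr_ge0 ?subr_ge0.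
(* Tangent line of the exponential at the mean [a]: [exp(A_j) >= exp(a)(1 + A_j - a)] for each [j],
   and [1 >= exp(a)(1 - a)] for the remaining mass, placed at 0. *)
have jensen w : expR (lam * (th * \sum_j `|dotp (row j W) (Z w)|)) <=
    \sum_j p j * expR (A w j) + (1 - \sum_j p j).
  rewrite -AE; set a := \sum_j p j * A w j.
  have h1 j : p j * (expR a * (1 + (A w j - a))) <= p j * expR (A w j).
    rewrite ler_wpM2l//; have := expR_ge1Dx (A w j - a) => h.
    have := ler_wpM2l (expR_ge0 a) h; rewrite -expRD => {}h.
    by apply: le_trans h _; rewrite addrC subrK.
  have h2 : expR a * (1 - a) <= 1.
    have := ler_wpM2l (expR_ge0 a) (expR_ge1Dx (- a)).
    by rewrite -expRD subrr expR0.
  have h3 : \sum_j p j * (expR a * (1 + (A w j - a))) <=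
      \sum_j p j * expR (A w j) by apply: ler_sum => j _.
  have h4 : \sum_j p j * (expR a * (1 + (A w j - a))) =
      expR a * ((1 - a) * (\sum_j p j) + a).
    rewrite mulr_sumr {3}/a -big_split/= mulr_sumr; apply: eq_bigr => j _; ring.
  have h5 : (expR a * (1 - a)) * (1 - \sum_j p j) <= 1 - \sum_j p j.
    by rewrite ler_piMl// subr_ge0.
  rewrite h4 in h3; apply: le_trans (_ : expR a * ((1 - a) * (\sum_j p j) + a) +
    (expR a * (1 - a)) * (1 - \sum_j p j) <= _); last exact: lerD.
  by rewrite le_eqVlt; apply/orP; left; apply/eqP; ring.
apply: (@le_trans _ _ (\int[P]_w (F w)%:E)%E).
  apply: probability_le_integral => //.
    apply: measurable_le_fun => //; apply: measurable_funM => //.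
    apply: measurable_sum => j; apply: measurableT_comp => //.
    exact: measurable_dotp.
  move=> w /= h; rewrite /F; apply: le_trans (_ : expR (- lam / 2) *
    expR (lam * (th * \sum_j `|dotp (row j W) (Z w)|)) <= _); last first.
    by rewrite ler_wpM2l ?expR_ge0.
  rewrite -expRD -[leLHS]expR0 ler_expR.
  by have := ler_wpM2l (ltW lam0) h; lra.
pose E : R := 2 * expR ((lam * S) ^+ 2 / d%:R / 2).
have E1 : 1 <= E.
  rewrite /E; have : 1 <= expR ((lam * S) ^+ 2 / d%:R / 2).
    by rewrite -[leLHS]expR0 ler_expR !divr_ge0// sqr_ge0.
  lra.
have EA j : (\int[P]_w (expR (A w j))%:E <= E%:E)%E.
  rewrite (le_trans (abs_mgf _))// lee_fin ler_wpM2l// ler_expR.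
  rewrite ler_wpM2r ?invr_ge0// ler_wpM2r ?invr_ge0 ?(ltW dR)//.
  rewrite dotpZl dotpZr mulrA -expr2 ler_piMr ?sqr_ge0//.
pose G w := \sum_j p j * expR (A w j) + (1 - \sum_j p j).
rewrite [leLHS](_ : _ = \int[P]_w ((expR (- lam / 2))%:E * (G w)%:E))%E//.
rewrite (@ge0_integralZl _ _ _ P _ measurableT (fun w => (G w)%:E)); first last.
- by rewrite lee_fin expR_ge0.
- by move=> w _; rewrite lee_fin addr_ge0// subr_ge0.
- by apply/measurable_EFinP; exact: measurable_funD.
apply: (@le_trans _ _ ((expR (- lam / 2))%:E * E%:E)%E); last first.
  rewrite -EFinM lee_fin /E mulrCA -expRD ler_wpM2l// ler_expR.
  rewrite le_eqVlt; apply/orP; left; apply/eqP; rewrite /lam; field.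
  by rewrite !gt_eqF.
rewrite lee_wpmul2l ?lee_fin ?expR_ge0//.
rewrite [leLHS](_ : _ = \int[P]_w ((\sum_j p j * expR (A w j))%:E +
  (1 - \sum_j p j)%:E))%E//.
rewrite (@ge0_integralD _ _ _ P _ measurableT
  (fun w => (\sum_j p j * expR (A w j))%:E) (fun=> (1 - \sum_j p j)%:E)); first last.
- exact/measurable_EFinP.
- by move=> w _; rewrite lee_fin subr_ge0.
- exact/measurable_EFinP.
- by move=> w _; rewrite lee_fin.
rewrite integral_cst//= probability_setT mule1.
apply: (@le_trans _ _ ((\sum_j p j * E)%:E + (1 - \sum_j p j)%:E)%E).
  rewrite leeD2r//; under eq_integral do rewrite -sumEFin.
  rewrite ge0_integral_sum//; last 2 first.
  - by move=> j; apply/measurable_EFinP; exact: measurable_funM.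
  - by move=> j w _; rewrite lee_fin mulr_ge0 ?expR_ge0.
  rewrite -sumEFin; apply: lee_sum => j _.
  rewrite [leLHS](_ : _ = \int[P]_w ((p j)%:E * (expR (A w j))%:E))%E//.
  rewrite (@ge0_integralZl _ _ _ P _ measurableT (fun w => (expR (A w j))%:E)); first last.
  - by rewrite lee_fin.
  - by move=> w _; rewrite lee_fin expR_ge0.
  - exact/measurable_EFinP.
  by rewrite [leRHS]EFinM; apply: lee_wpmul2l; rewrite ?lee_fin.
rewrite -EFinD lee_fin -mulr_suml.
have : (1 - \sum_j p j) * 1 <= (1 - \sum_j p j) * E by rewrite ler_wpM2l ?subr_ge0.
lra.
Qed.

End test_tail.

(** * Conditioning on the training data *)

Section independent_joint_law.
Context d0 d1 d2 (Om : measurableType d0) (A : measurableType d1)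
  (D : measurableType d2) (R : realType) (P : probability Om R).
Context (T : Om -> A) (Z : Om -> D).
Hypotheses (mT : measurable_fun setT T) (mZ : measurable_fun setT Z).
Hypothesis indep : independent P (sigma_of T) (sigma_of Z).

Let T' : {mfun Om >-> A} := HB.pack T (isMeasurableFun.Build _ _ _ _ _ mT).
Let Z' : {mfun Om >-> D} := HB.pack Z (isMeasurableFun.Build _ _ _ _ _ mZ).
Let mTZ : measurable_fun setT (fun w => (T w, Z w)).
Proof. exact: measurable_fun_pair. Qed.
Let TZ' : {mfun Om >-> (A * D)%type} :=
  HB.pack (fun w => (T w, Z w)) (isMeasurableFun.Build _ _ _ _ _ mTZ).

Let sectionE (S : set (A * D)) z :
  distribution P T' (ysection S z) = P [set w | S (T w, z)].
Proof.
by congr (P _); apply/seteqP; split => w /=; rewrite /ysection/= inE.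
Qed.

Let measurable_joint_section (S : set (A * D)) z : measurable S ->
  measurable [set w | S (T w, z)].
Proof.
move=> mS; rewrite (_ : [set w | _] = T @^-1` ysection S z).
  by rewrite -[X in measurable X]setTI; apply: mT => //; exact: measurable_ysection.
by apply/seteqP; split => w /=; rewrite /ysection/= inE.
Qed.

Let measurable_section_probability (S : set (A * D)) : measurable S ->
  measurable_fun setT (fun w' => P [set w | S (T w, Z w')]).
Proof.
move=> mS; under eq_fun do rewrite -sectionE.
exact: (measurableT_comp (measurable_fun_ysection (distribution P T') mS) mZ).
Qed.

(** Independence identifies the joint law with the product measure, by uniqueness on rectangles; its
    value on [S] is then computed by integrating the sections at fixed [z]. *)
Lemma independent_joint_law (S : set (A * D)) : measurable S ->
  P [set w | S (T w, Z w)] = (\int[P]_w' P [set w | S (T w, Z w')])%E.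
Proof.
move=> mS.
have -> : P [set w | S (T w, Z w)] = distribution P TZ' S by [].
have E (B : set A) (C : set D) : measurable B -> measurable C ->
    distribution P TZ' (B `*` C) = (distribution P T' B * distribution P Z' C)%E.
  move=> mB mC; apply: (indep (A := T @^-1` B) (B := Z @^-1` C)).
    by exists B => //; rewrite setTI.
  by exists C => //; rewrite setTI.
rewrite -(product_measure_unique E mS).
rewrite (@product_measure_unique _ _ _ _ _ (distribution P T') (distribution P Z')
  (distribution P T' \x^ distribution P Z')%E _ S mS); last first.
  by move=> B C mB mC; exact: (product_measure2E (distribution P T') (distribution P Z')).
transitivity (\int[distribution P Z']_z (distribution P T' (ysection S z)))%E => //.
rewrite ge0_integral_pushforward//.
- by apply: eq_integral => w _ /=; exact: sectionE.
- exact: measurable_fun_ysection.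
Qed.

Lemma independent_section_le (Bad : set (A * D)) (G : set D) (rho : R) :
  measurable Bad -> measurable G ->
  (forall z, G z -> (P [set w | Bad (T w, z)] <= rho%:E)%E) ->
  (P ([set w | Bad (T w, Z w)] `&` Z @^-1` G) <= rho%:E * P (Z @^-1` G))%E.
Proof.
move=> mBad mG h.
have mZG : measurable (Z @^-1` G) by rewrite -[X in measurable X]setTI; exact: mZ.
rewrite (_ : _ `&` _ = [set w | (Bad `&` (setT `*` G)) (T w, Z w)]); last first.
  by apply/seteqP; split => w /=; [move=> [? ?]; split|move=> [? []]].
have mS : measurable (Bad `&` ([set: A] `*` G)).
  by apply: measurableI => //; exact: measurableX.
rewrite (independent_joint_law mS).
(* For negative [rho] the section bound is impossible, so [G] has empty preimage. *)
have [rho0|rho0] := leP 0 rho; last first.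
  have E w : ~ (Z @^-1` G) w.
    move=> /= /h /(le_trans (measure_ge0 _ _)); rewrite lee_fin.
    by rewrite leNgt rho0.
  rewrite (_ : Z @^-1` G = set0) ?measure0 ?mule0; last first.
    by apply/seteqP; split => w // /E.
  rewrite integral0_eq// => w _; rewrite [X in P X](_ : _ = set0) ?measure0//.
  by apply/seteqP; split => // w' /= [_ [_ /E]].
have -> : (rho%:E * P (Z @^-1` G) = \int[P]_w (rho%:E * (\1_(Z @^-1` G) w)%:E))%E.
  rewrite (@ge0_integralZl _ _ _ P _ measurableT
    (fun w => (\1_(Z @^-1` G) w)%:E))//.
  - by rewrite integral_indic// setIT.
  - by apply/measurable_EFinP; exact: measurable_indic.
apply: ge0_le_integral => //.
- exact: measurable_section_probability.
- apply: emeasurable_funM => //; apply/measurable_EFinP; exact: measurable_indic.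
- move=> w _; rewrite indicE; have [/set_mem wG|wG] := boolP (w \in Z @^-1` G).
    rewrite mule1 (le_trans _ (h _ wG))//; apply: le_measure; rewrite ?inE.
    + exact: measurable_joint_section.
    + exact: measurable_joint_section.
    + by move=> w' /= [].
  rewrite mule0 [X in P X](_ : _ = set0) ?measure0//.
  apply/seteqP; split => // w' /= [_ [_ Gw]].
  by move/negP: wG; apply; exact: mem_set.
Qed.

End independent_joint_law.

Section conditional_probability_bound.
Context d0 d1 (Om : measurableType d0) (D : measurableType d1) (R : realType).
Context (P : probability Om R) (Z : Om -> D).
Hypothesis mZ : measurable_fun setT Z.

Lemma sigma_ofI (A B : set Om) :
  sigma_of Z A -> sigma_of Z B -> sigma_of Z (A `&` B).
Proof.
move=> [A' mA' <-] [B' mB' <-]; exists (A' `&` B'); first exact: measurableI.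
by rewrite preimage_setI setIA setIACA setIid setIA.
Qed.

Lemma measurable_sigma_of (A : set Om) : sigma_of Z A -> measurable A.
Proof. by move=> [A' mA' <-]; exact: mZ. Qed.

(** On [B = E] intersected with the set where [g >= rho + 1/(n+1)], integrating [g] gives [(rho +
    1/(n+1)) P(B) <= P(A and B) <= rho P(B)], so [P(B) = 0]; countably many [n] suffice. *)
Lemma cond_prob_le (A E : set Om) (g : Om -> R) (rho : R) :
  is_cond_prob P (sigma_of Z) A g -> sigma_of Z E ->
  (forall B, sigma_of Z B -> B `<=` E -> (P (A `&` B) <= rho%:E * P B)%E) ->
  {ae P, forall w, E w -> g w <= rho}.
Proof.
move=> [gG gint gP] ZE h.
suff H (n : nat) : {ae P, forall w, E w -> g w < rho + n.+1%:R^-1}.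
  have := ae_foralln H.
  apply: filterS => w gw Ew; apply/ler_addgt0Pr => e e0.
  have [n _ /(_ _ (leqnn n)) ne] := near_infty_natSinv_lt (PosNum e0).
  by rewrite ltW// (lt_le_trans (gw n Ew))// lerD2l ltW.
set c := rho + _; pose B := E `&` g @^-1` `[c, +oo[%classic.
have ZB : sigma_of Z B by apply: sigma_ofI => //; exact: gG.
have mB := measurable_sigma_of ZB.
exists B; split => //; last first.
  by move=> w /= /not_implyP[Ew /negP]; rewrite -leNgt => gw; split => //=;
    rewrite in_itv/= andbT.
have PB : P B \is a fin_num by rewrite fin_num_measure.
have i1 : (c%:E * P B <= \int[P]_(w in B) (g w)%:E)%E.
  rewrite -(integral_cst P mB); apply: le_integral => //.
  - exact: (finite_measure_integrable_cst P c mB).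
  - exact: (integrableS measurableT).
  - by move=> w; rewrite inE => -[_ /=]; rewrite in_itv/= andbT lee_fin.
have := le_trans i1 _; rewrite gP// => /(_ _ (h _ ZB (@subIsetl _ _ _))).
rewrite -(fineK PB) -!EFinM !lee_fin /c mulrDl gerDl.
have : 0 <= fine (P B) by exact: fine_ge0.
move=> p0 p1; congr EFin; apply/eqP; rewrite eq_le p0 andbT.
by rewrite pmulr_rle0 in p1.
Qed.

End conditional_probability_bound.

Section good_data_measurable.
Context {R : realType} {n d : nat} (gamma : R) (v : 'rV[R]_d).

Definition good_data (k M : nat) (z : 'M[R]_(n, d) * 'rV[R]_n) : Prop :=
  [/\ net_good M (noise_part gamma v z.1),
      labels_ok k (label_part gamma v z.1) z.2 &
      balanced (label_part gamma v z.1)].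

Lemma measurable_noise_part : measurable_fun setT (@noise_part R n d gamma v).
Proof.
apply: measurable_mx => i j; under eq_fun do rewrite !mxE.
apply: measurable_funM => //; apply: measurable_funB.
  exact: measurable_entry.
apply: measurable_funM => //; apply: measurable_dotp => //.
exact: measurable_row.
Qed.

Lemma measurable_label_part : measurable_fun setT (@label_part R n d gamma v).
Proof.
apply: measurable_mx => i j; under eq_fun do rewrite !mxE.
apply: measurable_funM => //; apply: measurable_dotp => //.
exact: measurable_row.
Qed.

Local Notation data := ('M[R]_(n, d) * 'rV[R]_n)%type.

Lemma measurable_good_data k M : measurable [set z : data | good_data k M z].
Proof.
pose Y (z : data) := label_part gamma v z.1.
have mY : measurable_fun setT Y.
  exact: (measurableT_comp measurable_label_part).
have mYi i : measurable_fun setT (fun z : data => Y z ord0 i).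
  exact: measurable_entry_comp.
have mi i : measurable_fun setT (fun z : data => z.2 ord0 i).
  exact: measurable_entry_comp.
have m1 : measurable [set z : data |
    net_good M (noise_part gamma v z.1)].
  rewrite -[X in measurable X]setTI.
  have mN : measurable_fun setT (fun z : data => noise_part gamma v z.1).
    exact: (measurableT_comp measurable_noise_part).
  exact: (mN measurableT _ (@measurable_net_good R n d M)).
have eqE (f : data -> R) (s : R) :
    measurable_fun setT f -> measurable [set z : data | f z == s].
  move=> mf; rewrite (_ : [set z | _] = [set z : data | f z = s]).
    exact: measurable_eq_fun.
  by apply/seteqP; split => z /= /eqP.
have m2 : measurable [set z : data | labels_ok k (Y z) z.2].
  rewrite (_ : [set z | _] =
    [set z : data | forall i, Y z ord0 i = 1 \/ Y z ord0 i = -1] `&`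
    [set z : data | forall i, z.2 ord0 i = Y z ord0 i \/ z.2 ord0 i = - Y z ord0 i] `&`
    [set z : data | (#|[set i | z.2 ord0 i != Y z ord0 i]%SET| <= k)%N]).
    apply: measurableI; first apply: measurableI.
    - apply: (@measurable_forall_fin _ _ _
        (fun i : 'I_n => [set z : data | Y z ord0 i = 1 \/ Y z ord0 i = -1])) => i.
      by apply: measurableU; exact: measurable_eq_fun.
    - apply: (@measurable_forall_fin _ _ _
        (fun i : 'I_n => [set z : data | z.2 ord0 i = Y z ord0 i \/ z.2 ord0 i = - Y z ord0 i])) => i.
      apply: measurableU; apply: measurable_eq_fun => //.
      exact: measurable_funN.
    - apply: (measurable_card_cond (b := fun i (z : data) => z.2 ord0 i != Y z ord0 i)
        (fun c => (c <= k)%N)) => i.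
      rewrite (_ : [set z | _] = ~` [set z : data | z.2 ord0 i = Y z ord0 i]).
        by apply: measurableC; exact: measurable_eq_fun.
      by apply/seteqP; split => z /= /eqP.
  by apply/seteqP; split => z; [case|move=> [[]]].
have mb (s : R) : measurable [set z : data | (n <= 8 * #|[set i | Y z ord0 i == s]%SET|)%N].
  apply: (measurable_card_cond (b := fun i (z : data) => Y z ord0 i == s)
    (fun c => (n <= 8 * c)%N)) => i.
  exact: eqE.
have m3 : measurable [set z : data | balanced (Y z)] by exact: measurableI (mb 1) (mb (-1)).
rewrite (_ : [set z | _] = [set z : data | net_good M (noise_part gamma v z.1)] `&`
  [set z : data | labels_ok k (Y z) z.2] `&` [set z : data | balanced (Y z)]).
  by do 2 apply: measurableI => //.
by apply/seteqP; split => z; [case|move=> [[]]].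
Qed.

End good_data_measurable.

(** * Probability of good training data *)

Section training_data_probability.
Context d0 (Om : measurableType d0) {R : realType} (P : probability Om R).
Context {d n k : nat} (gamma : R) (v : 'rV[R]_d).
Context (y : Om -> 'rV[R]_n) (N : Om -> 'M[R]_(n, d)) (B : Om -> {set 'I_n}).
Context (yt : Om -> R) (nt : Om -> 'rV[R]_d).
Hypothesis model : data_model P k gamma v y N B yt nt.
Hypotheses (gamma01 : 0 < gamma < 1) (v1 : dotp v v = 1).
Hypotheses (n_gt0 : (0 < n)%N) (dn : (8 * n <= d)%N).

Notation train := (training_data gamma v y N B).

Let my i : measurable_fun setT (fun w => y w ord0 i).
Proof. by case: (dm_y_unif model i). Qed.

Let mN : measurable_fun setT N.
Proof. exact: (measurable_gaussian_matrix (dm_N_gauss model)). Qed.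

Lemma measurable_training_data : measurable_fun setT train.
Proof.
apply: measurable_fun_pair.
  apply: measurable_mx => i j; under eq_fun do rewrite !mxE.
  apply: measurable_funD; first by do 2 apply: measurable_funM => //.
  by apply: measurable_funM => //; exact: measurable_entry_comp.
apply: measurable_mx => i j; under eq_fun do rewrite mxE.
apply: measurable_fun_ifT => //; last exact: measurable_funN.
apply: (measurable_fun_bool true); rewrite setTI.
rewrite (_ : _ @^-1` _ = \bigcup_(S in [set S : {set 'I_n} | j \in S]) B @^-1` [set S]).
  apply: fin_bigcup_measurable => [|S _]; first exact: finite_finset.
  exact: (dm_B_meas model).
apply/seteqP; split => w /=; first by move=> h; exists (B w).
by move=> [S /= jS ->].
Qed.

Lemma ae_noise_orthogonal : {ae P, forall w, forall i, dotp v (row i (N w)) = 0}.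
Proof.
apply: filter_forall => i.
have h := gaussian_orthogonal (dm_N_gauss model i).
have mA : measurable [set w | dotp v (row i (N w)) = 0].
  apply: measurable_eq_fun => //; apply: measurable_dotp => //.
  exact: measurable_row.
exists (~` [set w | dotp v (row i (N w)) = 0]); split => //.
  exact: measurableC.
rewrite probability_setC// h ?subee// dotp_noise_cov v1.
by rewrite expr1n subrr mulr0.
Qed.

Lemma ae_good_data (M : nat) : {ae P, forall w,
  net_good M (N w) -> balanced (y w) -> good_data gamma v k M (train w)}.
Proof.
have h := ae_labels_sign (dm_y_unif model).
have h' := ae_noise_orthogonal.
near=> w => good bal; rewrite /good_data/=.
have [-> ->] : noise_part gamma v (data_matrix gamma v (y w) (N w)) = N w /\
    label_part gamma v (data_matrix gamma v (y w) (N w)) = y w.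
  by apply: parts_data_matrix => //; near: w.
split => //; rewrite -(dm_B_card model w); apply: labels_ok_flip; by near: w.
Unshelve. all: by end_near. Qed.

(** Failure at every [r] is contained in failure at each single [r], whose probability is at most
    [2^(-r)]. The [r] that works depends on the outcome. *)
Lemma ae_net_good : {ae P, forall w,
  exists r, net_good (2 ^ (16 * r.+1) * 2 ^ (16 * r.+1)) (N w)}.
Proof.
pose M r := (2 ^ (16 * r.+1) * 2 ^ (16 * r.+1))%N.
have mG r : measurable [set w | net_good (M r) (N w)].
  rewrite -[X in measurable X]setTI.
  exact: (mN measurableT (@measurable_net_good R n d (M r))).
pose A := \bigcap_r (~` [set w | net_good (M r) (N w)]).
have mA : measurable A by apply: bigcapT_measurable => r; exact: measurableC.
exists A; split => //; last first.
  by move=> w /= h r _ g; apply: h; exists r.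
have PA r : (P A <= (2^-1 ^+ r)%:E)%E.
  apply: (@le_trans _ _ (P (~` [set w | net_good (M r) (N w)]))).
    apply: le_measure; rewrite ?inE//; first exact: measurableC.
    exact: bigcap_inf.
  have h := net_bad_probability n_gt0 dn v1 (dm_N_gauss model) (dm_N_indep model)
    (M := M r) (ltn0Sn r) erefl.
  apply: le_trans h _; rewrite lee_fin.
  apply: ler_wiXn2l; rewrite ?invr_ge0//; first by rewrite invf_le1// ler1n.
  have d1 : (0 < d)%N by rewrite (leq_trans _ dn)// muln_gt0.
  by rewrite -mulnA mulnCA (leq_trans (leqnSn r))// leq_pmulr// muln_gt0.
have PAfin : P A \is a fin_num by rewrite fin_num_measure.
have p0 : 0 <= fine (P A) by exact: fine_ge0.
rewrite -(fineK PAfin); congr EFin; apply/eqP; rewrite eq_le p0 andbT.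
apply/ler_addgt0Pr => e e0; rewrite add0r.
have [r _ /(_ _ (leqnn r)) re] := near_infty_natSinv_lt (PosNum e0).
have := PA r; rewrite -{1}(fineK PAfin) lee_fin => h; apply: le_trans h _.
apply: le_trans (ltW re); rewrite exprVn lef_pV2 ?posrE ?exprn_gt0//.
by rewrite -natrX ler_nat ltn_expl.
Qed.

Lemma good_data_probability (r M : nat) : (0 < r)%N ->
  M = (2 ^ (16 * r) * 2 ^ (16 * r))%N ->
  (P (train @^-1` [set z | good_data gamma v k M z]) >=
   (1 - (2^-1 ^+ (5 * r * d) + (4 / 5) ^+ n + (4 / 5) ^+ n))%:E)%E.
Proof.
move=> r0 ME.
pose E := train @^-1` [set z | good_data gamma v k M z].
have mE : measurable E.
  rewrite -[X in measurable X]setTI; apply: measurable_training_data => //.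
  exact: measurable_good_data.
have [Z [mZ PZ hZ]] := ae_good_data M.
pose A1 := [set w | ~ net_good M (N w)].
pose A2 s := [set w | (8 * #|[set i | y w ord0 i == s]%SET| < n)%N].
have mA1 : measurable A1.
  apply: (@measurableC _ _ [set w | net_good M (N w)]).
  rewrite -[X in measurable X]setTI.
  exact: (mN measurableT (@measurable_net_good R n d M)).
have mA2 s : measurable (A2 s).
  exact: (measurable_label_count (dm_y_unif model) (fun c => (8 * c < n)%N)).
(* Besides a null set there are three causes of failure: the net, too few labels [1], too few labels
   [-1]. *)
have sub : ~` E `<=` Z `|` (A1 `|` (A2 1 `|` A2 (-1))).
  move=> w nE; have [Zw|Zw] := pselect (Z w); first by left.
  right; have [g|g] := pselect (net_good M (N w)); last by left.
  right; have [b1|b1] := leqP n (8 * #|[set i | y w ord0 i == 1%R]%SET|); last by left.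
  have [b2|b2] := leqP n (8 * #|[set i | y w ord0 i == -1%R]%SET|); last by right.
  exfalso; apply: Zw; apply: hZ => /= h; apply: nE; apply: h => //.
have mU : measurable (A1 `|` (A2 1 `|` A2 (-1))).
  by do 2 apply: measurableU => //.
have PC : (P (~` E) <= (2^-1 ^+ (5 * r * d) + (4 / 5) ^+ n + (4 / 5) ^+ n)%:E)%E.
  apply: (@le_trans _ _ (P (Z `|` (A1 `|` (A2 1 `|` A2 (-1)))))).
    by apply: le_measure; rewrite ?inE//; [exact: measurableC|exact: measurableU].
  rewrite (le_trans (measureU2 _ _ _))// [X in (X + _)%E]PZ add0e.
  rewrite (le_trans (measureU2 _ _ _))//; first exact: measurableU.
  rewrite -addrA EFinD leeD//.
    exact: (net_bad_probability n_gt0 dn v1 (dm_N_gauss model) (dm_N_indep model)).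
  rewrite (le_trans (measureU2 _ _ _))// EFinD leeD//.
    by apply: (label_count_tail (dm_y_unif model) (dm_y_indep model)); left.
  by apply: (label_count_tail (dm_y_unif model) (dm_y_indep model)); right.
have PE : P E = (1 - P (~` E))%E.
  by rewrite -[in LHS](setCK E) probability_setC//; exact: measurableC.
by rewrite [leRHS]PE EFinB leeB.
Qed.

End training_data_probability.

Lemma measure_le_ae d0 (Om : measurableType d0) (R : realType)
    (P : probability Om R) (A B : set Om) :
  measurable A -> measurable B -> {ae P, forall w, A w -> B w} ->
  (P A <= P B)%E.
Proof.
move=> mA mB [Z [mZ PZ hZ]].
apply: (@le_trans _ _ (P (Z `|` B))).
  apply: le_measure; rewrite ?inE//; first exact: measurableU.
  move=> w Aw; have [Bw|Bw] := pselect (B w); [by right|left].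
  by apply: hZ => /= h; apply: Bw; exact: h.
by rewrite (le_trans (measureU2 _ _ _))// [X in (X + _)%E]PZ add0e.
Qed.

(** * Error at the test point *)

Section test_error_probability.
Context d0 (Om : measurableType d0) {R : realType} (P : probability Om R).
Context {d n k m : nat} (gamma alpha : R) (v : 'rV[R]_d).
Context (y : Om -> 'rV[R]_n) (N : Om -> 'M[R]_(n, d)) (B : Om -> {set 'I_n}).
Context (yt : Om -> R) (nt : Om -> 'rV[R]_d).
Hypothesis model : data_model P k gamma v y N B yt nt.
Hypotheses (gamma01 : 0 < gamma < 1) (v1 : dotp v v = 1).
Hypotheses (n_gt0 : (0 < n)%N) (dn : (8 * n <= d)%N).
Hypotheses (k_gt0 : (0 < k)%N) (m_gt0 : (0 < m)%N).
Hypothesis alpha01 : 0 < alpha <= 1.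
Hypothesis gamma_k : k%:R^-1 <= gamma.
Variable M : nat.
Hypothesis M2 : (1 < M)%N.
Hypothesis k_n :
  k%:R * (200 ^+ 2 * M%:R * (1 + 4 * M%:R)) <= alpha ^+ 2 * n%:R.

Notation train := (training_data gamma v y N B).
Let data := ('M[R]_(n, d) * 'rV[R]_n)%type.

Context (eta lam : Om -> R) (W0 : Om -> 'M[R]_(m.*2, d)).
Hypotheses (meta : measurable_fun setT eta) (mlam : measurable_fun setT lam).
Hypothesis mW0 : measurable_fun setT W0.
Hypothesis adm :
  {ae P, forall w, gd_admissible alpha (train w).1 (eta w) (lam w) (W0 w)}.
Hypothesis indep : independent P (sigma_of (fun w => (yt w, nt w)))
  (sigma_of (fun w => (train w, (eta w, lam w, W0 w)))).

Let mtrain : measurable_fun setT train.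
Proof. exact: (measurable_training_data model). Qed.

Let S : R := 6 * Num.sqrt ((1 + 4 * M%:R) * k%:R) / alpha.

Let rho : R := 2 * expR (- (d%:R / (8 * S ^+ 2))).

Let al0 : 0 < alpha. Proof. by case/andP: alpha01. Qed.

Let S0 : 0 < S.
Proof.
by rewrite divr_gt0// mulr_gt0// sqrtr_gt0 mulr_gt0 ?ltr0n.
Qed.

Let out (z : data * (R * R * 'M[R]_(m.*2, d))) : 'M[R]_(m.*2, d) :=
  gd_output alpha z.2.1.1 z.1.1 z.1.2 z.2.2.

Let mout : measurable_fun setT out.
Proof.
apply: measurable_gd_output.
- exact: (measurableT_comp measurable_fst (measurableT_comp measurable_fst measurable_snd)).
- exact: (measurableT_comp measurable_fst measurable_fst).
- exact: (measurableT_comp measurable_snd measurable_fst).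
- exact: (measurableT_comp measurable_snd measurable_snd).
Qed.

(** What the test bound needs of the weights, stated without reference to the training that produced
    them. *)
Let tame (W : 'M[R]_(m.*2, d)) :=
  (forall s : R, s = 1 \/ s = -1 ->
     2^-1 <= s * network alpha W ((Num.sqrt gamma * s) *: v)) /\
  Num.sqrt (1 - gamma) * (\sum_(j < m.*2) enorm (row j W)) <= S.

Let measurable_tame : measurable [set W | tame W].
Proof.
pose T s := [set W : 'M[R]_(m.*2, d) |
  2^-1 <= s * network alpha W ((Num.sqrt gamma * s) *: v)].
have mT s : measurable (T s).
  apply: measurable_le_fun => //; apply: measurable_funM => //.
  exact: measurable_network.
rewrite (_ : [set W | _] = T 1 `&` T (-1) `&` [set W : 'M[R]_(m.*2, d) |
  Num.sqrt (1 - gamma) * (\sum_(j < m.*2) enorm (row j W)) <= S]).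
  apply: measurableI; first exact: measurableI.
  apply: measurable_le_fun => //; apply: measurable_funM => //.
  apply: measurable_sum => j; apply: (measurableT_comp (f := @Num.sqrt R)).
    by apply: continuous_measurable_fun; exact: sqrt_continuous.
  by apply: measurable_dotp; exact: measurable_row.
apply/seteqP; split => W /=.
  by move=> [h1 h2]; split => //; split; apply: h1; [left|right].
by move=> [[h1 h2] h3]; split => // s [->|->].
Qed.

Let bad (p : (R * 'rV[R]_d) * (data * (R * R * 'M[R]_(m.*2, d)))) : Prop :=
  p.1.1 * network alpha (out p.2) (data_point gamma v p.1.1 p.1.2) <= 0.

Let measurable_bad : measurable [set p | bad p].
Proof.
have m1 : measurable_fun setT
    (fun p : (R * 'rV[R]_d) * (data * (R * R * 'M[R]_(m.*2, d))) => p.1.1).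
  exact: (measurableT_comp measurable_fst measurable_fst).
apply: measurable_le_fun => //; apply: measurable_funM => //.
apply: measurable_network; first exact: (measurableT_comp mout measurable_snd).
apply: measurable_mx => i j; under eq_fun do rewrite !mxE.
apply: measurable_funD; first by do 2 apply: measurable_funM => //.
apply: measurable_funM => //; apply: measurable_entry_comp.
exact: (measurableT_comp measurable_snd measurable_fst).
Qed.

Let ae_test_sign : {ae P, forall w, yt w = 1 \/ yt w = -1}.
Proof.
have n1 : (1 : R) <> -1 by move=> h; lra.
have [myt p1 p2] := dm_yt_unif model.
have mU : measurable ([set w | yt w = 1] `|` [set w | yt w = -1]).
  by apply: measurableU; exact: measurable_eq_fun.
exists (~` ([set w | yt w = 1] `|` [set w | yt w = -1])); split => //.
  exact: measurableC.
rewrite probability_setC// measureU//; try exact: measurable_eq_fun.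
  rewrite [X in (_ - (X + _))%E]p1 [X in (_ - (_ + X))%E]p2.
  have -> : ((2^-1)%:E + (2^-1)%:E = 1 :> \bar R)%E by rewrite -EFinD; congr EFin; field.
  by rewrite subee.
by apply/seteqP; split => // w [/= -> /n1].
Qed.

Let section_bad z : tame (out z) ->
  (P [set w | bad ((yt w, nt w), z)] <= rho%:E)%E.
Proof.
move=> [h1 h2].
have d_gt0 : (0 < d)%N by rewrite (leq_trans _ dn)// muln_gt0.
have [myt _ _] := dm_yt_unif model.
have mnt : measurable_fun setT nt by case: (dm_nt_gauss model).
apply: le_trans (test_noise_tail d_gt0 (dm_nt_gauss model) (sqrtr_ge0 _) S0 h2).
apply: measure_le_ae.
- rewrite -[X in measurable X]setTI.
  have mp : measurable_fun setT (fun w => ((yt w, nt w), z)).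
    by do 2 apply: measurable_fun_pair => //.
  exact: (mp measurableT _ measurable_bad).
- apply: measurable_le_fun => //; apply: measurable_funM => //.
  apply: measurable_sum => j; apply: measurableT_comp => //.
  exact: measurable_dotp.
- apply: filterS ae_test_sign => w w1 /= hw.
  exact: (test_error alpha01 w1 (h1 _ w1) hw).
Qed.

(** Training data, step size and initialization are frozen together, as they are jointly independent
    of the test point; the tail bound for fixed weights then applies. Letting [b] range over all
    events of good data is the form that conditioning on the training data requires. *)
Lemma test_error_probability (b : set data) : measurable b ->
  (forall z, b z -> good_data gamma v k M z) ->
  (P ([set w | (yt w * network alpha
        (gd_output alpha (eta w) (train w).1 (train w).2 (W0 w))
        (data_point gamma v (yt w) (nt w)) <= 0)%R] `&` train @^-1` b) <=
   (2 * expR (- (d%:R / (8 * (6 * Num.sqrt ((1 + 4 * M%:R) * k%:R) / alpha) ^+ 2))))%:E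
     * P (train @^-1` b))%E.
Proof.
rewrite -/S -/rho => mb bgood.
pose Z w := (train w, (eta w, lam w, W0 w)).
pose T w := (yt w, nt w).
have [myt _ _] := dm_yt_unif model.
have mnt : measurable_fun setT nt by case: (dm_nt_gauss model).
have mT : measurable_fun setT T by exact: measurable_fun_pair.
have mZ : measurable_fun setT Z by do 3 apply: measurable_fun_pair => //.
pose G : set (data * (R * R * 'M[R]_(m.*2, d))) :=
  (fst @^-1` b) `&` (out @^-1` [set W | tame W]).
have mG : measurable G.
  apply: measurableI; rewrite -[X in measurable X]setTI.
    exact: measurable_fst.
  exact: mout.
have mpre d' (D : measurableType d') (f : Om -> D) C : measurable_fun setT f ->
    measurable C -> measurable (f @^-1` C).
  by move=> mf mC; rewrite -[X in measurable X]setTI; exact: mf.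
have mA : measurable [set w | bad (T w, Z w)].
  have mp : measurable_fun setT (fun w => (T w, Z w)) by exact: measurable_fun_pair.
  exact: (mpre _ _ _ [set p | bad p] mp measurable_bad).
have ZG : {ae P, forall w, (train @^-1` b) w -> (Z @^-1` G) w}.
  apply: filterS adm => w admw /= bw; split => //=.
  have [net labels bal] := bgood _ bw; split.
    move=> s s1.
    exact: (gd_output_signal gamma01 v1 n_gt0 m_gt0 M2 alpha01 net labels admw
      bal gamma_k k_gt0 k_n s1).
  rewrite /S ler_pdivlMr// mulrC.
  exact: (gd_output_noise_norm gamma01 v1 n_gt0 m_gt0 M2 alpha01 net labels admw
    gamma_k k_gt0).
apply: (@le_trans _ _ (P ([set w | bad (T w, Z w)] `&` Z @^-1` G))).
  apply: measure_le_ae.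
  - by apply: measurableI; [exact: mA|exact: mpre].
  - by apply: measurableI; [exact: mA|exact: mpre].
  - by apply: filterS ZG => w h [h1 h2]; split => //; exact: h.
apply: le_trans (independent_section_le mT mZ indep measurable_bad mG _) _.
  by move=> z [_ h]; exact: section_bad.
apply: lee_wpmul2l; first by rewrite lee_fin mulr_ge0 ?expR_ge0.
by apply: le_measure; rewrite ?inE; [exact: mpre|exact: mpre|move=> w []].
Qed.

End test_error_probability.

(** * Choice of the constants *)

Lemma training_failure_le (R : realType) (d n : nat) (delta : R) :
  0 < delta -> 20 <= n%:R :> R -> 10 * ln (1 / delta) <= n%:R -> (n <= d)%N ->
  2^-1 ^+ (5 * 1 * d) + (4 / 5) ^+ n + (4 / 5) ^+ n <= delta.
Proof.
move=> de0 n20 nde nd.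
have h45 : (4 / 5) ^+ n <= expR (- (n%:R / 5)) :> R.
  have -> : - (n%:R / 5) = - 5^-1 * n%:R :> R by ring.
  rewrite expRM_natr; apply: lerXn2r; rewrite ?nnegrE ?expR_ge0//.
  by apply: le_trans (expR_ge1Dx _); lra.
have h2 : 2^-1 ^+ (5 * 1 * d) <= (4 / 5) ^+ n :> R.
  apply: (@le_trans _ _ (2^-1 ^+ n)); last by apply: lerXn2r; rewrite ?nnegrE; lra.
  by apply: ler_wiXn2l; [lra|lra|rewrite muln1 (leq_trans nd)// leq_pmull].
(* The three failure terms are each at most [exp(-n/5)]. One factor [exp(-n/10)] absorbs the 3,
   thanks to [n >= 20]; the other is at most [delta]. *)
have h3 : 3 * expR (- (n%:R / 10)) <= 1 :> R.
  have e0 := expR_gt0 (n%:R / 10 : R).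
  rewrite expRN -ler_pdivlMr ?invr_gt0// invrK mul1r.
  by apply: le_trans (expR_ge1Dx _); lra.
have h4 : expR (- (n%:R / 10)) <= delta.
  rewrite -[leRHS]lnK ?posrE// ler_expR.
  by move: nde; rewrite div1r lnV ?posrE//; lra.
have h5 : expR (- (n%:R / 5)) = expR (- (n%:R / 10)) * expR (- (n%:R / 10)) :> R.
  by rewrite -expRD; congr expR; field.
have := expR_ge0 (- (n%:R / 10) : R).
move: h45; rewrite h5; move: h2 h3 h4; set e := expR _; set a := _ ^+ n.
set b := _ ^+ _; move=> ? ? ? ? ?.
have : e * (3 * e) <= e * 1 by rewrite ler_wpM2l.
lra.
Qed.

(** With [q = alpha^2 d / k] the exponent is [- q/(288 K)]. Half of it is given up to absorb the
    factor 2, since [q/(576 K) >= 1] and [exp(x) >= 1 + x]. *)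
Lemma test_error_rate (R : realType) (d n k M : nat) (alpha : R) :
  0 < alpha -> (0 < k)%N -> (1 < M)%N -> (8 * n <= d)%N ->
  k%:R * (200 ^+ 2 * M%:R * (1 + 4 * M%:R)) <= alpha ^+ 2 * n%:R ->
  2 * expR (- (d%:R / (8 * (6 * Num.sqrt ((1 + 4 * M%:R) * k%:R) / alpha) ^+ 2)))
    <= expR (- (576 * (1 + 4 * M%:R))^-1 * (alpha ^+ 2 * d%:R / k%:R)).
Proof.
move=> al0 k0 M2 dn hk.
have kR : (0 : R) < k%:R by rewrite ltr0n.
have MR : (2 : R) <= M%:R by rewrite ler_nat.
set K := 1 + 4 * M%:R in hk *.
have K0 : 0 < K by rewrite /K; lra.
set q := alpha ^+ 2 * d%:R / k%:R.
have -> : d%:R / (8 * (6 * Num.sqrt (K * k%:R) / alpha) ^+ 2) = q / (288 * K).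
  rewrite exprMn exprMn exprVn sqr_sqrtr; last by rewrite mulr_ge0// ltW.
  by rewrite /q; field; rewrite !gt_eqF.
have q1 : 1 <= q / (576 * K).
  have K576 : 0 < 576 * K by lra.
  rewrite (ler_pdivlMr _ _ K576) mul1r /q ler_pdivlMr//.
  have h8 : 8 * n%:R <= d%:R :> R by rewrite -natrM ler_nat.
  have h9 : 8 * (alpha ^+ 2 * n%:R) <= alpha ^+ 2 * d%:R.
    by rewrite mulrCA ler_wpM2l// sqr_ge0.
  have h10 : 0 < K * k%:R by rewrite mulr_gt0.
  have h11 : K * k%:R * 2 <= K * k%:R * M%:R by rewrite ler_wpM2l// ltW.
  have E : k%:R * (200 ^+ 2 * M%:R * K) = 200 ^+ 2 * (K * k%:R * M%:R) by ring.
  by rewrite E expr2 in hk; lra.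
have -> : - (576 * K)^-1 * q = q / (576 * K) + - (q / (288 * K)).
  by field; rewrite gt_eqF.
rewrite expRD ler_wpM2r ?expR_ge0//.
by apply: le_trans (expR_ge1Dx _); lra.
Qed.

Theorem corollary3p2p1 (R : realType) :
  exists C C1 C2 c3 C4 : R,
    [/\ 0 < C, 0 < C1, 0 < C2, 0 < c3 & 0 < C4] /\
    forall (d n k m : nat) (gamma delta alpha : R) (v : 'rV[R]_d),
      (0 < d)%N -> (0 < n)%N -> (0 < k)%N -> (0 < m)%N -> (k <= n)%N ->
      0 < gamma < 1 -> 0 < delta < 1 -> 0 < alpha <= 1 -> enorm v = 1 ->
    forall (disp : measure_display) (Om : measurableType disp)
      (P : probability Om R) (y : Om -> 'rV[R]_n) (N : Om -> 'M[R]_(n, d))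
      (B : Om -> {set 'I_n}) (yt : Om -> R) (nt : Om -> 'rV[R]_d),
      data_model P k gamma v y N B yt nt ->
      n%:R >= C1 * ln (1 / delta) ->
      d%:R >= C2 * n%:R ->
      k%:R <= c3 * alpha ^+ 2 * n%:R ->
      gamma >= C4 / k%:R ->
      let train := training_data gamma v y N B in
      let X := fun w => (train w).1 in
      let yh := fun w => (train w).2 in
      let x := fun w => data_point gamma v (yt w) (nt w) in
      {ae P, forall w, forall (eta lam : R) (W0 : 'M[R]_(m.*2, d)),
         gd_admissible alpha (X w) eta lam W0 ->
         gd_terminates alpha eta (X w) (yh w) W0 /\
         hinge_loss alpha (gd_output alpha eta (X w) (yh w) W0) (X w) (yh w)
           = 0} /\
      (* The event E of probability at least 1 - delta is the same for all    *)
      (* step sizes and initializations; these may themselves be random, but  *)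
      (* together with the training data are independent of the test point.   *)
      exists E : set Om,
        [/\ sigma_of train E,
            (P E >= (1 - delta)%:E)%E &
            forall (eta lam : Om -> R) (W0 : Om -> 'M[R]_(m.*2, d)),
              measurable_fun [set: Om] eta -> measurable_fun [set: Om] lam ->
              measurable_fun [set: Om] W0 ->
              {ae P, forall w,
                 gd_admissible alpha (X w) (eta w) (lam w) (W0 w)} ->
              independent P (sigma_of (fun w => (yt w, nt w)))
                (sigma_of (fun w => (train w, (eta w, lam w, W0 w)))) ->
            let W := fun w => gd_output alpha (eta w) (X w) (yh w) (W0 w) in
            forall g : Om -> R,
              is_cond_prob P (sigma_of train)
                [set w | yt w * network alpha (W w) (x w) <= 0] g ->
              {ae P, forall w, E w ->
                 g w <= expR (- C * (alpha ^+ 2 * d%:R / k%:R))}].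
Proof.
(* [M] is kept as a variable: the unary numeral must never be evaluated. *)
have [M ME] : exists M, M = (2 ^ (16 * 1) * 2 ^ (16 * 1))%N by eexists.
have M2 : (1 < M)%N by rewrite ME -expnD -[X in (X < _)%N](expn0 2) ltn_exp2l.
have MR : (2 : R) <= M%:R by rewrite ler_nat.
pose K : R := 1 + 4 * M%:R; have K0 : 0 < K by rewrite /K; lra.
have K1 : 1 <= K by rewrite /K; lra.
have c20 : 20 <= 200 ^+ 2 * M%:R * K.
  have c200 : 20 <= 200 ^+ 2 :> R by rewrite expr2; lra.
  move: (200 ^+ 2) c200 => c c200; have : 20 * 1 <= c * M%:R by apply: ler_pM; lra.
  rewrite mulr1 => h; have : 20 * 1 <= c * M%:R * K by apply: ler_pM; lra.
  lra.
have c0 : 0 < 200 ^+ 2 * M%:R * K by exact: lt_le_trans c20.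
have K576 : 0 < 576 * K by lra.
(* In order: the rate left after absorbing the factor 2; the rate [1/10] in the training failure;
   the ratio [d/n] that pays for the net; the weakness of the noise against the clean points; and
   [1/gamma <= k]. *)
exists (576 * K)^-1, 10, 8, (200 ^+ 2 * M%:R * K)^-1, 1; split.
  by rewrite (invr_gt0 (576 * K)) (invr_gt0 (_ * K)); split.
move=> d n k m gamma delta alpha v d0 n0 k0 m0 kn gamma01 delta01 alpha01 v1.
move=> disp Om P y N B yt nt model nde dnR knR gk train X yh x.
have vv : dotp v v = 1 by rewrite -enorm_sqr v1 expr1n.
have al0 : 0 < alpha by case/andP: alpha01.
have al1 : alpha <= 1 by case/andP: alpha01.
have kR : (1 : R) <= k%:R by rewrite ler1n.
have dn : (8 * n <= d)%N by rewrite -(ler_nat R) natrM.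
have hk : k%:R * (200 ^+ 2 * M%:R * (1 + 4 * M%:R)) <= alpha ^+ 2 * n%:R.
  by rewrite -/K -ler_pdivlMr// mulrC mulrA.
have gk' : k%:R^-1 <= gamma by move: gk; rewrite div1r.
(* For [delta] near 1 the logarithmic condition says little about [n]; the bound comes from
   [k >= 1], which with [alpha <= 1] gives [n >= 200^2 M K]. *)
have n20 : 20 <= n%:R :> R.
  have h1 : alpha ^+ 2 * n%:R <= n%:R by rewrite ler_piMl// expr_le1// ltW.
  move: hk h1 c20 c0; rewrite -/K.
  move: (200 ^+ 2 * M%:R * K) => c ? ? ? c0.
  have h2 : 1 * c <= k%:R * c by rewrite ler_wpM2r// ltW.
  lra.
split.
  have hN := ae_net_good model vv n0 dn.
  have hy := ae_labels_sign (dm_y_unif model).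
  have hv := ae_noise_orthogonal model vv.
  near=> w => eta lam W0 adm.
  have [r net] : exists r, net_good (2 ^ (16 * r.+1) * 2 ^ (16 * r.+1)) (N w) by near: w.
  have [EN Ey] : noise_part gamma v (X w) = N w /\ label_part gamma v (X w) = y w.
    by apply: parts_data_matrix => //; near: w.
  have Mr : (1 < 2 ^ (16 * r.+1) * 2 ^ (16 * r.+1))%N.
    by rewrite -expnD -[X in (X < _)%N](expn0 2) ltn_exp2l// mulnS.
  apply: (gd_interpolates gamma01 vv n0 m0 Mr alpha01 (k := k) _ _ adm).
    by rewrite EN.
  rewrite Ey -(dm_B_card model w); apply: labels_ok_flip; by near: w.
pose E := train @^-1` [set z | good_data gamma v k M z].
have mE0 := @measurable_good_data R n d gamma v k M.
exists E; split.
- by exists [set z | good_data gamma v k M z] => //; rewrite setTI.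
- apply: le_trans (good_data_probability model gamma01 vv n0 dn (ltn0Sn 0) ME).
  rewrite lee_fin lerD2l lerN2; apply: training_failure_le => //.
    by case/andP: delta01.
  by rewrite (leq_trans _ dn)// leq_pmull.
move=> eta lam W0 meta mlam mW0 adm indep W g gP.
have mtrain := measurable_training_data model.
apply: (cond_prob_le mtrain gP).
  by exists [set z | good_data gamma v k M z] => //; rewrite setTI.
move=> C [b mb <-] bE; rewrite setTI in bE *.
(* [b] itself may contain bad data outside the range of the training map on this event; its preimage
   lies in [E], so the intersection has the same preimage. *)
pose b' := b `&` [set z | good_data gamma v k M z].
have -> : train @^-1` b = train @^-1` b'.
  by apply/seteqP; split => w /=; [move=> bw; split => //; exact: bE|case].
have mb' : measurable b' by exact: measurableI.
apply: le_trans (test_error_probability model gamma01 vv n0 dn k0 m0 alpha01 gk' M2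
  hk meta mlam mW0 adm indep mb' _) _.
  by move=> z [].
apply: lee_wpmul2r; first exact: measure_ge0.
by rewrite lee_fin; exact: test_error_rate al0 k0 M2 dn hk.
Unshelve. all: by end_near. Qed.
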